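(* Let $\omega$ be the $\mathrm{Der}\,\mathfrak p$-valued 1-form on $\mathbb C\times\mathfrak h$ defining the universal elliptic KZB connection. The 2-form $[\omega,\omega]$ vanishes, so that $\omega$ is integrable, i.e. $d\omega+\frac12[\omega,\omega]=0$.
   Context: $\mathfrak h$ is the upper half plane and $e(u):=\exp(2\pi iu)$. $\mathfrak p=\mathbb L(\mathbf t,\mathbf a)^\wedge$ is the completed free complex Lie algebra on $\mathbf t,\mathbf a$. A power series $f(\mathbf t,\mathbf a)$ acts on $x\in\mathfrak p$ by $f\cdot x:=f(\mathrm{ad}_{\mathbf t},\mathrm{ad}_{\mathbf a})(x)$. Elements of $\mathfrak p$ are regarded as derivations of $\mathfrak p$ via $\mathrm{ad}$. For $u\in\mathfrak p$, $u\,\partial/\partial\mathbf t$ is the continuous derivation $\mathbf t\mapsto u,\ \mathbf a\mapsto0$; similarly $u\,\partial/\partial\mathbf a$. $G_{2k}(\tau)=-\frac{B_{2k}}{4k}+\sum_{n\ge1}\sigma_{2k-1}(n)q^n$, $q=e(\tau)$, with $B_j$ the Bernoulli numbers ($\frac{x}{e^x-1}=\sum B_nx^n/n!$). With $\theta(u,\tau)=\sum_{n\in\mathbb Z}(-1)^nq^{\frac12(n+\frac12)^2}e^{(n+\frac12)u}$ and $\theta'$ its derivative in $u$, $$F(\xi,\eta,\tau)=2\pi i\,\frac{\theta'(0,\tau)\,\theta(2\pi i(\xi+\eta),\tau)}{\theta(2\pi i\xi,\tau)\,\theta(2\pi i\eta,\tau)}.$$ The connection is $\nabla f=df+\omega f$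 (meromorphic on $\mathbb C\times\mathfrak h$, with poles along $\xi\in\mathbb Z+\mathbb Z\tau$), where $\omega=\frac1{2\pi i}d\tau\otimes\mathbf a\frac{\partial}{\partial\mathbf t}+\psi+\nu$, $$\psi=\sum_{m\ge1}\frac{(2\pi i)^{2m+1}}{(2m)!}G_{2m+2}(\tau)d\tau\otimes\sum_{j+k=2m+1,\ j,k>0}(-1)^j[\mathrm{ad}_{\mathbf t}^j(\mathbf a),\mathrm{ad}_{\mathbf t}^k(\mathbf a)]\frac{\partial}{\partial\mathbf a},$$ $$\nu=\mathbf tF(\xi,\mathbf t,\tau)\cdot\mathbf a\,d\xi+\frac1{2\pi i}\Big(\frac1{\mathbf t}+\mathbf t\frac{\partial F}{\partial\mathbf t}(\xi,\mathbf t,\tau)\Big)\cdot\mathbf a\,d\tau.$$ The bracket $[\omega,\omega]$ combines wedge product of forms with the Lie bracket of $\mathrm{Der}\,\mathfrak p$. *)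

(* Defs.v *)
From HB Require Import structures.
From mathcomp Require Import all_boot all_order all_algebra.
From mathcomp Require Import all_classical all_reals all_analysis.
From mathcomp Require Import complex ring zify.

Set Implicit Arguments.
Unset Strict Implicit.
Unset Printing Implicit Defensive.

Import Order.TTheory GRing.Theory Num.Theory numFieldNormedType.Exports.

Local Open Scope classical_set_scope.
Local Open Scope ring_scope.

(* The free Lie algebra is realised, as usual, as the Lie subalgebra generated
   by the letters of the free associative algebra K<t,a>, and its completion
   as the set of the elements of K<<t,a>> all of whose homogeneous components
   are Lie polynomials.  A series is its family of coefficients; a word is a
   sequence of letters, where the letter t is true and the letter a is false. *)

Definition ncseries (K : fieldType) := seq bool -> K^o.

HB.instance Definition _ (K : fieldType) := GRing.Lmodule.on (ncseries K).

Section FreeLie.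
Variable K : fieldType.
Implicit Types (f g h u v : ncseries K) (w : seq bool) (b : bool).

Definition nc_letter b : ncseries K := fun w => (w == [:: b])%:R.

Definition nc_mul f g : ncseries K :=
  fun w => \sum_(i < (size w).+1) f (take i w) * g (drop i w).

Definition nc_comm f g : ncseries K := nc_mul f g - nc_mul g f.

Definition homog n f : ncseries K := fun w => if size w == n then f w else 0.

Inductive lie_poly : ncseries K -> Prop :=
| lie_poly_letter b : lie_poly (nc_letter b)
| lie_poly_lin (c : K) f g :
    lie_poly f -> lie_poly g -> lie_poly (c *: f + g)
| lie_poly_comm f g : lie_poly f -> lie_poly g -> lie_poly (nc_comm f g).

Definition lie_series : {pred ncseries K} :=
  [pred f | `[< forall n, lie_poly (homog n f) >]].

Lemma lie_seriesP f :
  reflect (forall n, lie_poly (homog n f)) (f \in lie_series).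
Proof. exact: asboolP. Qed.

Lemma lie_poly0 : lie_poly 0.
Proof.
have := lie_poly_lin (-1) (lie_poly_letter true) (lie_poly_letter true).
by rewrite scaleN1r addNr.
Qed.

Lemma lie_polyD f g : lie_poly f -> lie_poly g -> lie_poly (f + g).
Proof. by move=> lf lg; rewrite -[f]scale1r; apply: lie_poly_lin. Qed.

Lemma lie_polyZ (c : K) f : lie_poly f -> lie_poly (c *: f).
Proof.
by move=> lf; rewrite -[_ *: _]addr0; apply: lie_poly_lin => //; exact: lie_poly0.
Qed.

Lemma lie_poly_sum (I : Type) (r : seq I) (P : pred I) (F : I -> ncseries K) :
  (forall i, P i -> lie_poly (F i)) -> lie_poly (\sum_(i <- r | P i) F i).
Proof.
by move=> lF; elim/big_ind: _ => //; [exact: lie_poly0|exact: lie_polyD].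
Qed.

Lemma homogP n (c : K) f g : homog n (c *: f + g) = c *: homog n f + homog n g.
Proof.
apply/funext => w; rewrite /homog !fctE.
by case: ifP => // _; rewrite scaler0 addr0.
Qed.

Lemma lie_series_submod : GRing.submod_closed lie_series.
Proof.
split=> [|c f g /lie_seriesP lf /lie_seriesP lg]; apply/lie_seriesP => n.
  suff -> : homog n 0 = 0 by exact: lie_poly0.
  by apply/funext => w; rewrite /homog; case: ifP.
by rewrite homogP; apply: lie_poly_lin.
Qed.

HB.instance Definition _ :=
  GRing.isSubmodClosed.Build K (ncseries K) lie_series lie_series_submod.

Record liealg := LieAlg { lie_val :> ncseries K; _ : lie_val \in lie_series }.

HB.instance Definition _ := [isSub for lie_val].
HB.instance Definition _ := [Choice of liealg by <:].
HB.instance Definition _ := [SubChoice_isSubLmodule of liealg by <:].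


Lemma liealg_inj (x y : liealg) : lie_val x = lie_val y -> x = y.
Proof. exact: val_inj. Qed.

Lemma lie_valP (x : liealg) n : lie_poly (homog n x).
Proof. exact: (lie_seriesP _ (valP x)). Qed.

Lemma lie_valZD (c : K) (x y : liealg) :
  lie_val (c *: x + y) = c *: lie_val x + lie_val y.
Proof. by []. Qed.

Definition nc_shift b f : ncseries K := fun w => f (b :: w).

Lemma nc_mul_nil f g : nc_mul f g [::] = f [::] * g [::].
Proof. by rewrite /nc_mul /= big_ord1. Qed.

Lemma nc_mul_cons f g b w :
  nc_mul f g (b :: w) = f [::] * g (b :: w) + nc_mul (nc_shift b f) g w.
Proof. by rewrite /nc_mul /= big_ord_recl. Qed.

Lemma nc_mul_linl (c : K) f g h :
  nc_mul (c *: f + g) h = c *: nc_mul f h + nc_mul g h.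
Proof.
apply/funext => w; rewrite /nc_mul !fctE scaler_sumr -big_split /=.
by apply: eq_bigr => i _; rewrite mulrDl -mulrA.
Qed.

Lemma nc_mul_linr (c : K) f g h :
  nc_mul f (c *: g + h) = c *: nc_mul f g + nc_mul f h.
Proof.
apply/funext => w; rewrite /nc_mul !fctE scaler_sumr -big_split /=.
by apply: eq_bigr => i _; rewrite mulrDr scalerAr.
Qed.

Lemma nc_mulBl f g h : nc_mul (f - g) h = nc_mul f h - nc_mul g h.
Proof. by rewrite addrC -scaleN1r nc_mul_linl scaleN1r addrC. Qed.

Lemma nc_mulBr f g h : nc_mul f (g - h) = nc_mul f g - nc_mul f h.
Proof. by rewrite addrC -scaleN1r nc_mul_linr scaleN1r addrC. Qed.

Lemma nc_mulDl f g h : nc_mul (f + g) h = nc_mul f h + nc_mul g h.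
Proof. by have := nc_mul_linl 1 f g h; rewrite !scale1r. Qed.

Lemma nc_mulDr f g h : nc_mul f (g + h) = nc_mul f g + nc_mul f h.
Proof. by have := nc_mul_linr 1 f g h; rewrite !scale1r. Qed.

Lemma nc_shift_mul b f g :
  nc_shift b (nc_mul f g) = f [::] *: nc_shift b g + nc_mul (nc_shift b f) g.
Proof. by apply/funext => w; rewrite /nc_shift nc_mul_cons !fctE. Qed.

Lemma nc_mulA f g h : nc_mul f (nc_mul g h) = nc_mul (nc_mul f g) h.
Proof.
apply/funext => w; elim: w f g h => [|b w IHw] f g h.
  by rewrite !nc_mul_nil mulrA.
rewrite !nc_mul_cons nc_shift_mul nc_mul_linl !fctE nc_mul_nil IHw.
by rewrite mulrDr mulrA -addrA.
Qed.

Lemma homog_mul n f g :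
  homog n (nc_mul f g) =
  \sum_(i < n.+1) nc_mul (homog i f) (homog (n - i)%N g).
Proof.
apply/funext => w; rewrite fct_sumE /homog.
case: eqP => [wn|wn]; last first.
  rewrite big1 // => i _; rewrite /nc_mul big1 // => k _.
  case: eqP => [tk|_]; last by rewrite mul0r.
  case: eqP => [dk|_]; last by rewrite mulr0.
  have := size_cat (take k w) (drop k w); rewrite cat_take_drop tk dk => ws.
  by case: wn; rewrite ws; apply: subnKC; rewrite -ltnS.
rewrite -{}wn /nc_mul exchange_big /=.
apply: eq_bigr => k _; have kw : (k <= size w)%N by rewrite -ltnS.
rewrite (bigD1 (inord k)) //= inordK // size_takel // eqxx size_drop eqxx.
rewrite big1 ?addr0 // => i ik.
rewrite ifF ?mul0r //; apply: contraNF ik => /eqP ki.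
by apply/eqP/val_inj; rewrite /= inordK // -ki.
Qed.

Lemma homog_comm n f g :
  homog n (nc_comm f g) =
  \sum_(i < n.+1) nc_comm (homog i f) (homog (n - i)%N g).
Proof.
rewrite /nc_comm sumrB -homog_mul (reindex_inj rev_ord_inj) /=.
under eq_bigr => i _ do rewrite subSS subKn -1?ltnS //.
rewrite -homog_mul; apply/funext => w; rewrite /homog !fctE.
by case: ifP => // _; rewrite oppr0 addr0.
Qed.

Lemma nc_comm_lie f g :
  f \in lie_series -> g \in lie_series -> nc_comm f g \in lie_series.
Proof.
move=> /lie_seriesP lf /lie_seriesP lg; apply/lie_seriesP => n.
by rewrite homog_comm; apply: lie_poly_sum => i _; apply: lie_poly_comm.
Qed.

Lemma homog_letter n b : homog n (nc_letter b) = (n == 1)%:R *: nc_letter b.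
Proof.
apply/funext => w; rewrite /homog /nc_letter !fctE /=.
case: (w =P [:: b]) => [->/=|_]; last by rewrite if_same scaler0.
by rewrite eq_sym; case: eqP; rewrite ?scale1r ?scale0r.
Qed.

Lemma nc_letter_lie b : nc_letter b \in lie_series.
Proof.
apply/lie_seriesP => n; rewrite homog_letter.
by apply: lie_polyZ; apply: lie_poly_letter.
Qed.

Definition gen_t : liealg := LieAlg (nc_letter_lie true).
Definition gen_a : liealg := LieAlg (nc_letter_lie false).

Definition lie_br (x y : liealg) : liealg :=
  LieAlg (nc_comm_lie (valP x) (valP y)).

Lemma lie_val_br (x y : liealg) : lie_val (lie_br x y) = nc_comm x y.
Proof. by []. Qed.

(* x has order at least n: its components of degree < n vanish. *)
Definition order_ge n f := forall w, (size w < n)%N -> f w = 0.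

(* The sum of a series of elements x_0, x_1, ... such that x_m has order at
   least m: only the x_m with m <= size w contribute to the coefficient of w. *)
Definition nc_sum (F : nat -> ncseries K) : ncseries K :=
  fun w => \sum_(m < (size w).+1) F m w.

Lemma nc_sum_lie (F : nat -> liealg) :
  nc_sum (fun m => F m) \in lie_series.
Proof.
apply/lie_seriesP => n.
suff -> : homog n (nc_sum (fun m => F m)) = \sum_(m < n.+1) homog n (F m).
  by apply: lie_poly_sum => i _; apply: lie_valP.
apply/funext => w; rewrite fct_sumE /homog /nc_sum.
by case: eqP => [->//|_]; rewrite big1.
Qed.

Definition lie_sum (F : nat -> liealg) : liealg := LieAlg (nc_sum_lie F).

(* The action f . x = f(ad_t)(x) of a power series f = \sum_n (c n) t^n. *)
Definition ps_act (c : nat -> K) (x : liealg) : liealg :=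
  lie_sum (fun n => c n *: iter n (lie_br gen_t) x).

(* No continuity is required: every derivation of p is continuous, since the
   elements of order at least n form the n-th term of its lower central
   series. *)
Definition is_derivation : {pred liealg -> liealg} :=
  [pred D | `[< (forall (c : K) x y, D (c *: x + y) = c *: D x + D y) /\
               (forall x y, D (lie_br x y) =
                            lie_br (D x) y + lie_br x (D y)) >]].

Lemma lie_br_linl (c : K) (x y z : liealg) :
  lie_br (c *: x + y) z = c *: lie_br x z + lie_br y z.
Proof.
apply/liealg_inj; rewrite [RHS]lie_valZD !lie_val_br /nc_comm lie_valZD.
rewrite nc_mul_linl nc_mul_linr scalerBr.
by rewrite opprD addrACA.
Qed.

Lemma lie_br_linr (c : K) (x y z : liealg) :
  lie_br z (c *: x + y) = c *: lie_br z x + lie_br z y.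
Proof.
apply/liealg_inj; rewrite [RHS]lie_valZD !lie_val_br /nc_comm lie_valZD.
rewrite nc_mul_linl nc_mul_linr scalerBr.
by rewrite opprD addrACA.
Qed.

Lemma lie_br0l (z : liealg) : lie_br 0 z = 0.
Proof.
by have := lie_br_linl (-1) 0 0 z; rewrite scaler0 addr0 scaleN1r addNr.
Qed.

Lemma lie_br0r (z : liealg) : lie_br z 0 = 0.
Proof.
by have := lie_br_linr (-1) 0 0 z; rewrite scaler0 addr0 scaleN1r addNr.
Qed.

Lemma lie_brDl (x y z : liealg) : lie_br (x + y) z = lie_br x z + lie_br y z.
Proof. by have := lie_br_linl 1 x y z; rewrite !scale1r. Qed.

Lemma lie_brDr (x y z : liealg) : lie_br z (x + y) = lie_br z x + lie_br z y.
Proof. by have := lie_br_linr 1 x y z; rewrite !scale1r. Qed.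

Lemma lie_brNl (x z : liealg) : lie_br (- x) z = - lie_br x z.
Proof. by have := lie_br_linl (-1) x 0 z; rewrite !scaleN1r lie_br0l !addr0. Qed.

Lemma lie_brNr (x z : liealg) : lie_br z (- x) = - lie_br z x.
Proof. by have := lie_br_linr (-1) x 0 z; rewrite !scaleN1r lie_br0r !addr0. Qed.

Lemma lie_br_jacobi (x y z : liealg) :
  lie_br x (lie_br y z) = lie_br (lie_br x y) z + lie_br y (lie_br x z).
Proof.
apply/liealg_inj; rewrite -[lie_br (lie_br x y) z]scale1r lie_valZD scale1r.
rewrite !lie_val_br /nc_comm !(nc_mulBl, nc_mulBr) !nc_mulA.
apply/funext => w; rewrite !fctE; ring.
Qed.


Lemma is_derivationP (D : liealg -> liealg) :
  reflect ((forall (c : K) x y, D (c *: x + y) = c *: D x + D y) /\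
           (forall x y, D (lie_br x y) = lie_br (D x) y + lie_br x (D y)))
          (D \in is_derivation).
Proof. exact: asboolP. Qed.

Lemma is_derivation_submod : GRing.submod_closed is_derivation.
Proof.
split=> [|k D E /is_derivationP[Dl DL] /is_derivationP[El EL]].
  apply/is_derivationP; split=> [c x y|x y].
    by rewrite -[LHS]/0 -[RHS]/(c *: 0 + 0) scaler0 addr0.
  by rewrite -[RHS]/(lie_br 0 y + lie_br x 0) lie_br0l lie_br0r addr0.
apply/is_derivationP; split=> [c x y|x y]; rewrite !fctE.
  by rewrite Dl El !scalerDr !scalerA [k * c]mulrC addrACA.
rewrite DL EL lie_br_linl lie_br_linr scalerDr.
by rewrite addrACA.
Qed.

HB.instance Definition _ :=
  GRing.isSubmodClosed.Build K (liealg -> liealg) is_derivation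
    is_derivation_submod.

Record der := Der { der_fun :> liealg -> liealg; _ : der_fun \in is_derivation }.

HB.instance Definition _ := [isSub for der_fun].
HB.instance Definition _ := [Choice of der by <:].
HB.instance Definition _ := [SubChoice_isSubLmodule of der by <:].

Lemma der_lin (D : der) (c : K) x y : D (c *: x + y) = c *: D x + D y.
Proof. by have /is_derivationP[] := valP D. Qed.

Lemma der_leibniz (D : der) x y :
  D (lie_br x y) = lie_br (D x) y + lie_br x (D y).
Proof. by have /is_derivationP[] := valP D. Qed.

Lemma derD (D : der) x y : D (x + y) = D x + D y.
Proof. by have := der_lin D 1 x y; rewrite !scale1r. Qed.

Lemma der_br_subproof (D E : der) :
  (fun x => D (E x) - E (D x)) \in is_derivation.
Proof.
apply/is_derivationP; split=> [c x y|x y].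
  by rewrite !der_lin scalerBr opprD addrACA.
rewrite !der_leibniz !derD !der_leibniz lie_brDl lie_brDr.
rewrite lie_brNl lie_brNr [X in X - _](AC (2*2) ((1*4)*(2*3))) /=.
rewrite [X in _ - X](AC (2*2) ((1*4)*(3*2))) /=.
by rewrite opprD [LHS]addrACA subrr addr0 opprD [LHS]addrACA.
Qed.

Definition der_br (D E : der) : der := Der (der_br_subproof D E).

Lemma ad_subproof (x : liealg) : lie_br x \in is_derivation.
Proof.
apply/is_derivationP; split=> [c y z|y z]; first exact: lie_br_linr.
exact: lie_br_jacobi.
Qed.

Definition ad (x : liealg) : der := Der (ad_subproof x).

(* The continuous derivation of K<<t,a>> which maps the letter b to u and the
   other letter to 0.  Writing f = f(1) + \sum_c c f_c, where f_c is the
   series (nc_shift c f), the product rule reads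
   D f = u f_b + \sum_c c (D f_c). *)
Fixpoint nc_der b u f w {struct w} : K^o :=
  nc_mul u (nc_shift b f) w +
  if w is c :: w' then nc_der b u (nc_shift c f) w' else 0.

Lemma nc_der_lin b u (c : K) f g :
  nc_der b u (c *: f + g) = c *: nc_der b u f + nc_der b u g.
Proof.
apply/funext => w; rewrite !fctE; elim: w f g => [|x w IHw] f g /=.
  by rewrite !addr0 -[nc_shift _ _]/(c *: nc_shift b f + nc_shift b g) nc_mul_linr.
rewrite -[nc_shift b _]/(c *: nc_shift b f + nc_shift b g) nc_mul_linr.
rewrite -[nc_shift x _]/(c *: nc_shift x f + nc_shift x g) IHw !fctE.
by rewrite scalerDr addrACA.
Qed.

Lemma nc_der_mul b u f g :
  nc_der b u (nc_mul f g) = nc_mul (nc_der b u f) g + nc_mul f (nc_der b u g).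
Proof.
have regZ (c : K) (k : K^o) : c *: k = (c : K^o) * k by [].
have dcons h x : nc_shift x (nc_der b u h) =
    nc_shift x (nc_mul u (nc_shift b h)) + nc_der b u (nc_shift x h) by [].
apply/funext => w; rewrite !fctE; elim: w f g => [|x w IHw] f g.
  rewrite /= !addr0 nc_shift_mul !nc_mul_nil /= !fctE !nc_mul_nil !addr0.
  by rewrite regZ; ring.
rewrite /= !nc_shift_mul nc_mul_linr nc_der_lin !fctE IHw.
rewrite nc_mulA !nc_mul_cons dcons.
rewrite nc_mulDl !fctE /= nc_mul_nil addr0 !regZ -/(nc_der b u).
rewrite /= nc_mul_cons. ring.
Qed.

Lemma nc_derB b u f g : nc_der b u (f - g) = nc_der b u f - nc_der b u g.
Proof. by rewrite addrC -scaleN1r nc_der_lin scaleN1r addrC. Qed.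

Lemma nc_der_comm b u f g :
  nc_der b u (nc_comm f g) =
  nc_comm (nc_der b u f) g + nc_comm f (nc_der b u g).
Proof.
rewrite /nc_comm nc_derB !nc_der_mul [X in _ - X]addrC opprD.
by rewrite [LHS]addrACA.
Qed.

Lemma nc_der_letter b u c :
  nc_der b u (nc_letter c) = if c == b then u else 0.
Proof.
pose one : ncseries K := fun w => (w == [::])%:R.
have shift_letter x : nc_shift x (nc_letter c) = (x == c)%:R *: one + 0.
  rewrite addr0; apply/funext => w; rewrite /nc_shift /nc_letter eqseq_cons.
  rewrite !fctE /one; case: (x == c); first by rewrite scale1r.
  by rewrite scale0r.
have mul0 : nc_mul u 0 = 0.
  by apply/funext => w; rewrite /nc_mul big1 // => i _; exact: mulr0.
have mul1 : nc_mul u one = u.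
  apply/funext => w; rewrite /nc_mul big_ord_recr /= take_size drop_size.
  rewrite /one eqxx mulr1 big1 ?add0r // => i _.
  by rewrite -size_eq0 size_drop subn_eq0 leqNgt ltn_ord mulr0.
have d0 : nc_der b u 0 = 0.
  by have := nc_der_lin b u (-1) 0 0; rewrite scaler0 addr0 scaleN1r addNr.
have d1 w : nc_der b u one w = 0.
  have s1 x : nc_shift x one = 0 by [].
  by case: w => [|x w] /=; rewrite !s1 mul0 ?d0 addr0.
apply/funext => w; have -> : nc_der b u (nc_letter c) w =
    nc_mul u (nc_shift b (nc_letter c)) w.
  case: w => [|x w]; first by rewrite /= addr0.
  by rewrite /= (shift_letter x) nc_der_lin d0 addr0 !fctE d1 scaler0 addr0.
rewrite shift_letter nc_mul_linr mul0 mul1 addr0 eq_sym.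
by case: ifP => _; rewrite ?scale1r ?scale0r.
Qed.

Lemma nc_der_trunc b u f g w : u [::] = 0 ->
  (forall p : seq bool, (size p <= size w)%N -> f p = g p) ->
  nc_der b u f w = nc_der b u g w.
Proof.
move=> u0; elim: w f g => [|c w IHw] f g fg.
  by rewrite /= !nc_mul_nil u0 !mul0r.
rewrite /= (IHw (nc_shift c f) (nc_shift c g)) => [|v vw]; last exact: fg.
congr (_ + _); apply: eq_bigr => -[[|i] iw] _.
  by rewrite take0 u0 !mul0r.
congr (_ * _); apply: fg; rewrite /= size_drop.
by rewrite ltnS leq_subr.
Qed.

Lemma lie_series_nil f : f \in lie_series -> f [::] = 0.
Proof.
move=> /lie_seriesP/(_ 0); set h := homog 0 f => lh.
have -> : f [::] = h [::] by [].
elim: lh => [c|c g1 g2 _ g10 _ g20|g1 g2 _ g10 _ g20].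
- by [].
- by rewrite !fctE g10 g20 scaler0 addr0.
- by rewrite /nc_comm !fctE !nc_mul_nil g10 g20 !mul0r subr0.
Qed.

Lemma lie_poly_series f : lie_poly f -> f \in lie_series.
Proof.
elim=> [b|c g h _ lg _ lh|g h _ lg _ lh].
- exact: nc_letter_lie.
- by have [_] := lie_series_submod; apply.
- exact: nc_comm_lie.
Qed.

Lemma nc_der_lie b (u x : liealg) : nc_der b u x \in lie_series.
Proof.
have u0 := lie_series_nil (valP u).
have dpoly f : lie_poly f -> nc_der b u f \in lie_series.
  elim=> [c|c g h _ lg _ lh|g h pg lg ph lh].
  - rewrite nc_der_letter; case: ifP => _; first exact: valP.
    exact/lie_poly_series/lie_poly0.
  - by rewrite nc_der_lin; have [_] := lie_series_submod; apply.
  - rewrite nc_der_comm; have [_ lin] := lie_series_submod.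
    rewrite -[nc_comm _ h]scale1r; apply: lin.
      by apply: nc_comm_lie => //; exact: lie_poly_series.
    by apply: nc_comm_lie => //; exact: lie_poly_series.
apply/lie_seriesP => n.
pose xn : ncseries K := \sum_(m < n.+1) homog m x.
have xnE p : (size p <= n)%N -> (x : ncseries K) p = xn p.
  move=> pn; rewrite /xn fct_sumE (bigD1 (Ordinal (pn : (size p < n.+1)%N))) //=.
  rewrite /homog eqxx big1 ?addr0 // => i ip; case: ifP => // /eqP pi.
  by case/eqP: ip; apply: val_inj.
have -> : homog n (nc_der b u x) = homog n (nc_der b u xn).
  apply/funext => w; rewrite /homog; case: eqP => // wn.
  by apply: nc_der_trunc => // p; rewrite wn; exact: xnE.
apply/(lie_seriesP (nc_der b u xn))/dpoly.
by apply: lie_poly_sum => i _; apply: lie_valP.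
Qed.

Definition lie_der b (u x : liealg) : liealg := LieAlg (nc_der_lie b u x).

Lemma lie_der_subproof b (u : liealg) : lie_der b u \in is_derivation.
Proof.
apply/is_derivationP; split=> [c x y|x y]; apply/liealg_inj.
  exact: nc_der_lin.
exact: nc_der_comm.
Qed.

(* u d/dt and u d/da *)
Definition der_t (u : liealg) : der := Der (lie_der_subproof true u).
Definition der_a (u : liealg) : der := Der (lie_der_subproof false u).

Lemma der_t_t (u : liealg) : der_t u gen_t = u.
Proof. by apply/liealg_inj; rewrite /= nc_der_letter. Qed.

Lemma der_t_a (u : liealg) : der_t u gen_a = 0.
Proof. by apply/liealg_inj; rewrite /= nc_der_letter. Qed.

Lemma der_a_t (u : liealg) : der_a u gen_t = 0.
Proof. by apply/liealg_inj; rewrite /= nc_der_letter. Qed.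

Lemma der_a_a (u : liealg) : der_a u gen_a = u.
Proof. by apply/liealg_inj; rewrite /= nc_der_letter. Qed.

(* The sum of a series of derivations D_0, D_1, ... whose orders tend to
   infinity, in the sense that the values of D_m have order at least m. *)
Definition der_summable (D : nat -> der) := forall m x, order_ge m (D m x).

Lemma nc_sum_widen (F : nat -> ncseries K) n w :
  (forall m, order_ge m (F m)) -> (size w < n)%N ->
  nc_sum F w = \sum_(m < n) F m w.
Proof.
move=> FS wn; rewrite /nc_sum -!(big_mkord xpredT (fun m => F m w)).
rewrite [RHS](big_cat_nat (n := (size w).+1)) //= [X in _ + X]big_nat_cond.
by rewrite [X in _ + X]big1 ?addr0 // => m /andP[/andP[mw _] _]; exact: FS.
Qed.

Lemma nc_sum_mull (F : nat -> ncseries K) g w :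
  (forall m, order_ge m (F m)) ->
  nc_mul (nc_sum F) g w = nc_sum (fun m => nc_mul (F m) g) w.
Proof.
move=> FS; rewrite /nc_sum /nc_mul exchange_big; apply: eq_bigr => i _.
rewrite -mulr_suml; congr (_ * _); apply: nc_sum_widen => //.
by rewrite ltnS size_take; case: ifP => // /ltnW.
Qed.

Lemma nc_sum_mulr (F : nat -> ncseries K) g w :
  (forall m, order_ge m (F m)) ->
  nc_mul g (nc_sum F) w = nc_sum (fun m => nc_mul g (F m)) w.
Proof.
move=> FS; rewrite /nc_sum /nc_mul exchange_big; apply: eq_bigr => i _.
rewrite -mulr_sumr; congr (_ * _); apply: nc_sum_widen => //.
by rewrite ltnS size_drop leq_subr.
Qed.

Lemma der_sum_subproof (D : nat -> der) : der_summable D ->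
  (fun x => lie_sum (fun m => D m x)) \in is_derivation.
Proof.
move=> DS; apply/is_derivationP; split=> [c x y|x y].
  apply/liealg_inj/funext => w; rewrite lie_valZD !fctE /= /nc_sum.
  rewrite scaler_sumr -big_split /=; apply: eq_bigr => m _.
  by rewrite der_lin lie_valZD !fctE.
apply/liealg_inj/funext => w.
rewrite -[lie_br (lie_sum _) y]scale1r lie_valZD scale1r !lie_val_br /nc_comm.
rewrite !fctE nc_sum_mull 1?nc_sum_mulr 1?nc_sum_mull 1?nc_sum_mulr;
  try by move=> m; exact: DS.
rewrite /= /nc_sum -!sumrB -big_split /=; apply: eq_bigr => m _.
rewrite der_leibniz -[lie_br (D m x) y]scale1r lie_valZD scale1r !lie_val_br.
by rewrite /nc_comm !fctE.
Qed.

Definition der_sum (D : nat -> der) (DS : der_summable D) : der :=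
  Der (der_sum_subproof DS).

Lemma order_ge_br m n (x y : liealg) :
  order_ge m x -> order_ge n y -> order_ge (m + n)%N (lie_br x y).
Proof.
have omul f g p q : order_ge p f -> order_ge q g ->
    order_ge (p + q)%N (nc_mul f g).
  move=> of_ og w wpq; rewrite /nc_mul big1 // => i _.
  have [tp|tp] := ltnP (size (take i w)) p; first by rewrite of_ // mul0r.
  have [dq|dq] := ltnP (size (drop i w)) q; first by rewrite og // mulr0.
  by have := leq_add tp dq; rewrite -size_cat cat_take_drop leqNgt wpq.
move=> ox oy w wmn; rewrite lie_val_br /nc_comm !fctE (omul _ _ m n) //.
by rewrite (omul _ _ n m) ?subrr // addnC.
Qed.

Lemma order_ge1 (x : liealg) : order_ge 1%N x.
Proof.
by move=> [|//] _; exact: lie_series_nil (valP x).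
Qed.

Lemma order_ge_iter_ad n (x : liealg) : order_ge n.+1 (iter n (lie_br gen_t) x).
Proof.
elim: n => [|n IHn]; first exact: order_ge1.
by rewrite iterS -[n.+2]add1n; apply: order_ge_br => //; exact: order_ge1.
Qed.

Lemma order_geW m n f : (m <= n)%N -> order_ge n f -> order_ge m f.
Proof. by move=> mn fn w wm; apply: fn; exact: leq_trans mn. Qed.

Lemma order_ge_der_a m (u x : liealg) : order_ge m u -> order_ge m (der_a u x).
Proof.
move=> um w; rewrite /=.
elim: w (lie_val x) => [|c w IHw] f wm /=.
  by rewrite nc_mul_nil um // mul0r addr0.
rewrite IHw ?addr0; last exact: ltnW.
rewrite /nc_mul big1 // => i _; rewrite um ?mul0r //.
rewrite size_take; case: ifP => // iw.
exact: ltn_trans wm.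
Qed.

Lemma order_ge_sum (I : Type) (r : seq I) (P : pred I) (F : I -> liealg) m :
  (forall i, P i -> order_ge m (F i)) ->
  order_ge m (\sum_(i <- r | P i) F i).
Proof.
move=> oF; elim/big_rec: _ => // i x Pi ox w wm.
by rewrite -[F i]scale1r lie_valZD scale1r !fctE oF // ox // addr0.
Qed.

Lemma order_geZ (c : K) m (x : liealg) : order_ge m x -> order_ge m (c *: x).
Proof.
move=> ox w wm; rewrite -[c *: x]addr0 lie_valZD !fctE ox //.
by rewrite scaler0 add0r.
Qed.

End FreeLie.

Arguments gen_t {K}.
Arguments gen_a {K}.

(* The complex numbers, as a topological field. *)
Definition Cplx (R : realType) : numClosedFieldType := R[i].

Section Functions.
Variable R : realType.
Local Notation C := (Cplx R).

Definition cexp (z : C) : C :=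
  Complex (expR (complex.Re z) * cos (complex.Im z))
          (expR (complex.Re z) * sin (complex.Im z)).

Definition twopii : C := Complex 0 (2 * pi).

Definition e_ (u : C) : C := cexp (twopii * u).

(* The coefficients of the power series expansion at 0 of a function which is
   analytic in a punctured neighbourhood of 0 and extends analytically to 0. *)
Definition taylor0 (f : C -> C) : nat -> C :=
  get [set c : nat -> C | \forall x \near 0^',
         series (fun n => c n * x ^+ n) n @[n --> \oo] --> f x].

(* x / (exp x - 1) = \sum_n B_n x^n / n! *)
Definition bernoulli (n : nat) : C :=
  n`!%:R * taylor0 (fun x => x / (cexp x - 1)) n.

Definition sigma (k n : nat) : nat := \sum_(d <- divisors n) d ^ k.

(* G_{2k} *)
Definition eisenstein2 (k : nat) (tau : C) : C :=
  - (bernoulli k.*2 / (4 * k)%:R) +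
  limn (series (fun n => (sigma k.*2.-1 n.+1)%:R * e_ tau ^+ n.+1)).

(* q^{(n + 1/2)^2 / 2} is e((n + 1/2)^2 tau / 2), and the sum over Z is the sum
   of the sums over the n >= 0 and over the n < 0. *)
Definition theta_term (u tau : C) (n : int) : C :=
  (-1) ^ n * e_ (2^-1 * (n%:~R + 2^-1) ^+ 2 * tau) * cexp ((n%:~R + 2^-1) * u).

Definition theta (u tau : C) : C :=
  limn (series (fun n => theta_term u tau (Posz n))) +
  limn (series (fun n => theta_term u tau (Negz n))).

Definition kroneckerF (xi eta tau : C) : C :=
  twopii * (derive1 (theta ^~ tau) 0 * theta (twopii * (xi + eta)) tau /
            (theta (twopii * xi) tau * theta (twopii * eta) tau)).

(* The power series t F(xi, t, tau) and 1/t + t (dF/dt)(xi, t, tau) in t. *)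
Definition tF (xi tau : C) : nat -> C :=
  taylor0 (fun t => t * kroneckerF xi t tau).

Definition tdF (xi tau : C) : nat -> C :=
  taylor0 (fun t => t^-1 + t * derive1 (fun s => kroneckerF xi s tau) t).

(* A Der p-valued 1-form on (an open subset of) C x h is given by its
   components on dxi and dtau, and a 2-form by its component on
   dxi /\ dtau. *)
Record one_form := OneForm {
  dxi_part : C -> C -> der C;
  dtau_part : C -> C -> der C }.

Definition form_br (al be : one_form) (xi tau : C) : der C :=
  der_br (dxi_part al xi tau) (dtau_part be xi tau) -
  der_br (dtau_part al xi tau) (dxi_part be xi tau).

(* The coefficient of the word w in D x.  Der p-valued functions are
   differentiated coefficientwise. *)
Definition coef (D : der C) (x : liealg C) (w : seq bool) : C := lie_val (D x) w.

Definition form_d (al : one_form) (xi tau : C) x w : C :=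
  derive1 (fun s => coef (dtau_part al s tau) x w) xi -
  derive1 (fun s => coef (dxi_part al xi s) x w) tau.

(* Holomorphy, i.e. holomorphy in each variable separately. *)
Definition holomorphic_form (U : set (C * C)) (al : one_form) : Prop :=
  forall xi tau, U (xi, tau) -> forall x w,
  [/\ derivable (fun s => coef (dxi_part al s tau) x w) xi 1,
      derivable (fun s => coef (dxi_part al xi s) x w) tau 1,
      derivable (fun s => coef (dtau_part al s tau) x w) xi 1 &
      derivable (fun s => coef (dtau_part al xi s) x w) tau 1].

Definition integrable_form (U : set (C * C)) (al : one_form) : Prop :=
  holomorphic_form U al /\
  forall xi tau, U (xi, tau) -> forall x w,
    form_d al xi tau x w + 2^-1 * coef (form_br al al xi tau) x w = 0.

Definition ad_t (n : nat) : liealg C := iter n (lie_br gen_t) gen_a.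

(* The dtau component of the term of index m >= 1 of psi. *)
Definition psi_term (tau : C) (m : nat) : der C :=
  (twopii ^+ m.*2.+1 / m.*2`!%:R * eisenstein2 m.+1 tau) *:
  der_a (\sum_(1 <= j < m.*2.+1)
           (-1) ^+ j *: lie_br (ad_t j) (ad_t (m.*2.+1 - j)%N)).

Lemma psi_summable (tau : C) : der_summable (fun m => psi_term tau m.+1).
Proof.
move=> m x; apply: (@order_geZ _ _ m (der_a _ x)).
apply: order_ge_der_a; rewrite big_nat_cond; apply: order_ge_sum => j.
case/andP=> /andP[_ jm] _; apply: order_geZ.
apply: (@order_geW _ _ (j.+1 + (m.+1.*2.+1 - j).+1)%N); last first.
  by apply: order_ge_br; exact: order_ge_iter_ad.
lia.
Qed.

Definition psi (tau : C) : der C := der_sum (psi_summable tau).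

Definition omega : one_form := {|
  dxi_part := fun xi tau => ad (ps_act (tF xi tau) gen_a);
  dtau_part := fun xi tau =>
    twopii^-1 *: der_t gen_a + psi tau +
    ad (twopii^-1 *: ps_act (tdF xi tau) gen_a) |}.

(* C x h without the polar locus of omega *)
Definition kzb_domain : set (C * C) :=
  [set z | 0 < complex.Im z.2 /\
           forall m n : int, z.1 != m%:~R + n%:~R * z.2].

End Functions.

Arguments kzb_domain : clear implicits.
Arguments omega : clear implicits.

(* Main.v *)
(* Write a_n = ad_t^n(a) and t F(xi, t) = \sum_n h_n t^n.  Expanding F as the
   Kronecker series - 2 pi i \sum_n e(n eta) / (1 - e(xi + n tau)), which converges
   for 0 < Im eta < Im tau, gives each h_n, up to a Bernoulli number, as a moment
   in n of a rapidly convergent bilateral Lambert series in xi and tau.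

   Here omega = ad(phi) dxi + B dtau with phi = \sum_n h_n a_n, so that
   [omega, omega] is a multiple of ad(B phi).  In each degree B phi is a
   combination of the brackets [a_i, a_j]; replacing [a_i, a_j] with x^i y^j
   turns it into a polynomial, and the Fay identity
     F(xi, x) F'(xi, y) - F'(xi, x) F(xi, y) = F(xi, x + y) (wp(x) - wp(y)),
   with F' the derivative in the second variable, says exactly that this
   polynomial is symmetric.  As [a_i, a_j] is antisymmetric, B phi = 0.  The Fay
   identity itself holds term by term for the product of two Kronecker series.

   Finally d omega = 0 is the heat equation 2 pi i dF/dtau = d^2 F/dxi deta, which
   is evident on the moments. *)
From HB Require Import structures.
From mathcomp Require Import all_boot all_order all_algebra finmap.
From mathcomp Require Import all_classical all_reals all_analysis.
From mathcomp Require Import complex ring lra zify.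
Require Import Defs.

Set Implicit Arguments.
Unset Strict Implicit.
Unset Printing Implicit Defensive.

Import Order.TTheory GRing.Theory Num.Theory numFieldNormedType.Exports.

Local Open Scope classical_set_scope.
Local Open Scope ring_scope.

(** * Unordered sums *)

(** [omega] involves F only through its expansion at 0 in the second variable, so the function
    theory is done with germs there. The obstacle is that the Kronecker series converges on no
    punctured disc, only on the half disc [near_upper]. An identity proved on the half disc passes
    to all Taylor coefficients because the half disc accumulates at 0 ([ana_unique]).

    F is a quotient of thetas, so theta must first be shown to be nonzero off the lattice. This
    comes from the Kronecker formula itself, multiplied out: a zero off the lattice would force
    theta to vanish identically nearby, and averaging over translates by j/N isolates a Fourier
    coefficient that contradicts this.

    The Fay identity has two variables and germs have one. It is restricted to rays (s x, s y) with
    x, y on the positive imaginary axis, where s x, s y and s (x + y) all stay in the half disc for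
    small s > 0. The coefficient of each power of s is then a polynomial identity at infinitely many
    points, which is enough for symmetry.

    Double series are unordered sums, so that lattice shifts and triangular regroupings are
    reindexings. *)

Section UnorderedSums.
Variable R : realType.
Local Notation C := (Cplx R).

Definition has_tsum (T : choiceType) (f : T -> C) (s : C) :=
  forall e : C, 0 < e -> exists A : {fset T}, forall B : {fset T},
    (A `<=` B)%fset -> `|\sum_(i <- B) f i - s| < e.

(** The order of [C] compares only numbers with equal imaginary parts, so [M] is automatically a
    nonnegative real; real estimates can thus be written in [C] without coercions. *)
Definition summ (T : choiceType) (f : T -> C) :=
  exists M : C, forall B : {fset T}, \sum_(i <- B) `|f i| <= M.

Definition tsum (T : choiceType) (f : T -> C) : C := get [set s | has_tsum f s].

Lemma fsum_sub (T : choiceType) (V : zmodType) (f : T -> V) (A B : {fset T}) :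
  (A `<=` B)%fset ->
  \sum_(i <- B) f i = \sum_(i <- A) f i + \sum_(i <- (B `\` A)%fset) f i.
Proof.
move=> AB; rewrite (big_fsetID _ (mem A)) /=; congr (_ + _).
  congr (\sum_(i <- _) _); congr enum_fset; apply/fsetP => x; rewrite !inE /=.
  by case xA : (x \in A); rewrite ?andbF ?andbT //; apply/(fsubsetP AB).
congr (\sum_(i <- _) _); congr enum_fset; apply/fsetP => x; rewrite !inE /=.
by rewrite andbC.
Qed.

Lemma fsum_le (T : choiceType) (f : T -> C) (A B : {fset T}) :
  (forall i, 0 <= f i) -> (A `<=` B)%fset ->
  \sum_(i <- A) f i <= \sum_(i <- B) f i.
Proof.
by move=> f0 AB; rewrite (fsum_sub f AB) lerDl sumr_ge0.
Qed.

Lemma fsum_seq (T : choiceType) (V : nmodType) (f : T -> V) (s : seq T) :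
  uniq s -> \sum_(i <- [fset x in s]%fset) f i = \sum_(i <- s) f i.
Proof.
move=> us; apply: perm_big; apply: uniq_perm => [||x]; rewrite ?fset_uniq //.
by rewrite !inE.
Qed.

Lemma has_tsum_unique (T : choiceType) (f : T -> C) s t :
  has_tsum f s -> has_tsum f t -> s = t.
Proof.
move=> hs ht; apply/eqP; rewrite -subr_eq0 -normr_eq0; apply/negPn/negP => st.
have e0 : 0 < `|s - t| / 2 by rewrite divr_gt0 // lt0r st normr_ge0.
have [A hA] := hs _ e0; have [B hB] := ht _ e0.
have := hA (A `|` B)%fset (fsubsetUl _ _); have := hB (A `|` B)%fset (fsubsetUr _ _).
set S := \sum_(i <- _) _ => h1; rewrite distrC => h2.
have := ltrD h2 h1; rewrite -splitr => /(le_lt_trans (ler_normD _ _)).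
by rewrite addrA subrK ltxx.
Qed.

Lemma tsumE (T : choiceType) (f : T -> C) s : has_tsum f s -> tsum f = s.
Proof.
move=> hs; apply: (has_tsum_unique (f := f)) => //.
by rewrite /tsum; case: xgetP => [x -> //|/(_ s)].
Qed.

Lemma has_tsumD (T : choiceType) (f g : T -> C) s t :
  has_tsum f s -> has_tsum g t -> has_tsum (fun i => f i + g i) (s + t).
Proof.
move=> hs ht e e0; have e20 : 0 < e / 2 by rewrite divr_gt0.
have [A hA] := hs _ e20; have [B hB] := ht _ e20.
exists (A `|` B)%fset => X ABX; rewrite big_split /= opprD addrACA.
rewrite (le_lt_trans (ler_normD _ _)) // [e]splitr ltrD //.
  by apply: hA; apply: fsubset_trans ABX; exact: fsubsetUl.
by apply: hB; apply: fsubset_trans ABX; exact: fsubsetUr.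
Qed.

Lemma has_tsumZ (T : choiceType) (c : C) (f : T -> C) s :
  has_tsum f s -> has_tsum (fun i => c * f i) (c * s).
Proof.
move=> hs e e0; have c1 : 0 < `|c| + 1 by rewrite ltr_wpDl.
have [A hA] := hs (e / (`|c| + 1)) (divr_gt0 e0 c1).
exists A => B AB; rewrite -mulr_sumr -mulrBr normrM.
have := hA B AB; rewrite ltr_pdivlMr // => h; rewrite mulrC (le_lt_trans _ h) //.
by rewrite ler_wpM2l // lerDl.
Qed.

Lemma has_tsumB (T : choiceType) (f g : T -> C) s t :
  has_tsum f s -> has_tsum g t -> has_tsum (fun i => f i - g i) (s - t).
Proof.
move=> hs /(has_tsumZ (-1)) ht; rewrite -mulN1r.
have -> : (fun i => f i - g i) = fun i => f i + -1 * g i.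
  by apply/funext => i; rewrite mulN1r.
exact: has_tsumD.
Qed.

Lemma has_tsum_le (T : choiceType) (f : T -> C) s M :
  has_tsum f s -> (forall B : {fset T}, `|\sum_(i <- B) f i| <= M) -> `|s| <= M.
Proof.
move=> hs hM; have M0 : 0 <= M by apply: le_trans (hM fset0).
apply/ler_addgt0Pr => e e0; have [A hA] := hs _ e0.
have -> : s = \sum_(i <- A) f i - (\sum_(i <- A) f i - s) by rewrite opprB addrC subrK.
rewrite (le_trans (ler_normB _ _)) // lerD //.
by apply/ltW/hA.
Qed.

Lemma has_tsum_ge (T : choiceType) (f : T -> C) s (B : {fset T}) :
  (forall i, 0 <= f i) -> has_tsum f s -> \sum_(i <- B) f i <= `|s|.
Proof.
move=> f0 hs; apply/ler_addgt0Pr => e e0; have [A hA] := hs _ e0.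
apply: (le_trans (fsum_le f0 (fsubsetUr A B))).
rewrite -[leLHS]ger0_norm ?sumr_ge0 // -[X in `|X|](subrK s) addrC.
by rewrite (le_trans (ler_normD _ _)) // lerD2l ltW // hA // fsubsetUl.
Qed.

Lemma has_tsum_ge0 (T : choiceType) (f : T -> C) s :
  (forall i, 0 <= f i) -> has_tsum f s -> 0 <= s.
Proof.
move=> f0 hs; suff -> : s = `|s| by [].
apply: (has_tsum_unique hs) => e /hs[A hA]; exists A => B /hA; apply: le_lt_trans.
by rewrite -[X in `|X - _| <= _]ger0_norm ?sumr_ge0 // ler_dist_dist.
Qed.

Lemma summ_ge0_has_tsum (T : choiceType) (f : T -> R) (M : R) :
  (forall i, 0 <= f i) -> (forall B : {fset T}, \sum_(i <- B) f i <= M) ->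
  has_tsum (fun i => (f i)%:C%C : C) (sup [set \sum_(i <- B) f i | B in [set: {fset T}]])%:C%C.
Proof.
move=> f0 fM e e0; set E := [set _ | _ in _].
have hE : has_sup E.
  split; first by exists (\sum_(i <- (fset0 : {fset T})) f i); exists fset0.
  by exists M => _ [B _ <-]; exact: fM.
have [r er] : exists r : R, e = r%:C%C by exists (complex.Re e); rewrite RRe_real // gtr0_real.
have r0 : 0 < r by rewrite -ltcR -er.
have [_ [A _ <-] hA] := sup_adherent r0 hE.
exists A => B AB; rewrite -rmorph_sum -rmorphB /= normc_def /= expr0n addr0 sqrtr_sqr er ltcR.
have AleB : \sum_(i <- A) f i <= \sum_(i <- B) f i.
  by rewrite (fsum_sub f AB) lerDl sumr_ge0.
have Bs : \sum_(i <- B) f i <= sup E by apply: ub_le_sup; [case: hE|exists B].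
rewrite distrC ger0_norm ?subr_ge0 // ltrBlDr -ltrBlDl.
exact: lt_le_trans AleB.
Qed.

(** Completeness enters only through suprema of sets of reals: the real and the imaginary part are
    each the difference of the nonnegative families |g| + g and |g|. *)
Lemma summ_has_tsum (T : choiceType) (f : T -> C) : summ f -> has_tsum f (tsum f).
Proof.
case=> M hM.
suff [s hs] : exists s, has_tsum f s by rewrite (tsumE hs).
have [m hm] : exists m : R, forall B : {fset T}, \sum_(i <- B) complex.Re `|f i| <= m.
  exists (complex.Re M) => B; have := hM B; rewrite lecE => /andP[_].
  by rewrite raddf_sum.
pose re i := complex.Re (f i); pose im i := complex.Im (f i).
have part (g : T -> R) : (forall i, `|g i| <= complex.Re `|f i|) ->
    exists s, has_tsum (fun i => (g i)%:C%C : C) s.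
  move=> gf.
  have pos (h : T -> R) : (forall i, 0 <= h i <= 2 * complex.Re `|f i|) ->
      exists s, has_tsum (fun i => (h i)%:C%C : C) s.
    move=> hh; eexists; apply: (@summ_ge0_has_tsum _ _ (2 * m)) => [i|B].
      by case/andP: (hh i).
    rewrite (@le_trans _ _ (2 * \sum_(i <- B) complex.Re `|f i|)) //.
      by rewrite mulr_sumr ler_sum // => i _; case/andP: (hh i).
    by rewrite ler_pM2l.
  have [s1 h1] : exists s, has_tsum (fun i => (`|g i| + g i)%:C%C : C) s.
    by apply: pos => i; have := gf i; have := ler_norm (g i);
      have := ler_norm (- g i); rewrite normrN; lra.
  have [s2 h2] : exists s, has_tsum (fun i => (`|g i|)%:C%C : C) s.
    by apply: pos => i; have := gf i; have := normr_ge0 (g i); lra.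
  exists (s1 - s2); have := has_tsumB h1 h2.
  by congr has_tsum; apply/funext => i; rewrite -rmorphB /= [_ + g i]addrC addrK.
have normE (a b : R) : complex.Re `|(Complex a b : C)| = Num.sqrt (a ^+ 2 + b ^+ 2).
  by rewrite normc_def.
have [s1 h1] : exists s, has_tsum (fun i => (re i)%:C%C : C) s.
  apply: part => i; rewrite /re; case: (f i) => a b; rewrite normE -sqrtr_sqr.
  by rewrite ler_sqrt ?addr_ge0 ?sqr_ge0 // lerDl sqr_ge0.
have [s2 h2] : exists s, has_tsum (fun i => (im i)%:C%C : C) s.
  apply: part => i; rewrite /im; case: (f i) => a b; rewrite normE -sqrtr_sqr.
  by rewrite ler_sqrt ?addr_ge0 ?sqr_ge0 // lerDr sqr_ge0.
exists (s1 + 'i%C * s2); have := has_tsumD h1 (has_tsumZ 'i%C h2).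
by congr has_tsum; apply/funext => i; rewrite -complexE.
Qed.

Lemma tsum_le (T : choiceType) (f : T -> C) (M : C) :
  (forall B : {fset T}, \sum_(i <- B) `|f i| <= M) -> `|tsum f| <= M.
Proof.
move=> hM; apply: (has_tsum_le (f := f)) => [|B].
  by apply: summ_has_tsum; exists M.
exact: le_trans (ler_norm_sum _ _ _) (hM B).
Qed.

Lemma summ_norm (T : choiceType) (f : T -> C) :
  summ (fun i => `|f i|) <-> summ f.
Proof.
split=> -[M hM]; exists M => B; apply: le_trans (hM B);
by rewrite ler_sum // => i _; rewrite normr_id.
Qed.

Lemma summ_le (T : choiceType) (g f : T -> C) :
  summ g -> (forall i, `|f i| <= `|g i|) -> summ f.
Proof. by case=> M hM fg; exists M => B; apply: le_trans (hM B); rewrite ler_sum. Qed.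

Lemma fsum_norm_le_tsum (T : choiceType) (f : T -> C) (B : {fset T}) :
  summ f -> \sum_(i <- B) `|f i| <= `|tsum (fun i => `|f i|)|.
Proof.
by move=> /summ_norm/summ_has_tsum; apply: has_tsum_ge => i; exact: normr_ge0.
Qed.

Lemma norm_tsum_le (T : choiceType) (f : T -> C) :
  summ f -> `|tsum f| <= `|tsum (fun i => `|f i|)|.
Proof. by move=> sf; apply: tsum_le => B; exact: fsum_norm_le_tsum. Qed.

Lemma summZ (T : choiceType) (c : C) (f : T -> C) :
  summ f -> summ (fun i => c * f i).
Proof.
case=> M hM; exists (`|c| * M) => B.
under eq_bigr do rewrite normrM.
by rewrite -mulr_sumr ler_wpM2l.
Qed.

Lemma summD (T : choiceType) (f g : T -> C) :
  summ f -> summ g -> summ (fun i => f i + g i).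
Proof.
move=> [M hM] [N hN]; exists (M + N) => B.
apply: le_trans (lerD (hM B) (hN B)); rewrite -big_split /=.
by apply: ler_sum => i _; exact: ler_normD.
Qed.

Lemma summN (T : choiceType) (f : T -> C) : summ f -> summ (fun i => - f i).
Proof. by move=> /summ_le; apply=> i; rewrite normrN. Qed.

Lemma summB (T : choiceType) (f g : T -> C) :
  summ f -> summ g -> summ (fun i => f i - g i).
Proof. by move=> sf sg; apply: summD => //; exact: summN. Qed.

Lemma tsumZ (T : choiceType) (c : C) (f : T -> C) :
  summ f -> tsum (fun i => c * f i) = c * tsum f.
Proof. by move=> /summ_has_tsum h; apply/tsumE/has_tsumZ. Qed.

Lemma tsumD (T : choiceType) (f g : T -> C) :
  summ f -> summ g -> tsum (fun i => f i + g i) = tsum f + tsum g.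
Proof. by move=> /summ_has_tsum hf /summ_has_tsum hg; apply/tsumE/has_tsumD. Qed.

Lemma tsumB (T : choiceType) (f g : T -> C) :
  summ f -> summ g -> tsum (fun i => f i - g i) = tsum f - tsum g.
Proof. by move=> /summ_has_tsum hf /summ_has_tsum hg; apply/tsumE/has_tsumB. Qed.

Lemma summ0 (T : choiceType) : summ (fun _ : T => 0 : C).
Proof. by exists 0 => B; rewrite big1 // => i _; rewrite normr0. Qed.

Lemma tsum0 (T : choiceType) : tsum (fun _ : T => 0 : C) = 0.
Proof.
by apply: tsumE => e e0; exists fset0 => B _; rewrite big1 // subr0 normr0.
Qed.

Lemma fsum_image (S T : choiceType) (V : nmodType) (h : S -> T) (f : T -> V)
    (B : {fset S}) : injective h ->
  \sum_(i <- [fset h x | x in B]%fset) f i = \sum_(i <- B) f (h i).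
Proof. by move=> hI; rewrite big_imfset //= => x y _ _ /hI. Qed.

Lemma summ_comp (S T : choiceType) (h : S -> T) (f : T -> C) :
  injective h -> summ f -> summ (fun i => f (h i)).
Proof.
by move=> hI [M hM]; exists M => B; rewrite -(fsum_image (fun i => `|f i|)).
Qed.

Lemma has_tsum_reindex (S T : choiceType) (h : S -> T) (f : T -> C) s :
  bijective h -> has_tsum f s <-> has_tsum (fun i => f (h i)) s.
Proof.
case=> g gK hK; have [gI hI] := (can_inj hK, can_inj gK).
split=> hs e /hs[A hA].
  exists [fset g x | x in A]%fset => B AB; rewrite -(fsum_image f) //.
  apply: hA; apply/fsubsetP => x xA; apply/imfsetP; exists (g x) => //=.
  by apply/(fsubsetP AB)/imfsetP; exists x.
exists [fset h x | x in A]%fset => B AB.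
have -> : \sum_(i <- B) f i = \sum_(i <- [fset g x | x in B]%fset) f (h i).
  by rewrite fsum_image //; apply: eq_bigr => i _; rewrite hK.
apply: hA; apply/fsubsetP => x xA; apply/imfsetP; exists (h x) => //=.
by apply/(fsubsetP AB)/imfsetP; exists x.
Qed.

Lemma tsum_reindex (S T : choiceType) (h : S -> T) (f : T -> C) :
  bijective h -> tsum (fun i => f (h i)) = tsum f.
Proof.
move=> hb; congr get; apply/funext => s; apply/propext.
by split=> /(has_tsum_reindex _ _ hb).
Qed.

Lemma summ_reindex (S T : choiceType) (h : S -> T) (f : T -> C) :
  bijective h -> summ (fun i => f (h i)) <-> summ f.
Proof.
move=> hb; split; last by apply: summ_comp; exact: bij_inj.
case: hb => g gK hK /(summ_comp (can_inj hK)).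
by congr summ; apply/funext => i; rewrite /= hK.
Qed.

Definition fset_prod (S T : choiceType) (A : {fset S}) (B : {fset T}) : {fset S * T} :=
  [fset p in [seq (x, y) | x <- enum_fset A, y <- enum_fset B]]%fset.

Lemma in_fset_prod (S T : choiceType) (A : {fset S}) (B : {fset T}) p :
  (p \in fset_prod A B) = (p.1 \in A) && (p.2 \in B).
Proof.
rewrite !inE /=; case: p => x y /=.
apply/allpairsP/andP => [[[x' y'] /= [xA yB [-> ->]]]//|[xA yB]].
by exists (x, y).
Qed.

Lemma fsum_prod (S T : choiceType) (V : nmodType) (f : S * T -> V) (A : {fset S})
    (B : {fset T}) :
  \sum_(p <- fset_prod A B) f p = \sum_(x <- A) \sum_(y <- B) f (x, y).
Proof.
rewrite fsum_seq ?big_allpairs //; apply: allpairs_uniq => //; try exact: fset_uniq.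
by move=> [? ?] [? ?].
Qed.

Lemma fset_sub_prod (S T : choiceType) (A : {fset S * T}) :
  (A `<=` fset_prod [fset p.1 | p in A] [fset p.2 | p in A])%fset.
Proof.
apply/fsubsetP => p pA; rewrite in_fset_prod.
by apply/andP; split; apply/imfsetP; exists p.
Qed.

Lemma has_tsum_fubini (S T : choiceType) (F : S * T -> C) (g : S -> C) s :
  has_tsum F s -> (forall x, has_tsum (fun y => F (x, y)) (g x)) -> has_tsum g s.
Proof.
move=> hF hg e e0; have e20 : 0 < e / 2 by rewrite divr_gt0.
have [A hA] := hF _ e20; exists [fset p.1 | p in A]%fset => B AB.
have rows (d : C) (X : seq S) : 0 < d -> exists V : {fset T}, forall W : {fset T},
    (V `<=` W)%fset -> `|\sum_(x <- X) \sum_(y <- W) F (x, y) - \sum_(x <- X) g x| <= d *+ size X.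
  move=> d0; elim: X => [|x X [V hV]]; first by exists fset0 => W _; rewrite !big_nil subr0 normr0.
  have [U hU] := hg x _ d0; exists (U `|` V)%fset => W UVW.
  rewrite !big_cons opprD addrACA (le_trans (ler_normD _ _)) //= mulrS lerD //.
    by apply/ltW/hU; apply: fsubset_trans UVW; exact: fsubsetUl.
  by apply: hV; apply: fsubset_trans UVW; exact: fsubsetUr.
(* The rows over [B] together cost at most e / 2; the successor keeps the quotient positive when [B]
   is empty. Enlarging [V] by the second projection of [A] makes the rectangle contain [A]. *)
have [|V hV] := rows (e / 2 / (size B).+1%:R) B; first by rewrite divr_gt0 // ltr0n.
pose W := (V `|` [fset p.2 | p in A])%fset.
have h1 := hV W (fsubsetUl _ _).
have h2 : `|\sum_(p <- fset_prod B W) F p - s| < e / 2.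
  apply: hA; apply/fsubsetP => p pA; rewrite in_fset_prod; apply/andP; split.
    by apply/(fsubsetP AB)/imfsetP; exists p.
  by rewrite inE; apply/orP; right; apply/imfsetP; exists p.
rewrite fsum_prod in h2; rewrite distrC in h1.
set X := \sum_(x <- B) \sum_(y <- W) _ in h1 h2.
rewrite -[_ - s](subrKA X) (le_lt_trans (ler_normD _ _)) // [e]splitr ler_ltD //.
apply: (le_trans h1); rewrite -[leLHS]mulr_natr mulrAC ler_pdivrMr ?ltr0n //.
by rewrite ler_wpM2l ?ler_nat // ltW.
Qed.

Lemma summ_row (S T : choiceType) (F : S * T -> C) x :
  summ F -> summ (fun y => F (x, y)).
Proof. by apply: summ_comp => y y' []. Qed.

Lemma tsum_fubini (S T : choiceType) (F : S * T -> C) :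
  summ F -> tsum (fun x => tsum (fun y => F (x, y))) = tsum F.
Proof.
move=> sF; apply: tsumE; apply: has_tsum_fubini (summ_has_tsum sF) _ => x.
exact/summ_has_tsum/summ_row.
Qed.

Lemma summ_fubini (S T : choiceType) (F : S * T -> C) :
  summ F -> summ (fun x => tsum (fun y => F (x, y))).
Proof.
move=> /summ_norm sF; pose g x := tsum (fun y => `|F (x, y)|).
have hg : has_tsum g (tsum (fun p => `|F p|)).
  apply: has_tsum_fubini (summ_has_tsum sF) _ => x.
  exact: summ_has_tsum (summ_row _ sF).
exists `|tsum (fun p => `|F p|)| => B.
have g0 x : 0 <= g x by apply: has_tsum_ge0 (summ_has_tsum (summ_row _ sF)) => y.
apply: le_trans (has_tsum_ge B g0 hg); apply: ler_sum => x _.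
rewrite -[g x]ger0_norm //; apply: norm_tsum_le.
by apply: summ_row; apply/summ_norm.
Qed.

Lemma summ_sigma (S T : choiceType) (F : S * T -> C) (b : S -> C) :
  summ b -> (forall x (B : {fset T}), \sum_(y <- B) `|F (x, y)| <= `|b x|) -> summ F.
Proof.
move=> [M hM] hF; exists M => B; apply: le_trans (hM [fset p.1 | p in B]%fset).
apply: le_trans (fsum_le _ (fset_sub_prod B)) _ => [p|]; first exact: normr_ge0.
by rewrite fsum_prod ler_sum.
Qed.

Lemma summ_prod (S T : choiceType) (f : S -> C) (g : T -> C) :
  summ f -> summ g -> summ (fun p => f p.1 * g p.2).
Proof.
move=> sf [M hM]; apply: (@summ_sigma _ _ _ (fun x => M * f x)) => [|x B].
  exact: summZ.
under eq_bigr do rewrite /= normrM.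
rewrite -mulr_sumr normrM mulrC ler_wpM2r //.
by apply: le_trans (hM B) _; rewrite ger0_norm // (le_trans _ (hM fset0)) // big_nil.
Qed.

Lemma tsum_prod (S T : choiceType) (f : S -> C) (g : T -> C) :
  summ f -> summ g -> tsum (fun p => f p.1 * g p.2) = tsum f * tsum g.
Proof.
move=> sf sg; rewrite -tsum_fubini; last exact: summ_prod.
rewrite mulrC -tsumZ //; congr tsum; apply/funext => x /=.
by rewrite tsumZ // mulrC.
Qed.

Lemma tsum_swap (S T : choiceType) (F : S * T -> C) : summ F ->
  tsum (fun x => tsum (fun y => F (x, y))) = tsum (fun y => tsum (fun x => F (x, y))).
Proof.
move=> sF; have sb : bijective (fun p : T * S => (p.2, p.1)).
  by exists (fun p => (p.2, p.1)) => -[].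
rewrite tsum_fubini // -(tsum_reindex _ sb) -(tsum_fubini (F := fun p : T * S => F (p.2, p.1))) //.
by apply/(summ_reindex _ sb).
Qed.

End UnorderedSums.

(** * Sums over the natural numbers and the integers, geometric comparison *)

Section SumsOverNatInt.
Variable R : realType.
Local Notation C := (Cplx R).

Lemma fsum_pmap (S T : choiceType) (V : nmodType) (h : S -> T) (g : T -> option S)
    (f : T -> V) (s : seq T) :
  ocancel g h -> (forall x, g x = None -> f x = 0) ->
  \sum_(x <- s) f x = \sum_(y <- pmap g s) f (h y).
Proof.
move=> gK f0; elim: s => [|x s IHs]; first by rewrite !big_nil.
rewrite big_cons /= IHs; case gx : (g x) => [y|] /=.
  by rewrite big_cons; congr (f _ + _); have := gK x; rewrite gx.
by rewrite f0 // add0r.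
Qed.

Lemma pmap_fset_uniq (S T : choiceType) (h : S -> T) (g : T -> option S)
    (B : {fset T}) : ocancel g h -> uniq (pmap g B).
Proof. by move=> gK; apply: (pmap_uniq gK); exact: fset_uniq. Qed.

Section Extension.
Variables (S T : choiceType) (h : S -> T) (g : T -> option S) (f : T -> C).
Hypotheses (gK : ocancel g h) (hK : pcancel h g).
Hypothesis f0 : forall x, g x = None -> f x = 0.

(** The injection [h] comes with a partial inverse [g]: finite subsets of [T] are pulled back by
    [pmap], and the points discarded by [g] contribute 0. *)
Lemma has_tsum_ext s : has_tsum (fun y => f (h y)) s -> has_tsum f s.
Proof.
move=> hs e /hs[A hA]; exists [fset h x | x in A]%fset => B AB.
rewrite (fsum_pmap _ gK f0) -(fsum_seq (fun y => f (h y))) ?(pmap_fset_uniq _ gK) //.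
apply: hA.
apply/fsubsetP => x xA; rewrite !inE mem_pmap /= -hK; apply: map_f.
by apply/(fsubsetP AB)/imfsetP; exists x.
Qed.

Lemma summ_ext : summ (fun y => f (h y)) -> summ f.
Proof.
case=> M hM; exists M => B; rewrite (@fsum_pmap _ _ _ h g) //.
  by rewrite -(fsum_seq (fun y => `|f (h y)|)) ?(pmap_fset_uniq _ gK).
by move=> x /f0 ->; rewrite normr0.
Qed.

Lemma tsum_ext : summ (fun y => f (h y)) -> tsum f = tsum (fun y => f (h y)).
Proof. by move=> /summ_has_tsum/has_tsum_ext/tsumE. Qed.

End Extension.

Lemma int_sumP (f : int -> C) :
  summ (fun n => f (Posz n)) -> summ (fun n => f (Negz n)) ->
  summ f /\ tsum f = tsum (fun n => f (Posz n)) + tsum (fun n => f (Negz n)).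
Proof.
move=> sp sn.
pose fp z := if z is Posz n then f z else 0.
pose fn z := if z is Negz n then f z else 0.
pose gp z := if z is Posz n then Some n else None.
pose gn z := if z is Negz n then Some n else None.
have gpK : ocancel gp Posz by case.
have gnK : ocancel gn Negz by case.
have fp0 z : gp z = None -> fp z = 0 by case: z.
have fn0 z : gn z = None -> fn z = 0 by case: z.
have sfp : summ fp by apply: (@summ_ext _ _ Posz gp).
have sfn : summ fn by apply: (@summ_ext _ _ Negz gn).
have fE : f = fun z => fp z + fn z.
  by apply/funext => -[n|n]; rewrite /= ?addr0 ?add0r.
have hp : tsum fp = tsum (fun n => f (Posz n)) by apply: tsum_ext gpK _ _ _.
have hn : tsum fn = tsum (fun n => f (Negz n)) by apply: tsum_ext gnK _ _ _.
rewrite -hp -hn fE; split; first exact: summD.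
exact: tsumD.
Qed.

Lemma has_tsum_point (T : choiceType) (x : T) (f : T -> C) :
  (forall y, y != x -> f y = 0) -> has_tsum f (f x).
Proof.
move=> f0 e e0; exists [fset x]%fset => B xB.
rewrite (fsum_sub f xB) big_seq_fset1 big_seq big1 ?addr0 ?subrr ?normr0 //.
by move=> y; rewrite !inE => /andP[yx _]; exact: f0.
Qed.

Lemma tsum_recl (f : nat -> C) : summ f -> tsum f = f 0%N + tsum (fun n => f n.+1).
Proof.
move=> sf; pose f1 n := if n is 0%N then f n else 0.
pose f2 n := if n is 0%N then 0 else f n.
pose g n := if n is m.+1 then Some m else None.
have gK : ocancel g S by case.
have f20 n : g n = None -> f2 n = 0 by case: n.
have sS : summ (fun n => f n.+1) by apply: summ_comp sf; exact: succn_inj.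
have h1 : has_tsum f1 (f 0%N) by apply: (@has_tsum_point _ 0%N f1) => -[].
have h2 : has_tsum f2 (tsum (fun n => f n.+1)).
  by apply: (@has_tsum_ext _ _ S g) => //; exact: summ_has_tsum.
have -> : f = fun n => f1 n + f2 n by apply/funext => -[|n]; rewrite /= ?addr0 ?add0r.
rewrite (tsumE (has_tsumD h1 h2)) /= addr0; congr (_ + tsum _).
by apply/funext => n; rewrite add0r.
Qed.

Lemma summ_recl (f : nat -> C) : summ (fun n => f n.+1) -> summ f.
Proof.
case=> M hM; exists (`|f 0%N| + M) => B.
pose g n := if n is m.+1 then Some m else None.
have gK : ocancel g S by case.
have -> : \sum_(i <- B) `|f i| = \sum_(i <- B) (if i is 0%N then `|f i| else 0) +
    \sum_(i <- B) (if i is 0%N then 0 else `|f i|).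
  by rewrite -big_split; apply: eq_bigr => -[|i] _; rewrite /= ?addr0 ?add0r.
apply: lerD.
  have -> : \sum_(i <- B) (if i is 0%N then `|f i| else 0) =
      \sum_(i <- B | i == 0%N) `|f 0%N|.
    by rewrite [RHS]big_mkcond; apply: eq_bigr => -[|i].
  rewrite big_const_seq; have : (count (pred1 0%N) B <= 1)%N.
    by rewrite count_uniq_mem ?fset_uniq // leq_b1.
  by case: count => [|[|//]] _ /=; rewrite ?addr0.
rewrite (fsum_pmap _ gK) => [|[]//].
by rewrite -(fsum_seq (fun y => `|f y.+1|)) ?(pmap_fset_uniq _ gK).
Qed.

Lemma series_fset (f : nat -> C) n :
  series f n = \sum_(i <- [fset x in iota 0 n]%fset) f i.
Proof. by rewrite fsum_seq ?iota_uniq // /series /= /index_iota subn0. Qed.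

Lemma cvg_series_tsum (f : nat -> C) :
  summ f -> series f n @[n --> \oo] --> tsum f.
Proof.
move=> /summ_has_tsum hf; apply/cvgrPdist_lt => e e0; have [A hA] := hf _ e0.
exists (\max_(i <- A) i).+1 => // n /= An; rewrite distrC series_fset; apply: hA.
apply/fsubsetP => x xA; rewrite !inE mem_iota /= ?add0n.
by apply: leq_trans An; rewrite ltnS; exact: leq_bigmax_seq.
Qed.

Lemma lim_series (f : nat -> C) : summ f -> limn (series f) = tsum f.
Proof. by move=> sf; apply: cvg_lim => //; exact: cvg_series_tsum. Qed.

Lemma summ_nat (f : nat -> C) (M : C) :
  (forall n, \sum_(i < n) `|f i| <= M) -> summ f.
Proof.
move=> hM; exists M => B; apply: le_trans (hM (\max_(i <- B) i).+1).
rewrite -(big_mkord xpredT (fun i => `|f i|)) /index_iota subn0.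
rewrite -[leRHS](fsum_seq (fun i => `|f i|)) ?iota_uniq //; apply: fsum_le => //.
apply/fsubsetP => x xB; rewrite !inE /=; case: x xB => // x xB /=.
by rewrite mem_iota /= add1n !ltnS; exact: (@leq_bigmax_seq _ _ xpredT id).
Qed.

Lemma geometric_sum (x : C) n : (1 - x) * (\sum_(i < n) x ^+ i) = 1 - x ^+ n.
Proof. by rewrite -opprB mulNr -subrX1 opprB. Qed.

Lemma summ_geometric (r : C) : `|r| < 1 -> summ (fun n => r ^+ n).
Proof.
move=> r1; apply: (@summ_nat _ (1 - `|r|)^-1) => n.
have r1' : 0 < 1 - `|r| by rewrite subr_gt0.
rewrite -[leRHS]mul1r ler_pdivlMr //.
under eq_bigr do rewrite normrX.
rewrite mulrC geometric_sum.
by rewrite gerBl exprn_ge0.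
Qed.

Lemma tsum_geometric (r : C) : `|r| < 1 -> tsum (fun n => r ^+ n) = (1 - r)^-1.
Proof.
move=> r1; have sr := summ_geometric r1.
have r1' : 1 - r != 0.
  by rewrite subr_eq0; apply: contraTneq r1 => <-; rewrite normr1 ltxx.
apply: (mulIf r1'); rewrite mulVf // mulrBr mulr1 mulrC -tsumZ //.
under [X in _ - tsum X]funext do rewrite -exprS.
by rewrite tsum_recl // expr0 addrK.
Qed.

Lemma mid1_lt (x : C) : x < 1 -> x < (x + 1) / 2 /\ (x + 1) / 2 < 1.
Proof.
move=> x1; split; first by rewrite ltr_pdivlMr // mulr_natr mulr2n ltrD2l.
by rewrite ltr_pdivrMr // mul1r -[2]/(1 + 1) ltrD2r.
Qed.

Lemma natX_expr_bounded (k : nat) (x : C) : 0 <= x < 1 ->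
  exists M : C, forall n, n.+1%:R ^+ k * x ^+ n <= M.
Proof.
elim: k x => [|k IHk] x /andP[x0 x1].
  by exists 1 => n; rewrite expr0 mul1r exprn_ile1 // ltW.
(* A point strictly between x and 1: the factor (x / y)^n absorbs one power of n + 1, and y^n is
   left for the induction. *)
pose y := (x + 1) / 2; have [xy y1] : x < y /\ y < 1 by exact: mid1_lt.
have y0 : 0 < y by exact: le_lt_trans xy.
have [|M hM] := IHk y; first by rewrite ltW.
have xy0 : 0 <= x / y by rewrite divr_ge0 // ltW.
have xy1 : 0 < 1 - x / y by rewrite subr_gt0 ltr_pdivrMr // mul1r.
(* The powers decrease, so n + 1 copies of the last one are below the geometric sum. *)
have hN n : n.+1%:R * (x / y) ^+ n <= (1 - x / y)^-1.
  rewrite -[leRHS]mul1r ler_pdivlMr //.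
  have : \sum_(i < n.+1) (x / y) ^+ n <= \sum_(i < n.+1) (x / y) ^+ i.
    apply: ler_sum => i _; apply: ler_wiXn2l => //; last by rewrite -ltnS.
    by rewrite -subr_ge0 ltW.
  rewrite sumr_const card_ord mulr_natl => h.
  apply: le_trans (ler_wpM2r (ltW xy1) h) _.
  rewrite mulrC geometric_sum.
  by rewrite gerBl exprn_ge0.
exists (M * (1 - x / y)^-1) => n.
have -> : n.+1%:R ^+ k.+1 * x ^+ n = (n.+1%:R ^+ k * y ^+ n) * (n.+1%:R * (x / y) ^+ n).
  have -> : x ^+ n = y ^+ n * (x / y) ^+ n by rewrite -exprMn mulrC divfK // gt_eqF.
  by rewrite exprS; ring.
by apply: ler_pM => //; rewrite mulr_ge0 ?exprn_ge0 // ltW.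
Qed.

Lemma summ_natX_expr (k : nat) (r : C) : `|r| < 1 ->
  summ (fun n => n.+1%:R ^+ k * r ^+ n).
Proof.
move=> r1; pose y := (`|r| + 1) / 2.
have [ry y1] : `|r| < y /\ y < 1 by exact: mid1_lt.
have y0 : 0 < y by exact: le_lt_trans ry.
have [|M hM] := @natX_expr_bounded k (`|r| / y).
  by rewrite divr_ge0 ?(ltW y0) //= ltr_pdivrMr // mul1r.
apply: (@summ_le _ _ (fun n => M * y ^+ n)) => [|n].
  by apply/summZ/summ_geometric; rewrite gtr0_norm.
rewrite !normrM !normrX normr_nat (gtr0_norm y0).
have -> : `|r| ^+ n = (`|r| / y) ^+ n * y ^+ n.
  by rewrite expr_div_n mulfVK // expf_neq0 // gt_eqF.
rewrite mulrA ler_wpM2r ?(exprn_ge0 _ (ltW y0)) //.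
apply: le_trans (hM n) _; rewrite ger0_norm // (le_trans _ (hM n)) //.
by rewrite mulr_ge0 ?exprn_ge0 // divr_ge0 // ltW.
Qed.

End SumsOverNatInt.

Section CauchyProduct.
Variable R : realType.
Local Notation C := (Cplx R).

Lemma tsum_ord (f : nat -> C) N :
  (forall i, (N <= i)%N -> f i = 0) -> tsum f = \sum_(i < N) f i.
Proof.
move=> f0; apply: tsumE => e e0; exists [fset x in iota 0 N]%fset => B NB.
have -> : \sum_(i <- B) f i = \sum_(i < N) f i.
  rewrite (fsum_sub f NB) (fsum_seq f) ?iota_uniq //.
  rewrite [X in _ + X]big_seq [X in _ + X]big1 => [|i].
    by rewrite addr0 -(big_mkord xpredT f) /index_iota subn0.
  by rewrite in_fsetD !inE mem_iota /= add0n -leqNgt => /andP[+ _]; exact: f0.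
by rewrite subrr normr0.
Qed.

Definition conv (f g : nat -> C) n := \sum_(i < n.+1) f i * g (n - i)%N.

Lemma cauchy_product (f g : nat -> C) : summ f -> summ g ->
  summ (conv f g) /\ tsum (conv f g) = tsum f * tsum g.
Proof.
move=> sf sg.
(* Index pairs (n, i) with i <= n, where n is the total degree: the rows of [F] are the convolution,
   and [h] identifies the triangle with the full product. *)
pose F (p : nat * nat) := if (p.2 <= p.1)%N then f p.2 * g (p.1 - p.2)%N else 0.
pose h (p : nat * nat) := ((p.1 + p.2)%N, p.1).
pose k (p : nat * nat) := if (p.2 <= p.1)%N then Some (p.2, (p.1 - p.2)%N) else None.
have kK : ocancel k h.
  by case=> n i; rewrite /k /h /=; case: leqP => //= le_in; rewrite subnKC.
have hK : pcancel h k.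
  by case=> i j; rewrite /k /h /= leq_addr addKn.
have F0 p : k p = None -> F p = 0 by rewrite /k /F; case: ifP.
have Fh : (fun p => F (h p)) = fun p => f p.1 * g p.2.
  by apply/funext => -[i j]; rewrite /F /h /= leq_addr addKn.
have sF : summ F by apply: (summ_ext kK F0); rewrite Fh; exact: summ_prod.
have cE : conv f g = fun n => tsum (fun i => F (n, i)).
  apply/funext => n; rewrite (@tsum_ord _ n.+1) => [|i]; last by rewrite /F /= ltnNge => /negPf ->.
  by apply: eq_bigr => i _; rewrite /F /= -ltnS ltn_ord.
rewrite cE; split; first exact: summ_fubini.
by rewrite tsum_fubini // (tsum_ext kK hK F0) Fh ?tsum_prod //; exact: summ_prod.
Qed.

End CauchyProduct.

(** * The complex exponential and its power series *)

Section ComplexExponential.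
Variable R : realType.
Local Notation C := (Cplx R).

Lemma cexpD (x y : C) : cexp (x + y) = cexp x * cexp y.
Proof.
case: x y => a b [c d]; rewrite /cexp /= expRD cosD sinD.
by apply/eqP; rewrite eq_complex /=; apply/andP; split; apply/eqP; ring.
Qed.

Lemma cexp0 : cexp (0 : C) = 1.
Proof. by rewrite /cexp /= expR0 cos0 sin0 mulr1 mulr0. Qed.

Lemma norm_cexp (z : C) : `|cexp z| = (expR (complex.Re z))%:C%C.
Proof.
rewrite normc_def /cexp /= !exprMn -mulrDr cos2Dsin2 mulr1.
by rewrite sqrtr_sqr ger0_norm // expR_ge0.
Qed.

Lemma cexp_neq0 (z : C) : cexp z != 0.
Proof. by rewrite -normr_eq0 norm_cexp eq_complex /= expR_eq0. Qed.

Lemma cexpN (z : C) : cexp (- z) = (cexp z)^-1.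
Proof. by apply: (mulIf (cexp_neq0 z)); rewrite -cexpD addNr cexp0 mulVf ?cexp_neq0. Qed.

Lemma cexpMn (z : C) n : cexp (n%:R * z) = cexp z ^+ n.
Proof.
elim: n => [|n IHn]; first by rewrite mul0r cexp0.
by rewrite -natr1 mulrDl mul1r cexpD IHn exprSr.
Qed.

Lemma cvg_Re (u : nat -> C) (l : C) :
  u n @[n --> \oo] --> l -> complex.Re (u n) @[n --> \oo] --> complex.Re l.
Proof.
move=> /cvgrPdist_lt h; apply/cvgrPdist_lt => e e0.
have [|N _ hN] := h e%:C%C; first by rewrite ltcR.
exists N => // n /hN /=; rewrite -raddfB; case: (l - u n) => a b.
rewrite normc_def ltcR /=; apply: le_lt_trans.
by rewrite -sqrtr_sqr ler_sqrt ?addr_ge0 ?sqr_ge0 // lerDl sqr_ge0.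
Qed.

Lemma cvg_Im (u : nat -> C) (l : C) :
  u n @[n --> \oo] --> l -> complex.Im (u n) @[n --> \oo] --> complex.Im l.
Proof.
move=> /cvgrPdist_lt h; apply/cvgrPdist_lt => e e0.
have [|N _ hN] := h e%:C%C; first by rewrite ltcR.
exists N => // n /hN /=; rewrite -raddfB; case: (l - u n) => a b.
rewrite normc_def ltcR /=; apply: le_lt_trans.
by rewrite -sqrtr_sqr ler_sqrt ?addr_ge0 ?sqr_ge0 // lerDr sqr_ge0.
Qed.

Lemma lim_Re (u : nat -> C) (v : nat -> R) (l : C) (m : R) :
  u n @[n --> \oo] --> l -> (forall n, complex.Re (u n) = v n) ->
  v n @[n --> \oo] --> m -> complex.Re l = m.
Proof.
move=> /cvg_Re hu uv hv; apply: (cvg_unique _ hu) => //.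
by have -> : (fun n => complex.Re (u n)) = v by apply/funext.
Qed.

Lemma lim_Im (u : nat -> C) (v : nat -> R) (l : C) (m : R) :
  u n @[n --> \oo] --> l -> (forall n, complex.Im (u n) = v n) ->
  v n @[n --> \oo] --> m -> complex.Im l = m.
Proof.
move=> /cvg_Im hu uv hv; apply: (cvg_unique _ hu) => //.
by have -> : (fun n => complex.Im (u n)) = v by apply/funext.
Qed.

Lemma norm_real (z : C) : `|z| = (complex.Re `|z|)%:C%C.
Proof. by rewrite RRe_real. Qed.

Definition cexp_term (z : C) (n : nat) : C := z ^+ n / n`!%:R.

Lemma summ_cexp_term (z : C) : summ (cexp_term z).
Proof.
pose r := complex.Re `|z|; have r0 : 0 <= r by rewrite -ler0c -norm_real.
apply: (@summ_nat _ _ (expR r)%:C%C) => n.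
have -> : \sum_(i < n) `|cexp_term z i| = (\sum_(i < n) exp_coeff r i)%:C%C.
  rewrite rmorph_sum /=; apply: eq_bigr => i _.
  by rewrite /exp_coeff /cexp_term normf_div normrX normr_nat norm_real fmorph_div
             rmorphXn /= rmorph_nat.
rewrite lecR -(big_mkord xpredT); apply: (@nondecreasing_cvgn_le _ (series (exp_coeff r))).
  apply/nondecreasing_series => i _ _; exact: exp_coeff_ge0.
exact: is_cvg_series_exp_coeff.
Qed.

Lemma cexp_term_real (x : R) : tsum (cexp_term x%:C%C) = (expR x)%:C%C.
Proof.
have h := cvg_series_tsum (summ_cexp_term x%:C%C).
have sE n : series (cexp_term x%:C%C) n = (series (exp_coeff x) n)%:C%C.
  rewrite /series /= rmorph_sum; apply: eq_bigr => i _.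
  by rewrite /exp_coeff /cexp_term fmorph_div rmorphXn /= rmorph_nat.
rewrite [LHS]complexE.
rewrite (lim_Im (v := fun=> 0) h (m := 0)) => [|n|]; [|by rewrite sE|exact: cvg_cst].
rewrite mulr0 addr0; congr (_%:C%C).
apply: (lim_Re h (v := series (exp_coeff x))) => [n|]; first by rewrite sE.
exact: is_cvg_series_exp_coeff.
Qed.

Lemma cexp_term_imag (y : R) : tsum (cexp_term (Complex 0 y)) = Complex (cos y) (sin y).
Proof.
have h := cvg_series_tsum (summ_cexp_term (Complex 0 y)).
have tE n : cexp_term (Complex 0 y) n = Complex (cos_coeff y n) (sin_coeff y n).
  have -> : cexp_term (Complex 0 y) n = 'i%C ^+ n * (y ^+ n / n`!%:R)%:C%C.
    rewrite /cexp_term fmorph_div rmorphXn /= rmorph_nat mulrA -exprMn; congr (_ ^+ n / _).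
    by apply/eqP; rewrite eq_complex /=; apply/andP; split; apply/eqP; ring.
  have iX k : 'i%C ^+ k.*2 = ((-1) ^+ k)%:C%C :> C.
    by rewrite -muln2 mulnC exprM sqr_i rmorphXn rmorphN1.
  rewrite /cos_coeff /sin_coeff /= -{1}(odd_double_half n).
  case on : (odd n) => /=.
    have -> : n.-1./2 = n./2 by lia.
    rewrite add1n exprS iX -exprnP.
    by apply/eqP; rewrite eq_complex /=; apply/andP; split; apply/eqP; ring.
  rewrite add0n iX -exprnP.
  by apply/eqP; rewrite eq_complex /=; apply/andP; split; apply/eqP; ring.
rewrite [LHS]complexE; apply/eqP; rewrite eq_complex /=.
rewrite !(mul0r, mul1r, mulr0, subr0, add0r, addr0, oppr0).
apply/andP; split; apply/eqP.
  apply: (lim_Re h (v := series (cos_coeff y))) => [n|].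
    by rewrite /series /= raddf_sum; apply: eq_bigr => i _; rewrite tE.
  by rewrite unlock; exact: is_cvg_series_cos_coeff.
apply: (lim_Im h (v := series (sin_coeff y))) => [n|].
  by rewrite /series /= raddf_sum; apply: eq_bigr => i _; rewrite tE.
by rewrite unlock; exact: is_cvg_series_sin_coeff.
Qed.

Lemma cexp_term_add (x y : C) :
  tsum (cexp_term (x + y)) = tsum (cexp_term x) * tsum (cexp_term y).
Proof.
have [_ <-] := cauchy_product (summ_cexp_term x) (summ_cexp_term y).
congr tsum; apply/funext => n; rewrite /cexp_term /conv exprDn mulr_suml.
rewrite (reindex_inj rev_ord_inj) /=; apply: eq_bigr => i _.
rewrite subSS; have le_in : (i <= n)%N by rewrite -ltnS.
rewrite bin_sub // subKn // -mulr_natl.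
have nz k : k`!%:R != 0 :> C by rewrite pnatr_eq0 -lt0n fact_gt0.
rewrite -(bin_fact le_in) !natrM; field.
by rewrite !nz pnatr_eq0 -lt0n bin_gt0 le_in.
Qed.

(** [cexp] is defined from real functions. Its series is known on the real axis from that of [expR]
    and on the imaginary axis from those of [cos] and [sin]; the Cauchy product joins the two. *)
Lemma cexpE (z : C) : cexp z = tsum (cexp_term z).
Proof.
case: z => a b; rewrite /cexp /=.
have -> : (Complex a b : C) = a%:C%C + Complex 0 b.
  by apply/eqP; rewrite eq_complex /= addr0 add0r !eqxx.
rewrite cexp_term_add cexp_term_real cexp_term_imag.
by apply/eqP; rewrite eq_complex /= !mul0r subr0 addr0 !eqxx.
Qed.

End ComplexExponential.

(** * Derivatives and germs of analytic functions *)

Section ComplexDerivative.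
Variable R : realType.
Local Notation C := (Cplx R).

(** A quadratic bound on the remainder, unlike a bare o(h), can be added up over the terms of a
    series; this is the form in which derivatives are obtained for series below. *)
Lemma is_derive_quad (f : C -> C) (x l d M : C) : 0 < d ->
  (forall h, `|h| < d -> `|f (x + h) - f x - h * l| <= M * `|h| ^+ 2) ->
  is_derive x 1 f l.
Proof.
move=> d0 hM.
suff cv : (fun h => h^-1 *: (f (h *: 1 + x) - f x)) @ 0^' --> l.
  by apply: DeriveDef; [apply/cvg_ex; exists l|exact: cvg_lim].
apply/cvgrPdist_lt => e e0.
have M1 : 0 < `|M| + 1 by rewrite ltr_wpDl.
have dd : 0 < e / (`|M| + 1) by rewrite divr_gt0.
near=> h.
have h0 : h != 0 by near: h; exact: nbhs_dnbhs_neq.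
have hd : `|h| < d by near: h; exact: dnbhs0_lt.
have he : `|h| < e / (`|M| + 1) by near: h; exact: dnbhs0_lt.
have hh : 0 < `|h| by rewrite normr_gt0.
rewrite distrC -(ltr_pM2l hh) -normrM mulrBr.
have -> : h * (h^-1 *: (f (h *: 1 + x) - f x)) = f (x + h) - f x.
  by rewrite [h^-1 *: _]/(h^-1 * _) mulrA divff // mul1r [h *: 1]mulr1 [h + x]addrC.
have M0 : M * `|h| ^+ 2 <= (`|M| + 1) * `|h| ^+ 2.
  have Mh : 0 <= M.
    by rewrite -(pmulr_lge0 _ (exprn_gt0 2 hh)) (le_trans _ (hM _ hd)).
  by rewrite ler_wpM2r ?exprn_ge0 // ger0_norm // lerDl.
apply: (le_lt_trans (le_trans (hM _ hd) M0)).
by rewrite expr2 mulrCA ltr_pM2l // mulrC -ltr_pdivlMr.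
Unshelve. all: by end_near. Qed.

Lemma is_derive_near (f g : C -> C) (x l d : C) : 0 < d ->
  (forall h, `|h| < d -> f (x + h) = g (x + h)) ->
  is_derive x 1 f l -> is_derive x 1 g l.
Proof.
move=> d0 fg; apply: near_eq_is_derive; near=> y.
have yd : `|y - x| < d by rewrite distrC; near: y; exact: cvgr_dist_lt.
by have := fg _ yd; rewrite addrC subrK.
Unshelve. all: by end_near. Qed.

Lemma is_derive1E (f : C -> C) (x l : C) : is_derive x 1 f l -> derive1 f x = l.
Proof. by move=> h; rewrite derive1E; exact: derive_val. Qed.

(** Summability of the constants of the quadratic remainders takes the place of locally uniform
    convergence of the differentiated series. *)
Lemma is_derive_tsum (T : choiceType) (f : T -> C -> C) (f' : T -> C) (M : T -> C)
    (x d : C) : 0 < d -> summ M -> summ f' ->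
  (forall h, `|h| < d -> summ (fun t => f t (x + h))) ->
  (forall t h, `|h| < d ->
     `|f t (x + h) - f t x - h * f' t| <= `|M t| * `|h| ^+ 2) ->
  is_derive x 1 (fun y => tsum (fun t => f t y)) (tsum f').
Proof.
move=> d0 sM sf' sf hM.
apply: (@is_derive_quad _ _ _ d `|tsum (fun t => `|M t|)|) => // h hd.
have sx : summ (fun t => f t x) by rewrite -[x]addr0; apply: sf; rewrite normr0.
have shf : summ (fun t => h * f' t) by exact: summZ.
rewrite -tsumZ // -tsumB //; last exact: sf.
rewrite -tsumB //; last by apply: summB => //; exact: sf.
apply: tsum_le => B; rewrite (le_trans (ler_sum _ (fun t _ => hM t h hd))) //.
by rewrite -mulr_suml ler_wpM2r ?exprn_ge0 // fsum_norm_le_tsum.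
Qed.

End ComplexDerivative.

Section Germs.
Variable R : realType.
Local Notation C := (Cplx R).

Definition ana_at (r : C) (f : C -> C) (c : nat -> C) :=
  forall x, `|x| < r -> summ (fun n => c n * x ^+ n) /\ f x = tsum (fun n => c n * x ^+ n).

(** The value at 0 is included. A function with a removable singularity must therefore be replaced
    by its extension, as [kron_gf] does for eta F(xi, eta). *)
Definition ana (f : C -> C) (c : nat -> C) := exists2 r : C, 0 < r & ana_at r f c.

Lemma minC_ex (r s : C) : 0 < r -> 0 < s ->
  exists t : C, [/\ 0 < t, t <= r & t <= s].
Proof.
move=> r0 s0; have /orP[rs|sr] := real_leVge (gtr0_real r0) (gtr0_real s0).
  by exists r.
by exists s.
Qed.

Lemma ana_atW (s r : C) f c : s <= r -> ana_at r f c -> ana_at s f c.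
Proof. by move=> sr h x xs; apply: h; exact: lt_le_trans sr. Qed.

Lemma ana2_at f c g d : ana f c -> ana g d ->
  exists r : C, [/\ 0 < r, ana_at r f c & ana_at r g d].
Proof.
move=> [r r0 hf] [s s0 hg]; have [t [t0 tr ts]] := minC_ex r0 s0.
by exists t; split=> //; [exact: ana_atW hf|exact: ana_atW hg].
Qed.

Lemma ana_near (r : C) f g c : 0 < r -> (forall x, `|x| < r -> f x = g x) ->
  ana f c -> ana g c.
Proof.
move=> r0 fg [s s0 hf]; have [t [t0 tr ts]] := minC_ex r0 s0; exists t => // x xt.
by rewrite -fg; [apply: hf; exact: lt_le_trans ts|exact: lt_le_trans tr].
Qed.

Lemma ana_ext f g c d : f =1 g -> c =1 d -> ana f c -> ana g d.
Proof. by move=> /funext -> /funext ->. Qed.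

Lemma anaD f c g d : ana f c -> ana g d ->
  ana (fun x => f x + g x) (fun n => c n + d n).
Proof.
move=> hf hg; have [r [r0 {}hf {}hg]] := ana2_at hf hg; exists r => // x xr.
have [[sf ->] [sg ->]] := (hf x xr, hg x xr).
under eq_fun do rewrite mulrDl.
by split; [exact: summD|rewrite tsumD].
Qed.

Lemma anaZ k f c : ana f c -> ana (fun x => k * f x) (fun n => k * c n).
Proof.
move=> [r r0 hf]; exists r => // x /hf[sf ->].
under eq_fun do rewrite -mulrA.
by split; [exact: summZ|rewrite tsumZ].
Qed.

Lemma anaB f c g d : ana f c -> ana g d ->
  ana (fun x => f x - g x) (fun n => c n - d n).
Proof.
move=> hf /(anaZ (-1)) hg; apply: ana_ext (anaD hf hg) => [x|n];
by rewrite mulN1r.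
Qed.

Lemma ana_cst k : ana (fun=> k) (fun n => if n is 0%N then k else 0).
Proof.
exists 1 => // x _; have h : has_tsum (fun n => (if n is 0%N then k else 0) * x ^+ n) k.
  have := @has_tsum_point _ _ 0%N (fun n => (if n is 0%N then k else 0) * x ^+ n).
  by rewrite mulr1; apply=> -[//|n] _; rewrite mul0r.
split; last by rewrite (tsumE h).
by apply: (@summ_recl _ _); apply: summ_le (summ0 _ _) _ => n; rewrite mul0r.
Qed.

Lemma anaM f c g d : ana f c -> ana g d -> ana (fun x => f x * g x) (conv c d).
Proof.
move=> hf hg; have [r [r0 {}hf {}hg]] := ana2_at hf hg; exists r => // x xr.
have [[sf ->] [sg ->]] := (hf x xr, hg x xr).
have [] := cauchy_product sf sg.
have -> : conv (fun n => c n * x ^+ n) (fun n => d n * x ^+ n) =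
          fun n => conv c d n * x ^+ n.
  apply/funext => n; rewrite /conv mulr_suml; apply: eq_bigr => i _.
  have ni : (i <= n)%N by rewrite -ltnS.
  have -> : x ^+ n = x ^+ i * x ^+ (n - i) by rewrite -exprD subnKC.
  by ring.
by move=> s ->.
Qed.

Lemma ana_shift_at f c r : 0 < r -> ana_at r f c ->
  exists2 g, ana g (fun n => c n.+1) & forall x, `|x| < r -> f x = c 0%N + x * g x.
Proof.
move=> r0 hf; exists (fun x => tsum (fun n => c n.+1 * x ^+ n)).
  exists r => // x xr; split=> //; have [-> |x0] := eqVneq x 0.
    apply: summ_recl; apply: summ_le (summ0 _ _) _ => n.
    by rewrite exprS mul0r mulr0.
  have [sf _] := hf x xr; have := summ_comp succn_inj sf => /(summZ x^-1).
  by congr summ; apply/funext => n; rewrite exprS mulrCA mulKf.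
move=> x xr; have [sf ->] := hf x xr; rewrite tsum_recl // mulr1; congr (_ + _).
have [-> |x0] := eqVneq x 0.
  rewrite mul0r -[RHS](tsum0 R nat); congr tsum; apply/funext => n.
  by rewrite exprS mul0r mulr0.
have sS := summZ x^-1 (summ_comp succn_inj sf).
rewrite -[LHS]mul1r -(divff x0) -mulrA -tsumZ; last exact: summ_comp succn_inj sf.
by congr (_ * tsum _); apply/funext => n; rewrite exprS mulrCA mulKf.
Qed.

Lemma ana_shift f c : ana f c ->
  exists2 g, ana g (fun n => c n.+1) &
  exists2 r : C, 0 < r & forall x, `|x| < r -> f x = c 0%N + x * g x.
Proof. by move=> [r r0 /(ana_shift_at r0)[g hg hfg]]; exists g => //; exists r. Qed.

Lemma ana_bounded f c : ana f c ->
  exists2 r : C, 0 < r & exists M : C, forall x, `|x| < r -> `|f x| <= M.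
Proof.
move=> [r r0 hf]; pose s := r / 2; have s0 : 0 < s by rewrite divr_gt0.
have sr : `|s| < r by rewrite gtr0_norm // ltr_pdivrMr // mulr_natr mulr2n ltrDl.
exists s => //; exists `|tsum (fun n => `|c n * s ^+ n|)| => x xs.
have sr' : s < r by rewrite -(gtr0_norm s0).
have [_ ->] := hf _ (lt_trans xs sr').
have [ss _] := hf _ sr; apply: tsum_le => B.
apply: le_trans (fsum_norm_le_tsum B ss); apply: ler_sum => n _.
by rewrite !normrM ler_wpM2l // !normrX lerXn2r ?nnegrE // (gtr0_norm s0) ltW.
Qed.

(** The nonzero zeros accumulate at 0. The identity principle is stated under this weak hypothesis
    because identities for the Kronecker series are available only on a half disc. *)
Definition freq_zero (f : C -> C) :=
  forall d : C, 0 < d -> exists x : C, [/\ x != 0, `|x| < d & f x = 0].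

Lemma ana_eq0_0 f c : ana f c -> freq_zero f -> c 0%N = 0.
Proof.
move=> hf fz.
have [g hg [r r0 fg]] := ana_shift hf; have [s s0 [M hM]] := ana_bounded hg.
apply/eqP; rewrite -normr_eq0; apply/eqP/le_anti; rewrite normr_ge0 andbT.
apply/ler_addgt0Pr => e e0; rewrite add0r.
have M1 : 0 < `|M| + 1 by rewrite ltr_wpDl.
have [t [t0 tr ts]] := minC_ex r0 s0.
have [t' [t'0 t't t'e]] := minC_ex t0 (divr_gt0 e0 M1).
have [x [x0 xt fx]] := fz _ t'0.
have xr : `|x| < r by apply: lt_le_trans xt (le_trans t't tr).
have xs : `|x| < s by apply: lt_le_trans xt (le_trans t't ts).
have := fg x xr; rewrite fx => /esym/eqP; rewrite addr_eq0 => /eqP ->.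
rewrite normrN normrM.
have gM : `|g x| <= `|M| + 1.
  have Mx := hM _ xs; have M0 : 0 <= M by exact: le_trans Mx.
  by rewrite (le_trans Mx) // ger0_norm // lerDl.
rewrite (le_trans (ler_pM _ _ (lexx _) gM)) // -ler_pdivlMr //.
exact: le_trans (ltW xt) t'e.
Qed.

(** The constant term vanishes by continuity along the zeros; division by x then gives a germ with
    the same nonzero zeros near 0 and the shifted coefficients. *)
Lemma ana_eq0 f c : ana f c -> freq_zero f -> forall n, c n = 0.
Proof.
move=> hf fz n; elim: n f c hf fz => [|n IHn] f c hf fz; first exact: ana_eq0_0 hf fz.
have c0 := ana_eq0_0 hf fz.
have [g hg [r r0 fg]] := ana_shift hf; apply: (IHn _ _ hg) => d d0.
have [t [t0 tr td]] := minC_ex r0 d0; have [x [x0 xt fx]] := fz _ t0.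
exists x; split=> //; first exact: lt_le_trans td.
have := fg x (lt_le_trans xt tr); rewrite fx c0 add0r => /esym/eqP.
by rewrite mulf_eq0 (negPf x0) => /eqP.
Qed.

Lemma ana_unique f c g d : ana f c -> ana g d ->
  freq_zero (fun x => f x - g x) -> c =1 d.
Proof.
move=> hf hg fz n; apply/eqP; rewrite -subr_eq0; apply/eqP.
exact: (ana_eq0 (anaB hf hg) fz n).
Qed.

Lemma freq_zero_near (r : C) f : 0 < r ->
  (forall x, x != 0 -> `|x| < r -> f x = 0) -> freq_zero f.
Proof.
move=> r0 hf d d0; have [t [t0 tr td]] := minC_ex r0 d0.
have t2 : `|t / 2| < t by rewrite gtr0_norm ?divr_gt0 // ltr_pdivrMr // mulr_natr mulr2n ltrDl.
exists (t / 2); split; first by rewrite gt_eqF // divr_gt0.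
  exact: lt_le_trans td.
apply: hf; first by rewrite gt_eqF // divr_gt0.
exact: lt_le_trans tr.
Qed.

Lemma ana_scale k f c : ana f c -> ana (fun x => f (k * x)) (fun n => c n * k ^+ n).
Proof.
move=> [r r0 hf]; have k1 : 0 < `|k| + 1 by rewrite ltr_wpDl.
exists (r / (`|k| + 1)) => [|x]; first exact: divr_gt0.
rewrite ltr_pdivlMr // => xr.
have /hf : `|k * x| < r.
  by rewrite normrM mulrC (le_lt_trans _ xr) // ler_wpM2l // lerDl.
have -> : (fun n => c n * (k * x) ^+ n) = fun n => c n * k ^+ n * x ^+ n.
  by apply/funext => n; rewrite exprMn mulrA.
by [].
Qed.

Lemma summ_bounded (f : nat -> C) : summ f -> exists M : C, forall n, `|f n| <= M.
Proof.
by case=> M hM; exists M => n; have := hM [fset n]%fset; rewrite big_seq_fset1.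
Qed.

(** The remainder D_n satisfies D_(n+1) = (x + h) D_n + n x^(n-1) h^2. The factor rho^2 stands on
    the left so that no power rho^(n-2) has to be written for n < 2. *)
Lemma expr_taylor_bound (x h rho : C) n : `|x| <= rho -> `|x + h| <= rho ->
  `|(x + h) ^+ n - x ^+ n - h * (n%:R * x ^+ n.-1)| * rho ^+ 2 <=
  n%:R ^+ 2 * rho ^+ n * `|h| ^+ 2.
Proof.
move=> xr xhr; have r0 : 0 <= rho by exact: le_trans xr.
elim: n => [|n IHn].
  by rewrite !expr0 subrr mul0r mulr0 subrr normr0 !mul0r expr0n !mul0r.
set D := (_ - _ - _) in IHn.
have -> : (x + h) ^+ n.+1 - x ^+ n.+1 - h * (n.+1%:R * x ^+ n) =
          (x + h) * D + n%:R * x ^+ n.-1 * h ^+ 2.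
  rewrite /D; case: n {IHn D} => [|n] /=; first by rewrite !expr0 !expr1; ring.
  by rewrite !exprS; ring.
have IH2 : `|(x + h) * D| * rho ^+ 2 <= rho * (n%:R ^+ 2 * rho ^+ n * `|h| ^+ 2).
  rewrite normrM -[leLHS]mulrA; apply: (ler_pM _ _ xhr IHn) => //.
  by apply: mulr_ge0 => //; exact: exprn_ge0.
have h2 : `|n%:R * x ^+ n.-1 * h ^+ 2| * rho ^+ 2 <= n%:R * rho ^+ n.+1 * `|h| ^+ 2.
  case: n {IHn D IH2} => [|n]; first by rewrite !mul0r normr0 !mul0r.
  rewrite !normrM normr_nat !normrX [leRHS](_ : _ = n.+1%:R * rho ^+ n * `|h| ^+ 2 * rho ^+ 2);
    last by rewrite !exprS; ring.
  rewrite ler_wpM2r ?exprn_ge0 // ler_wpM2r ?exprn_ge0 // ler_wpM2l //.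
  by rewrite lerXn2r ?nnegrE.
apply: le_trans (ler_wpM2r _ (ler_normD _ _)) _; first exact: exprn_ge0.
rewrite mulrDl (le_trans (lerD IH2 h2)) //.
have -> : rho * (n%:R ^+ 2 * rho ^+ n * `|h| ^+ 2) + n%:R * rho ^+ n.+1 * `|h| ^+ 2 =
    (n%:R ^+ 2 + n%:R) * (rho ^+ n.+1 * `|h| ^+ 2) by rewrite !exprS; ring.
rewrite -[leRHS]mulrA ler_wpM2r ?mulr_ge0 ?exprn_ge0 //.
have -> : (n.+1%:R : C) ^+ 2 = (n%:R ^+ 2 + n%:R) + n.+1%:R by rewrite -natr1; ring.
by rewrite lerDl.
Qed.

End Germs.

Section GermDerivative.
Variable R : realType.
Local Notation C := (Cplx R).

Lemma ana_is_derive f c : ana f c ->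
  exists2 r : C, 0 < r & exists2 g, ana g (fun n => n.+1%:R * c n.+1) &
    forall x : C, `|x| < r -> is_derive x (1 : C) f (g x).
Proof.
move=> [r r0 hf].
(* Radii 2 x0 = rho < s < r. Boundedness of c_n s^n makes |c_n| rho^n decay like (rho / s)^n, which
   absorbs the polynomial factors of derivative and remainder; x and h of size at most x0 keep x + h
   in the disc of radius rho. *)
pose s := r / 2; have s0 : 0 < s by rewrite divr_gt0.
have sr : s < r by rewrite ltr_pdivrMr // mulr_natr mulr2n ltrDl.
clearbody s.
pose rho := s / 2; have rho0 : 0 < rho by rewrite divr_gt0.
have rhos : rho < s by rewrite ltr_pdivrMr // mulr_natr mulr2n ltrDl.
clearbody rho.
pose x0 := rho / 2; have x00 : 0 < x0 by rewrite divr_gt0.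
have x0E : x0 + x0 = rho by rewrite /x0 -splitr.
clearbody x0.
have [ss _] : summ (fun n => c n * s ^+ n) /\ f s = tsum (fun n => c n * s ^+ n).
  by apply: hf; rewrite gtr0_norm.
have [K hK] := summ_bounded ss.
have K0 : 0 <= K by apply: le_trans (hK 0%N).
have rs1 : `|rho / s| < 1 by rewrite gtr0_norm ?divr_gt0 // ltr_pdivrMr // mul1r.
have cK n : `|c n| * rho ^+ n <= K * (rho / s) ^+ n.
  rewrite expr_div_n mulrA ler_pdivlMr ?exprn_gt0 // mulrAC ler_wpM2r ?exprn_ge0 ?(ltW rho0) //.
  by have := hK n; rewrite normrM normrX (gtr0_norm s0).
have sM k : summ (fun n => n.+1%:R ^+ k * (c n * rho ^+ n)).
  apply: (summ_le (summZ K (summ_natX_expr k rs1))) => n.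
  rewrite [in leRHS]mulrCA [leLHS]normrM [leRHS]normrM ler_wpM2l // !normrM.
  rewrite (gtr0_norm (exprn_gt0 _ rho0)) (le_trans (cK n)) //.
  by rewrite !ger0_norm // exprn_ge0 // divr_ge0 // ltW.
have sg x : `|x| < x0 -> summ (fun n => n%:R * x ^+ n.-1 * c n).
  move=> xx; apply: (summ_le (summZ rho^-1 (sM 1%N))) => -[|n].
    by rewrite !mul0r normr0.
  have xrho : `|x| <= rho by rewrite (le_trans (ltW xx)) // -x0E lerDl ltW.
  rewrite expr1 exprS !normrM normrX !normr_nat normfV (gtr0_norm rho0).
  rewrite (gtr0_norm (exprn_gt0 _ rho0)).
  have -> : rho^-1 * (n.+2%:R * (`|c n.+1| * (rho * rho ^+ n))) =
      n.+2%:R * rho ^+ n * `|c n.+1|.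
    by field; rewrite gt_eqF.
  apply: ler_wpM2r => //; apply: ler_pM => //; rewrite ?exprn_ge0 ?ler_nat //.
  by rewrite lerXn2r ?nnegrE // ltW.
exists x0 => //; exists (fun x => tsum (fun n => n%:R * x ^+ n.-1 * c n)).
  exists x0 => // x xx; have sx := sg x xx.
  have sE : (fun n => n.+1%:R * c n.+1 * x ^+ n) =
            (fun n => (fun n => n%:R * x ^+ n.-1 * c n) n.+1).
    by apply/funext => n /=; rewrite mulrAC.
  rewrite sE; split; first exact: summ_comp succn_inj sx.
  by rewrite [LHS]tsum_recl // !mul0r add0r.
move=> x xx.
have key : is_derive x (1 : C) (fun y => tsum (fun n => c n * y ^+ n))
    (tsum (fun n => n%:R * x ^+ n.-1 * c n)).
  apply: (@is_derive_tsum _ _ _ _ (fun n => rho ^- 2 * (n.+1%:R ^+ 2 * (c n * rho ^+ n))) _ x0)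
      => //.
  - by apply: summZ; exact: sM.
  - exact: sg.
  - move=> h hh; apply: (hf _ _).1; apply: (le_lt_trans (ler_normD _ _)).
    rewrite (lt_trans (ltrD xx hh)) // x0E; exact: lt_trans sr.
  - move=> n h hh.
    have xrho : `|x| <= rho by rewrite (le_trans (ltW xx)) // -x0E lerDl ltW.
    have xhrho : `|x + h| <= rho.
      by rewrite (le_trans (ler_normD _ _)) // -x0E lerD // ltW.
    have -> : c n * (x + h) ^+ n - c n * x ^+ n - h * (n%:R * x ^+ n.-1 * c n) =
       c n * ((x + h) ^+ n - x ^+ n - h * (n%:R * x ^+ n.-1)) by ring.
    rewrite normrM -(ler_pM2r (exprn_gt0 2 rho0)) -[leLHS]mulrA.
    apply: (le_trans (ler_wpM2l _ (expr_taylor_bound n xrho xhrho))) => //.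
    rewrite !normrM normfV !normrX normr_nat (gtr0_norm rho0).
    have -> : rho ^- 2 * (n.+1%:R ^+ 2 * (`|c n| * rho ^+ n)) * `|h| ^+ 2 * rho ^+ 2 =
        `|c n| * (n.+1%:R ^+ 2 * rho ^+ n * `|h| ^+ 2) by field; rewrite gt_eqF.
    rewrite ler_wpM2l // ler_wpM2r ?exprn_ge0 // ler_wpM2r ?exprn_ge0 ?(ltW rho0) //.
    by rewrite lerXn2r ?nnegrE // ler_nat.
apply: (is_derive_near x00 _ key) => h hh; apply/esym/(hf _ _).2.
apply: (le_lt_trans (ler_normD _ _)).
rewrite (lt_trans (ltrD xx hh)) // x0E; exact: lt_trans sr.
Qed.

End GermDerivative.

(** * Computing [taylor0] *)

Section TaylorCoefficients.
Variable R : realType.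
Local Notation C := (Cplx R).

Lemma summ_shift N (f : nat -> C) : summ (fun n => f (N + n)%N) -> summ f.
Proof.
elim: N f => [//|N IHN] f sf; apply: summ_recl; apply: (IHN (fun n => f n.+1)).
by under eq_fun do rewrite -addSn.
Qed.

(** Abel's argument: [taylor0] only promises convergence of partial sums, but convergence at x0
    bounds the terms there, and comparison with (x / x0)^n gives absolute convergence inside. *)
Lemma cvg_series_ana (d : nat -> C) (f : C -> C) (x0 : C) : 0 < x0 ->
  (forall x, x != 0 -> `|x| <= x0 -> series (fun n => d n * x ^+ n) n @[n --> \oo] --> f x) ->
  exists2 g, ana g d & forall x, x != 0 -> `|x| < x0 -> f x = g x.
Proof.
move=> x00 hf; have x0n : x0 != 0 by rewrite gt_eqF.
have sx x : `|x| < x0 -> summ (fun n => d n * x ^+ n).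
  move=> xx0; have := hf x0 x0n; rewrite gtr0_norm // => /(_ (lexx _))/cvgP.
  move=> /cvg_series_cvg_0/cvgrPdist_lt/(_ 1 ltr01)[N _ hN].
  have r1 : `|x / x0| < 1 by rewrite normf_div (gtr0_norm x00) ltr_pdivrMr // mul1r.
  apply: (@summ_shift N); apply: (summ_le (summ_comp (@addnI N) (summ_geometric r1))) => n /=.
  have /= := hN (N + n)%N (leq_addr _ _); rewrite sub0r normrN => h1.
  rewrite expr_div_n.
  have -> : d (N + n)%N * x ^+ (N + n) =
      (d (N + n)%N * x0 ^+ (N + n)) * (x ^+ (N + n) / x0 ^+ (N + n)).
    by field; rewrite expf_neq0.
  by rewrite [leLHS]normrM -[leRHS]mul1r ler_wpM2r // ltW.
exists (fun x => tsum (fun n => d n * x ^+ n)).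
  by exists x0 => // x xx0; split=> //; exact: sx.
move=> x xn xx0; apply: (cvg_unique _ (hf x xn (ltW xx0))) => //.
exact/cvg_series_tsum/sx.
Qed.

(** [taylor0] chooses some sequence whose series tends to f near 0. The sequence c is a candidate,
    and by [ana_unique] any candidate equals it. *)
Lemma taylor0E (f g : C -> C) (c : nat -> C) (r : C) : 0 < r ->
  (forall x, x != 0 -> `|x| < r -> f x = g x) -> ana g c -> taylor0 f = c.
Proof.
move=> r0 fg ag; rewrite /taylor0; case: xgetP => [d _ /= nd|/(_ c)/=].
  have [s s0 hs] : exists2 s : C, 0 < s & forall x, x != 0 -> `|x| < s ->
      series (fun n => d n * x ^+ n) n @[n --> \oo] --> f x.
    move: nd; rewrite near_withinE => /nbhs_ballP[s s0 hs]; exists s => // x xn xs.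
    by apply: hs => //; rewrite /ball /= sub0r normrN.
  have [||g' ag' hg'] := @cvg_series_ana d f (s / 2).
  - by rewrite divr_gt0.
  - move=> x xn xs; apply: hs => //; apply: le_lt_trans xs _.
    by rewrite ltr_pdivrMr // mulr_natr mulr2n ltrDl.
  have [t [t0 tr ts]] := minC_ex r0 (divr_gt0 s0 (ltr0Sn _ 1)).
  apply/funext; apply: (ana_unique ag' ag); apply: (freq_zero_near t0) => x xn xt.
  rewrite -hg' // ?fg ?subrr //; [exact: lt_le_trans tr|exact: lt_le_trans ts].
case; have [s s0 hs] := ag; have [t [t0 tr ts]] := minC_ex r0 s0.
rewrite near_withinE; apply/nbhs_ballP; exists t => // x.
rewrite /ball /= sub0r normrN => xt xn; rewrite fg //; last exact: lt_le_trans tr.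
have [ss ->] := hs x (lt_le_trans xt ts); exact: cvg_series_tsum.
Qed.

End TaylorCoefficients.

(** * Bounds for the exponential and sums of exponentials *)

Section ExponentialEstimates.
Variable R : realType.
Local Notation C := (Cplx R).
Implicit Types (r s z h : C).

Lemma has_tsum_cexp z : has_tsum (cexp_term z) (cexp z).
Proof. by rewrite cexpE; apply/summ_has_tsum/summ_cexp_term. Qed.

Lemma cexp_term_ge0 r n : 0 <= r -> 0 <= cexp_term r n.
Proof. by move=> r0; rewrite divr_ge0 ?exprn_ge0. Qed.

Lemma norm_cexp_term z n : `|cexp_term z n| = cexp_term `|z| n.
Proof. by rewrite normf_div normrX normr_nat. Qed.

Lemma cexp_ge0 r : 0 <= r -> 0 <= cexp r.
Proof.
by move=> r0; apply: has_tsum_ge0 (has_tsum_cexp r) => n; exact: cexp_term_ge0.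
Qed.

Lemma fsum_cexp_le r (B : {fset nat}) : 0 <= r -> \sum_(n <- B) cexp_term r n <= cexp r.
Proof.
move=> r0; rewrite -[leRHS]ger0_norm ?cexp_ge0 //.
by apply: has_tsum_ge (has_tsum_cexp r) => n; exact: cexp_term_ge0.
Qed.

Lemma cexp_le r s : 0 <= r -> r <= s -> cexp r <= cexp s.
Proof.
move=> r0 rs; have s0 := le_trans r0 rs; rewrite -[leLHS]ger0_norm ?cexp_ge0 // cexpE.
apply: tsum_le => B; apply: le_trans (fsum_cexp_le B s0); apply: ler_sum => n _.
rewrite norm_cexp_term ger0_norm // ler_wpM2r ?invr_ge0 //.
by rewrite lerXn2r ?nnegrE.
Qed.

Lemma cexp_ge1 r : 0 <= r -> 1 <= cexp r.
Proof. by move=> r0; rewrite -(cexp0 R) cexp_le. Qed.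

Lemma norm_cexp_le z : `|cexp z| <= cexp `|z|.
Proof.
rewrite cexpE; apply: tsum_le => B.
by under eq_bigr do rewrite norm_cexp_term; exact: fsum_cexp_le.
Qed.

Lemma cexp_sub1 z : cexp z - 1 = tsum (fun n => cexp_term z n.+1).
Proof.
rewrite cexpE tsum_recl; last exact: summ_cexp_term.
by rewrite {1}/cexp_term expr0 fact0 divr1 addrC addKr.
Qed.

Lemma cexp_sub1_le z : `|cexp z - 1| <= `|z| * cexp `|z|.
Proof.
rewrite cexp_sub1; apply: tsum_le => B.
apply: le_trans (ler_wpM2l (normr_ge0 z) (fsum_cexp_le B (normr_ge0 z))).
rewrite mulr_sumr; apply: ler_sum => n _; rewrite norm_cexp_term /cexp_term exprS -mulrA.
rewrite ler_wpM2l // ler_wpM2l ?exprn_ge0 // lef_pV2 ?posrE ?ltr0n ?fact_gt0 //.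
by rewrite ler_nat leq_fact.
Qed.

Lemma cexp_sub1B_le z : `|cexp z - 1 - z| <= `|z| ^+ 2 * cexp `|z|.
Proof.
have sS : summ (fun n => cexp_term z n.+1) := summ_comp succn_inj (summ_cexp_term z).
rewrite cexp_sub1 tsum_recl // {1}/cexp_term expr1 divr1 addrC addKr.
apply: tsum_le => B.
apply: le_trans (ler_wpM2l (exprn_ge0 2 (normr_ge0 z)) (fsum_cexp_le B (normr_ge0 z))).
rewrite mulr_sumr; apply: ler_sum => n _; rewrite norm_cexp_term /cexp_term !exprS expr0 mulr1.
rewrite !mulrA -[leRHS]mulrA -[leLHS]mulrA ler_wpM2l ?mulr_ge0 //.
rewrite ler_wpM2l ?exprn_ge0 // lef_pV2 ?posrE ?ltr0n ?fact_gt0 //.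
by rewrite ler_nat leq_fact // leqW.
Qed.

Lemma is_derive_cexp (a b x : C) :
  is_derive x (1 : C) (fun y : C => cexp (a * y + b)) (a * cexp (a * x + b)).
Proof.
apply: (@is_derive_quad _ _ _ _ 1 (`|cexp (a * x + b)| * (`|a| ^+ 2 * cexp `|a|))) => // h h1.
have -> : cexp (a * (x + h) + b) - cexp (a * x + b) - h * (a * cexp (a * x + b)) =
    cexp (a * x + b) * (cexp (a * h) - 1 - a * h).
  have -> : a * (x + h) + b = (a * x + b) + a * h by ring.
  by rewrite cexpD; ring.
rewrite normrM -[leRHS]mulrA ler_wpM2l //; apply: (le_trans (cexp_sub1B_le _)).
rewrite normrM exprMn [leRHS]mulrAC ler_wpM2l ?mulr_ge0 ?exprn_ge0 //.
by rewrite cexp_le ?mulr_ge0 // ler_piMr // ltW.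
Qed.

Lemma ana_cexp (a : C) : ana (fun x => cexp (a * x)) (cexp_term a).
Proof.
exists 1 => // x _; have e : (fun n => cexp_term a n * x ^+ n) = cexp_term (a * x).
  by apply/funext => n; rewrite /cexp_term exprMn mulrAC.
by rewrite e cexpE; split=> //; exact: summ_cexp_term.
Qed.

(** Expand each exponential and exchange the sums over T and over the degree; the weights exp(|l_t|
    rho) dominate both. Theta, its quotient by 1 - e and the regularised Kronecker series all have
    this form, with l_t = 2 pi i t and T the integers. *)
Lemma ana_at_expsum (T : choiceType) (c l : T -> C) (rho : C) : 0 < rho ->
  summ (fun t => c t * cexp (`|l t| * rho)) ->
  ana_at rho (fun x => tsum (fun t => c t * cexp (l t * x)))
    (fun n => tsum (fun t => c t * cexp_term (l t) n)).
Proof.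
move=> rho0 sb x xr.
pose F (p : T * nat) := c p.1 * cexp_term (l p.1 * x) p.2.
have FE t n : F (t, n) = c t * cexp_term (l t) n * x ^+ n.
  by rewrite /F /cexp_term exprMn; ring.
have sF : summ F.
  apply: (summ_sigma sb) => t B; rewrite /F /=.
  under eq_bigr do rewrite normrM norm_cexp_term.
  rewrite -mulr_sumr [leRHS]normrM ler_wpM2l //.
  apply: le_trans (fsum_cexp_le B (normr_ge0 _)) _.
  have lr : 0 <= `|l t| * rho by rewrite mulr_ge0 // ltW.
  by rewrite [leRHS]ger0_norm ?cexp_ge0 // cexp_le // normrM ler_wpM2l // ltW.
pose sw (p : nat * T) := (p.2, p.1).
have sb' : bijective sw by exists (fun p => (p.2, p.1)) => -[].
have sF' : summ (fun p => F (sw p)) by apply/(summ_reindex _ sb').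
have sn n : summ (fun t => c t * cexp_term (l t) n).
  apply: (summ_le (summZ (rho ^- n) sb)) => t.
  have rn : 0 < rho ^+ n by rewrite exprn_gt0.
  rewrite [leLHS]normrM [leRHS](_ : _ = `|c t| * (`|cexp (`|l t| * rho)| / rho ^+ n)).
    rewrite ler_wpM2l // ler_pdivlMr // norm_cexp_term.
    have -> : cexp_term `|l t| n * rho ^+ n = cexp_term (`|l t| * rho) n.
      by rewrite /cexp_term exprMn mulrAC.
    have lr : 0 <= `|l t| * rho by rewrite mulr_ge0 // ltW.
    have := fsum_cexp_le [fset n]%fset lr; rewrite big_seq_fset1 => /le_trans; apply.
    by rewrite [leRHS]ger0_norm ?cexp_ge0.
  by rewrite !normrM normfV (gtr0_norm rn) mulrCA [X in _ * X]mulrC.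
have rowE : (fun n => tsum (fun t => c t * cexp_term (l t) n) * x ^+ n) =
    fun n => tsum (fun t => F (t, n)).
  apply/funext => n; rewrite mulrC -tsumZ //; congr tsum; apply/funext => t.
  by rewrite FE mulrC.
rewrite rowE; split.
  exact: (@summ_fubini _ _ _ (fun p => F (sw p))).
rewrite -tsum_swap //; congr tsum; apply/funext => t; rewrite cexpE -tsumZ //.
exact: summ_cexp_term.
Qed.

Lemma summ_expsum (T : choiceType) (c l : T -> C) (rho x : C) : 0 < rho ->
  summ (fun t => c t * cexp (`|l t| * rho)) -> `|x| <= rho ->
  summ (fun t => c t * cexp (l t * x)).
Proof.
move=> rho0 sb xr; apply: (summ_le sb) => t; rewrite !normrM ler_wpM2l //.
apply: (le_trans (norm_cexp_le _)); rewrite [leRHS]ger0_norm.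
  by rewrite cexp_le // normrM ler_wpM2l.
by rewrite cexp_ge0 // mulr_ge0 // ltW.
Qed.

End ExponentialEstimates.

(** * Bernoulli numbers *)

Section BernoulliSeries.
Variable R : realType.
Local Notation C := (Cplx R).

Lemma is_derive_mul (f g : C -> C) (x f' g' : C) :
  is_derive x (1 : C) g g' -> is_derive x (1 : C) f f' ->
  is_derive x (1 : C) (fun y => f y * g y) (f x * g' + g x * f').
Proof. by move=> hg hf; exact: is_deriveM. Qed.

Lemma ana_mulX (g : C -> C) (d : nat -> C) : ana g d ->
  ana (fun x => x * g x) (fun n => if n is m.+1 then d m else 0).
Proof.
case=> s s0 hs; exists s => // x xs; have [sg ->] := hs x xs.
have e : (fun n => d n * x ^+ n.+1) = fun n => x * (d n * x ^+ n).
  by apply/funext => n; rewrite exprS mulrCA.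
have ss : summ (fun n => (if n is m.+1 then d m else 0) * x ^+ n).
  by apply: summ_recl; rewrite e; exact: summZ.
by split=> //; rewrite [RHS]tsum_recl // mul0r add0r e tsumZ.
Qed.

(** The list of all earlier values makes the strong recursion structural. The recursion says that
    the series times (e^x - 1) / x is 1. *)
Fixpoint bern_seq n : seq C :=
  if n is m.+1 then
    rcons (bern_seq m)
      ((m == 0%N)%:R - \sum_(i < m) (bern_seq m)`_i / (m - i).+1`!%:R)
  else [::].

(* B_n / n! *)
Definition bern n := (bern_seq n.+1)`_n.

Lemma size_bern_seq n : size (bern_seq n) = n.
Proof. by elim: n => //= n IHn; rewrite size_rcons IHn. Qed.

Lemma nth_bern_seq n i : (i < n)%N -> (bern_seq n)`_i = bern i.
Proof.
elim: n => // n IHn; rewrite ltnS leq_eqVlt => /predU1P[-> //|i_n].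
by rewrite /= nth_rcons size_bern_seq i_n IHn.
Qed.

Lemma bernE n :
  bern n = (n == 0%N)%:R - \sum_(i < n) bern i / (n - i).+1`!%:R.
Proof.
rewrite /bern /= nth_rcons size_bern_seq ltnn eqxx; congr (_ - _).
by apply: eq_bigr => i _; rewrite nth_bern_seq.
Qed.

(** Crude but sufficient, since only the germ at 0 matters: 2^k <= (k + 1)! dominates the recursion
    by a geometric sum that stays below 1. *)
Lemma bern_le1 n : `|bern n| <= 1.
Proof.
elim/ltn_ind: n => n IHn; rewrite bernE; case: n => [|n] in IHn *.
  by rewrite big_ord0 subr0 normr1.
rewrite sub0r normrN (le_trans (ler_norm_sum _ _ _)) //.
have fact2 k : (2 ^ k <= k.+1`!)%N.
  by elim: k => // k IHk; rewrite expnS factS leq_mul.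
apply: (@le_trans _ _ (\sum_(i < n.+1) (2^-1 : C) ^+ i.+1)).
  rewrite (reindex_inj rev_ord_inj) /=; apply: ler_sum => i _.
  rewrite subSS normf_div normr_nat.
  have ni : (n - (n - i) = i)%N by rewrite subKn // -ltnS.
  have -> : (n.+1 - (n - i) = i.+1)%N by rewrite subSn ?leq_subr // ni.
  rewrite ler_pdivrMr ?ltr0n ?fact_gt0 //; apply: (le_trans (IHn _ _)).
    by rewrite ltnS leq_subr.
  rewrite exprVn mulrC ler_pdivlMr ?exprn_gt0 // mul1r -natrX ler_nat.
  by apply: leq_trans (fact2 i.+1) _; rewrite leq_fact.
have -> : \sum_(i < n.+1) (2^-1 : C) ^+ i.+1 = 1 - 2^-1 ^+ n.+1.
  rewrite -geometric_sum mulr_sumr; apply: eq_bigr => i _.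
  by rewrite exprS; field.
by rewrite gerBl exprn_ge0 // invr_ge0.
Qed.

Definition bern_gf (x : C) := tsum (fun n => bern n * x ^+ n).

Lemma ana_bern_gf : ana_at 1 bern_gf bern.
Proof.
move=> x x1; split=> //; apply: (summ_le (summ_geometric x1)) => n.
by rewrite normrM ler_piMl // bern_le1.
Qed.

Lemma bern_gfM (x : C) : `|x| < 1 -> bern_gf x * (cexp x - 1) = x.
Proof.
move=> x1; have [sb _] := ana_bern_gf x1.
have [->|x0] := eqVneq x 0; first by rewrite cexp0 subrr mulr0.
have sS : summ (fun n => cexp_term x n.+1) := summ_comp succn_inj (summ_cexp_term x).
have sE := summZ x^-1 sS.
have -> : cexp x - 1 = x * tsum (fun n => x^-1 * cexp_term x n.+1).
  by rewrite tsumZ // mulVKf // cexp_sub1.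
have [_] := cauchy_product sb sE.
set c := conv _ _ => hc; rewrite mulrCA /bern_gf -hc.
suff -> : tsum c = c 0%N.
  rewrite /c /conv big_ord1 subnn /cexp_term bernE big_ord0 subr0 (_ : 1`! = 1%N) //.
  by rewrite expr0 expr1 divr1 !mul1r mulVf // mulr1.
rewrite (@tsum_ord _ _ 1) ?big_ord1 // => -[//|n] _.
rewrite /c /conv.
have -> : \sum_(i < n.+2) bern i * x ^+ i * (x^-1 * cexp_term x (n.+1 - i).+1) =
    x ^+ n.+1 * (\sum_(i < n.+2) bern i / (n.+1 - i).+1`!%:R).
  rewrite mulr_sumr; apply: eq_bigr => i _; rewrite /cexp_term.
  have -> : x ^+ n.+1 = x ^+ i * x ^+ (n.+1 - i) by rewrite -exprD subnKC // -ltnS.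
  by rewrite [x ^+ (_ - i).+1]exprS; field; rewrite x0 pnatr_eq0 -lt0n fact_gt0.
rewrite big_ord_recr /= subnn (_ : 1`! = 1%N) // divr1 [bern n.+1]bernE sub0r.
by rewrite subrr mulr0.
Qed.

Lemma ana_bern : ana bern_gf bern.
Proof. by exists 1 => //; exact: ana_bern_gf. Qed.

Lemma cexp_sub1_neq0 (x : C) : `|x| < 1 -> x != 0 -> cexp x - 1 != 0.
Proof.
by move=> x1; apply: contraNneq => e; rewrite -(bern_gfM x1) e mulr0.
Qed.

Lemma bern_gfE (x : C) : `|x| < 1 -> x != 0 -> bern_gf x = x / (cexp x - 1).
Proof.
by move=> x1 x0; rewrite -{2}(bern_gfM x1) mulfK // cexp_sub1_neq0.
Qed.

Lemma bernoulliE n : bernoulli R n = n`!%:R * bern n.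
Proof.
rewrite /bernoulli (taylor0E ltr01 _ ana_bern) // => x x0 x1.
by rewrite bern_gfE.
Qed.

(** Comparison of coefficients in (- x) / (e^(-x) - 1) = x / (e^x - 1) + x. *)
Lemma bern_parity n : bern n * (-1) ^+ n = bern n + (n == 1%N)%:R.
Proof.
have aL := ana_scale (-1) ana_bern.
have aid : ana (fun x : C => x) (fun n => (n == 1%N)%:R).
  exists 1 => // x _.
  have h : has_tsum (fun n => (n == 1%N)%:R * x ^+ n) x.
    have := @has_tsum_point _ _ 1%N (fun n => (n == 1%N)%:R * x ^+ n).
    by rewrite eqxx mul1r expr1; apply=> y /negPf ->; rewrite mul0r.
  split; last by rewrite (tsumE h).
  do 2!apply: summ_recl; apply: (summ_le (summ0 _ _)) => m.
  by rewrite mul0r.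
apply: (ana_unique aL (anaD ana_bern aid)); apply: (freq_zero_near ltr01) => x x0 x1.
have nx1 : `|-1 * x| < 1 by rewrite mulN1r normrN.
have nx0 : -1 * x != 0 by rewrite mulN1r oppr_eq0.
have e1 := cexp_sub1_neq0 x1 x0; rewrite !bern_gfE // mulN1r cexpN.
have e2 : (cexp x)^-1 - 1 = - (cexp x - 1) / cexp x by field; exact: cexp_neq0.
by rewrite e2; field; rewrite e1 cexp_neq0.
Qed.

Lemma bern_odd k : bern k.+1.*2.+1 = 0.
Proof.
have := bern_parity k.+1.*2.+1; rewrite -signr_odd /= odd_double expr1 mulrN1.
rewrite addr0 => /eqP; rewrite -subr_eq0 -opprD oppr_eq0 -mulr2n mulrn_eq0 /=.
by move/eqP.
Qed.

(** This function gives the polar part of [dkron]. Writing L for [bern_gf], differentiation of L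
    (e^x - 1) = x yields L^2 e^x = L - x L'. *)
Lemma ana_bern_sqr :
  ana (fun x => bern_gf x ^+ 2 * cexp x) (fun n => (1 - n%:R) * bern n).
Proof.
have [r r0 [g ag dg]] := ana_is_derive ana_bern.
have axg : ana (fun x => x * g x) (fun n => n%:R * bern n).
  by apply: ana_ext (ana_mulX ag) => // -[|n]; rewrite ?mul0r.
have [t [t0 tr t1]] := minC_ex r0 (@ltr01 C).
apply: (@ana_near _ t (fun x => bern_gf x - x * g x)) => // [x xt|]; last first.
  by apply: ana_ext (anaB ana_bern axg) => n //; ring.
have x1 : `|x| < 1 by exact: lt_le_trans t1.
have d1 : is_derive x (1 : C) (fun y : C => bern_gf y * (cexp y - 1))
    (bern_gf x * cexp x + (cexp x - 1) * g x).
  apply: is_derive_mul; last by apply: dg; exact: lt_le_trans tr.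
  have := is_derive_cexp 1 0 x; under eq_fun do rewrite mul1r addr0.
  rewrite !mul1r addr0 => h; apply: is_derive_eq; exact: subr0.
have d2 : is_derive x (1 : C) (fun y : C => bern_gf y * (cexp y - 1)) 1.
  have x10 : 0 < 1 - `|x| by rewrite subr_gt0.
  apply: (is_derive_near x10 _ (is_derive_id _ _)) => h hx; rewrite bern_gfM //.
  by apply: (le_lt_trans (ler_normD _ _)); rewrite addrC -ltrBrDr.
have e : bern_gf x * cexp x + (cexp x - 1) * g x = 1.
  by rewrite -(is_derive1E d1) (is_derive1E d2).
have -> : bern_gf x ^+ 2 * cexp x = bern_gf x - (bern_gf x * (cexp x - 1)) * g x.
  by rewrite -[X in _ = X - _](mulr1 (bern_gf x)) -[X in _ * X - _]e; ring.
by rewrite bern_gfM.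
Qed.

End BernoulliSeries.

(** * The function e(z), its kernel, and points off the lattice *)

Section Lattice.
Variable R : realType.
Local Notation C := (Cplx R).
Implicit Types (z w tau : C).

Lemma e_D z w : e_ (z + w) = e_ z * e_ w.
Proof. by rewrite /e_ mulrDr cexpD. Qed.

Lemma e_0 : e_ (0 : C) = 1.
Proof. by rewrite /e_ mulr0 cexp0. Qed.

Lemma e_neq0 z : e_ z != 0.
Proof. exact: cexp_neq0. Qed.

Lemma e_N z : e_ (- z) = (e_ z)^-1.
Proof. by rewrite /e_ mulrN cexpN. Qed.

Lemma e_Mn n z : e_ (n%:R * z) = e_ z ^+ n.
Proof. by rewrite /e_ mulrCA cexpMn. Qed.

Lemma norm_e z : `|e_ z| = (expR (- (2 * pi * complex.Im z)))%:C%C.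
Proof. by rewrite norm_cexp; case: z => a b /=; rewrite mul0r sub0r. Qed.

Lemma norm_e_lt1 z : (`|e_ z| < 1) = (0 < complex.Im z).
Proof.
rewrite norm_e (_ : (1 : C) = (1 : R)%:C%C) // ltcR expR_lt1 oppr_lt0.
by rewrite pmulr_rgt0 // mulr_gt0 // pi_gt0.
Qed.

Lemma e_1 : e_ (1 : C) = 1.
Proof.
rewrite /e_ mulr1 /cexp /= expR0 !mul1r mulr_natl cos2pi sin2pi.
by [].
Qed.

Lemma e_int (m : int) : e_ (m%:~R : C) = 1.
Proof.
have e_nat n : e_ (n%:R : C) = 1 by rewrite -[n%:R]mulr1 e_Mn e_1 expr1n.
case: m => n; first by rewrite -pmulrn e_nat.
by rewrite NegzE mulrNz -pmulrn e_N e_nat invr1.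
Qed.

Lemma e_eq1 z : e_ z = 1 -> exists m : int, z = m%:~R.
Proof.
move=> ez; have : `|e_ z| = 1 by rewrite ez normr1.
rewrite norm_e => /(congr1 (@complex.Re R)) /=; rewrite -expR0.
move=> /expR_inj/eqP; rewrite oppr_eq0 mulf_eq0 gt_eqF ?mulr_gt0 ?pi_gt0 //= => /eqP b0.
case: z ez b0 => a b ez /= b0; rewrite {}b0 in ez *.
pose m := Num.floor a; pose f := a - m%:~R.
have f01 : 0 <= f < 1.
  by rewrite /f subr_ge0 ltrBlDl floor_le_tmp /= -intrD1 floorD1_gt.
have zE : (Complex a 0 : C) = m%:~R + f%:C%C.
  have -> : (m%:~R : C) = (m%:~R : R)%:C%C by rewrite rmorph_int.
  by apply/eqP; rewrite eq_complex /= /f addrC subrK addr0 !eqxx.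
suff f0 : f = 0 by exists m; rewrite zE f0 addr0.
move: ez; rewrite zE e_D e_int mul1r /e_ /cexp /= => /(congr1 (@complex.Re R)) /=.
rewrite !(mul0r, mulr0) subrr expR0 mul1r add0r.
(* Passing to the half angle: cos(2 pi f) = 1 forces sin(pi f) = 0, whereas 0 < f < 1 would make
   this sine positive. *)
have -> : 2 * pi * f = (pi * f) *+ 2 by ring.
rewrite cos_mulr2n => c1; apply/eqP/negPn/negP => f0.
have /sin_gt0_pi : 0 < pi * f < pi.
  have [f_ge0 f_lt1] := andP f01; rewrite mulr_gt0 ?pi_gt0 ?lt0r ?f0 //=.
  by rewrite gtr_pMr ?pi_gt0.
rewrite lt0r => /andP[/negP s0 _]; apply: s0.
by rewrite -sqrf_eq0 sin2cos2; apply/eqP; lra.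
Qed.

Lemma kzb_domainP xi tau : kzb_domain R (xi, tau) <->
  0 < complex.Im tau /\ forall n : int, e_ (xi + n%:~R * tau) != 1.
Proof.
split=> -[/= t0 h]; split=> //.
  move=> n; apply/eqP => /e_eq1[m hm].
  have := h m (- n); rewrite -hm mulrNz mulNr.
  by rewrite addrK eqxx.
move=> m n /=; apply/eqP => e; have := h (- n); rewrite e mulrNz mulNr addrK e_int.
by rewrite eqxx.
Qed.

Lemma summ_int_geo (f : int -> C) (K r : C) j : 0 <= r < 1 ->
  (forall n : int, `|f n| <= K * (`|n|%N.+1%:R ^+ j * r ^+ `|n|%N)) -> summ f.
Proof.
move=> /andP[r0 r1] hf; have r1' : `|r| < 1 by rewrite ger0_norm.
have sg := summZ K (summ_natX_expr j r1').
have h0 n : `|f n| <= `|K * (`|n|%N.+1%:R ^+ j * r ^+ `|n|%N)|.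
  by apply: (le_trans (hf n)); rewrite [leRHS]ger0_norm // (le_trans _ (hf n)).
have [] // := @int_sumP R f.
  by apply: (summ_le sg) => n; exact: h0.
have sS := summ_comp succn_inj sg.
by apply: (summ_le sS) => n; exact: h0.
Qed.

Lemma archiC (x : C) : 0 <= x -> exists N : nat, x < N%:R.
Proof.
move=> x0; have xR : x = (complex.Re x)%:C%C by rewrite RRe_real // ger0_real.
have [N hN] : exists N : nat, complex.Re x < N%:R.
  by exists (Num.bound (complex.Re x)); apply: archi_boundP; rewrite -ler0c -xR.
by exists N; rewrite xR -(rmorph_nat (real_complex R)) ltcR.
Qed.

Lemma exprn_small (r e : C) : 0 <= r < 1 -> 0 < e -> exists N : nat,
  forall n, (N <= n)%N -> r ^+ n < e.
Proof.
move=> r01 e0; have [M hM] := natX_expr_bounded 1 r01.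
have M0 : 0 <= M by apply: le_trans (hM 0%N); rewrite expr1 expr0.
have [N hN] := archiC (divr_ge0 M0 (ltW e0)); exists N => n Nn.
have n0 : 0 < n.+1%:R :> C by rewrite ltr0n.
have := hM n; rewrite expr1 mulrC -ler_pdivlMr // => /le_lt_trans; apply.
rewrite ltr_pdivrMr // mulrC -ltr_pdivrMr //; apply: (lt_le_trans hN).
by rewrite ler_nat leqW.
Qed.

Lemma eventually_bounded (f : nat -> C) (M : C) N :
  (forall n, (N <= n)%N -> `|f n| <= M) -> exists K : C, forall n, `|f n| <= K.
Proof.
move=> hM; exists (\sum_(i < N) `|f i| + M) => n.
have M0 : 0 <= M by apply: le_trans (hM N _).
case: (leqP N n) => [/hM h|nN]; first by rewrite (le_trans h) // lerDr sumr_ge0.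
rewrite (bigD1 (Ordinal nN)) //= -addrA lerDl addr_ge0 // sumr_ge0 //.
Qed.

End Lattice.

Lemma summ_int_halves (R : realType) (f : int -> Cplx R) : summ f ->
  summ (fun n : nat => f (Posz n)) /\ summ (fun n : nat => f (Negz n)).
Proof. by move=> sf; split; apply: (summ_comp _ sf) => m n []. Qed.

(** * The theta function *)

Section Theta.
Variable R : realType.
Local Notation C := (Cplx R).
Variable tau : C.
Hypothesis tau_gt0 : 0 < complex.Im tau.
Let r : C := `|e_ tau|.

Let r_ge0 : 0 <= r. Proof. exact: normr_ge0. Qed.
Let r_gt0 : 0 < r. Proof. by rewrite normr_gt0 e_neq0. Qed.
Let r_lt1 : r < 1. Proof. by rewrite norm_e_lt1. Qed.

(** Since (k + 1/2)^2 / 2 = 1/8 + k (k + 1) / 2, taking out e(tau / 8) and e(xi / 2) turns theta(2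
    pi i xi) into a Laurent series in e(xi) with these coefficients. *)
Definition th_coef (k : int) : C := (-1) ^ k * e_ (k%:~R * (k%:~R + 1) / 2 * tau).

Lemma triangularE (k : nat) : k%:R * (k%:R + 1) / 2 = 'C(k.+1, 2)%:R :> C.
Proof.
elim: k => [|k IHk]; first by rewrite mul0r mul0r.
by rewrite binS natrD -IHk bin1 -natr1; field.
Qed.

Lemma th_coef_Posz (k : nat) : th_coef k = (-1) ^+ k * e_ tau ^+ 'C(k.+1, 2).
Proof. by rewrite /th_coef -pmulrn triangularE e_Mn. Qed.

Lemma th_coef_Negz (k : nat) : th_coef (Negz k) = - th_coef k.
Proof.
rewrite /th_coef -[(-1) ^ Negz k]/((-1) ^- k.+1) invr_sign exprS mulN1r mulNr.
congr (- (_ * e_ (_ * tau))); rewrite NegzE mulrNz -!pmulrn -natr1.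
by field.
Qed.

Lemma th_coef_neq0 k : th_coef k != 0.
Proof. by rewrite mulf_neq0 ?e_neq0 // expfz_neq0 // oppr_eq0 oner_eq0. Qed.

Lemma norm_th_coef (k : nat) : `|th_coef k| = r ^+ 'C(k.+1, 2).
Proof. by rewrite th_coef_Posz normrM !normrX normrN1 expr1n mul1r. Qed.

Lemma th_coefD n k : th_coef (n + k) = th_coef n * th_coef k * e_ (n%:~R * k%:~R * tau).
Proof.
rewrite /th_coef expfzDr ?oppr_eq0 ?oner_eq0 // intrD.
have -> : (n%:~R + k%:~R) * (n%:~R + k%:~R + 1) / 2 * tau =
  n%:~R * (n%:~R + 1) / 2 * tau + k%:~R * (k%:~R + 1) / 2 * tau + n%:~R * k%:~R * tau.
  by field.
by rewrite !e_D; ring.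
Qed.

Lemma summ_gauss (B : C) : 0 <= B -> summ (fun k => r ^+ 'C(k.+1, 2) * B ^+ k).
Proof.
move=> B0; have B1 : 0 < B + 1 by rewrite ltr_wpDl.
have [||N hN] := @exprn_small R r (B + 1)^-1.
- by rewrite r_ge0 r_lt1.
- by rewrite invr_gt0.
have rB : `|r ^+ N * B| < 1.
  rewrite ger0_norm ?mulr_ge0 ?exprn_ge0 //.
  have : r ^+ N * (B + 1) < 1 by rewrite -ltr_pdivlMr // div1r hN.
  by apply: le_lt_trans; rewrite ler_wpM2l ?exprn_ge0 // lerDl.
apply: (summ_le (summZ (r ^- (N * N)) (summ_geometric rB))) => k.
have rN : 0 < r ^+ (N * N) by rewrite exprn_gt0.
(* k (k + 1) / 2 + N^2 >= N k, so the constant r^-(N^2) pays for replacing the Gaussian decay by the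
   ratio r^N B < 1. *)
have e1 : r ^+ 'C(k.+1, 2) * r ^+ (N * N) <= r ^+ (N * k).
  rewrite -exprD ler_wiXn2l // 1?ltW //.
  have := bin2 k.+1; have := mul_bin_diag k.+1 1; rewrite bin1 /=; nia.
rewrite !ger0_norm ?mulr_ge0 ?invr_ge0 ?exprn_ge0 ?mulr_ge0 ?exprn_ge0 //.
rewrite [leRHS]mulrC ler_pdivlMr // mulrAC exprMn -exprM ler_wpM2r ?exprn_ge0 //.
Qed.

Lemma norm_int (k : int) : `|k%:~R| = (`|k|%N)%:R :> C.
Proof. by rewrite -intr_norm -abszE. Qed.

Lemma summ_th_weight (rho : C) : 0 <= rho ->
  summ (fun k => th_coef k * cexp (`|twopii R * k%:~R| * rho)).
Proof.
move=> rho0; pose A := `|twopii R| * rho; pose B := cexp A.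
have A0 : 0 <= A by rewrite mulr_ge0.
have B0 : 0 <= B by rewrite cexp_ge0.
have wE k : cexp (`|twopii R * k%:~R| * rho) = B ^+ `|k|%N.
  by rewrite normrM norm_int mulrAC mulrC cexpMn.
have sg := summ_gauss B0.
have [] // := @int_sumP R (fun k => th_coef k * cexp (`|twopii R * k%:~R| * rho)).
  apply: (summ_le sg) => k; rewrite wE absz_nat [leLHS]normrM norm_th_coef.
  by rewrite [leRHS]normrM (@ger0_norm _ (r ^+ _)) // exprn_ge0.
apply: (summ_le (summZ B sg)) => k; rewrite wE th_coef_Negz [leLHS]normrM normrN.
rewrite norm_th_coef [in leRHS]mulrCA -exprS [leRHS]normrM (@ger0_norm _ (r ^+ _)) //.
exact: exprn_ge0.
Qed.

Definition Theta (xi : C) := tsum (fun k => th_coef k * e_ (k%:~R * xi)).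

Lemma e_lin k (xi : C) : e_ (k%:~R * xi) = cexp (twopii R * k%:~R * xi).
Proof. by rewrite /e_ mulrA. Qed.

Lemma summ_Theta xi : summ (fun k => th_coef k * e_ (k%:~R * xi)).
Proof.
have rho0 : 0 < `|xi| + 1 by rewrite ltr_wpDl.
under eq_fun do rewrite e_lin.
apply: (summ_expsum rho0); first exact/summ_th_weight/ltW.
by rewrite lerDl.
Qed.

Lemma thetaE (xi : C) :
  theta (twopii R * xi) tau = e_ (tau / 8) * e_ (xi / 2) * Theta xi.
Proof.
have tE n : theta_term (twopii R * xi) tau n =
    e_ (tau / 8) * e_ (xi / 2) * (th_coef n * e_ (n%:~R * xi)).
  rewrite /theta_term /th_coef.
  have -> : 2^-1 * (n%:~R + 2^-1) ^+ 2 * tau = tau / 8 + n%:~R * (n%:~R + 1) / 2 * tau.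
    by field.
  rewrite e_D -[cexp _]/(cexp _).
  have -> : cexp ((n%:~R + 2^-1) * (twopii R * xi)) = e_ (xi / 2) * e_ (n%:~R * xi).
    by rewrite -e_D /e_; congr cexp; field.
  by ring.
have sT := summZ (e_ (tau / 8) * e_ (xi / 2)) (summ_Theta xi).
rewrite -tsumZ; last exact: summ_Theta.
have [sP sN] := summ_int_halves sT.
set f := (X in tsum X) in sT *; have [_ ->] := @int_sumP R f sP sN.
rewrite /theta; congr (_ + _).
  by rewrite -lim_series //; congr (limn (series _)); apply/funext => n; rewrite tE.
by rewrite -lim_series //; congr (limn (series _)); apply/funext => n; rewrite tE.
Qed.

Lemma addz_bij (n : int) : bijective (fun k : int => n + k).
Proof. by exists (fun k => k - n) => k; [rewrite [n + k]addrC addrK|rewrite addrC subrK]. Qed.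

Lemma Theta_shift n xi : Theta xi = th_coef n * e_ (n%:~R * xi) * Theta (xi + n%:~R * tau).
Proof.
rewrite {1}/Theta -(tsum_reindex _ (addz_bij n)) -tsumZ; last exact: summ_Theta.
congr tsum; apply/funext => k; rewrite th_coefD intrD.
have -> : (n%:~R + k%:~R) * xi = n%:~R * xi + k%:~R * xi by ring.
have -> : k%:~R * (xi + n%:~R * tau) = k%:~R * xi + n%:~R * k%:~R * tau by ring.
by rewrite !e_D; ring.
Qed.

Lemma summ_Theta_weight (xi rho : C) : 0 < rho ->
  summ (fun k => th_coef k * e_ (k%:~R * xi) * cexp (`|twopii R * k%:~R| * rho)).
Proof.
move=> rho0; have s0 : 0 < rho + `|xi| by rewrite ltr_pwDl.
apply: (summ_le (summ_th_weight (ltW s0))) => k.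
rewrite [leLHS]normrM [X in X * _]normrM [leRHS]normrM -mulrA ler_wpM2l //.
rewrite mulrDr cexpD [leRHS]normrM mulrC ler_wpM2l // e_lin.
apply: (le_trans (norm_cexp_le _)); rewrite normrM.
by rewrite [leRHS]ger0_norm // cexp_ge0 // mulr_ge0.
Qed.

Lemma ana_at_Theta xi rho : 0 < rho ->
  ana_at rho (fun eta => Theta (xi + eta))
    (fun n => tsum (fun k => th_coef k * e_ (k%:~R * xi) * cexp_term (twopii R * k%:~R) n)).
Proof.
move=> rho0; have := ana_at_expsum rho0 (summ_Theta_weight xi rho0).
move=> h x /h[sx <-]; split=> //.
by congr tsum; apply/funext => k; rewrite mulrDr e_D -(e_lin k x) mulrA.
Qed.

Let tail (k : nat) : C := tsum (fun j : nat => th_coef (Posz (k + j))).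

Let summ_tail k : summ (fun j : nat => th_coef (Posz (k + j))).
Proof.
have [sP _] := summ_int_halves (summ_Theta 0).
have -> : (fun j => th_coef (Posz (k + j))) =
    (fun j => (fun n : nat => th_coef n * e_ (n%:~R * 0)) (k + j)%N).
  by apply/funext => j /=; rewrite mulr0 e_0 mulr1.
exact: summ_comp (@addnI k) sP.
Qed.

Let tailS k : tail k = th_coef k + tail k.+1.
Proof.
rewrite /tail tsum_recl // addn0; congr (_ + tsum _).
by apply/funext => j; rewrite addnS.
Qed.

Let tail_le k : `|tail k| <= r ^+ 'C(k.+1, 2) / (1 - r).
Proof.
have r1 : `|r| < 1 by rewrite ger0_norm.
have sE : tsum (fun n => `|r ^+ n|) = (1 - r)^-1.
  rewrite -tsum_geometric //; congr tsum; apply/funext => n.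
  by rewrite ger0_norm // exprn_ge0.
apply: tsum_le => B; have := fsum_norm_le_tsum B (summ_geometric r1).
rewrite sE [leRHS]ger0_norm; last by rewrite invr_ge0 subr_ge0 ltW.
move=> /(ler_wpM2l (exprn_ge0 'C(k.+1, 2) r_ge0)); apply: le_trans.
rewrite mulr_sumr; apply: ler_sum => j _; rewrite norm_th_coef.
rewrite (@ger0_norm _ (r ^+ j)) ?exprn_ge0 // -exprD ler_wiXn2l // 1?ltW //.
have := bin2 (k + j).+1; have := bin2 k.+1.
have := mul_bin_diag k.+1 1; have := mul_bin_diag (k + j).+1 1.
rewrite !bin1 /=; nia.
Qed.

(** The sum of [th_coef] over all indices at most k, that is, the Laurent coefficient of Theta / (1
    - e). By [th_coef_Negz] the total sum is 0, so for k >= 0 the sum equals minus the complementary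
    tail; in this form both ends visibly decay. *)
Definition s_coef (k : int) : C :=
  match k with Posz k => - tail k.+1 | Negz k => - tail k end.

Lemma s_coef_pred k : s_coef k - s_coef (k - 1) = th_coef k.
Proof.
case: k => [[|k]|k].
- by rewrite -[0 - 1]/(Negz 0) /= opprK addrC [tail 0]tailS addrK.
- have -> : Posz k.+1 - 1 = Posz k by lia.
  by rewrite /= opprK addrC [tail k.+1]tailS addrK.
- have -> : Negz k - 1 = Negz k.+1 by lia.
  by rewrite /= opprK [tail k]tailS opprD addrNK th_coef_Negz.
Qed.

(** The extra r^(k+1), absent for negative indices, is what makes [theta_ratio] converge for Im eta
    up to Im tau. *)
Lemma s_coef_Posz_le (k : nat) : `|s_coef k| <= `|th_coef k| * (r ^+ k.+1 / (1 - r)).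
Proof.
by rewrite /= normrN (le_trans (tail_le _)) // norm_th_coef mulrA -exprD binS bin1.
Qed.

Lemma s_coef_Negz_le (k : nat) : `|s_coef (Negz k)| <= `|th_coef (Negz k)| / (1 - r).
Proof. by rewrite /= normrN (le_trans (tail_le _)) // th_coef_Negz normrN norm_th_coef. Qed.

Lemma s_coef_le k : `|s_coef k| <= `|th_coef k| / (1 - r).
Proof.
case: k => k; last exact: s_coef_Negz_le.
apply: (le_trans (s_coef_Posz_le k)); rewrite ler_wpM2l // ler_piMl //.
  by rewrite invr_ge0 subr_ge0 ltW.
by rewrite exprn_ile1 // ltW.
Qed.

Lemma summ_S_weight rho : 0 <= rho ->
  summ (fun k => s_coef k * cexp (`|twopii R * k%:~R| * rho)).
Proof.
move=> rho0; apply: (summ_le (summZ (1 - r)^-1 (summ_th_weight rho0))) => k.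
rewrite [leLHS]normrM [leRHS]normrM [X in _ <= _ * X]normrM mulrA ler_wpM2r //.
apply: (le_trans (s_coef_le k)); rewrite mulrC (@ger0_norm _ (1 - r)^-1) //.
by rewrite invr_ge0 subr_ge0 ltW.
Qed.

(** The entire function Theta(xi) / (1 - e(xi)), which removes the zero at 0. Its value there is
    theta'(0) up to an explicit nonzero factor ([derive_theta0]). *)
Definition theta_quot (xi : C) := tsum (fun k => s_coef k * e_ (k%:~R * xi)).

Lemma summ_theta_quot xi : summ (fun k => s_coef k * e_ (k%:~R * xi)).
Proof.
have rho0 : 0 < `|xi| + 1 by rewrite ltr_wpDl.
under eq_fun do rewrite e_lin.
apply: (summ_expsum rho0); first exact/summ_S_weight/ltW.
by rewrite lerDl.
Qed.

Lemma theta_quotM xi : (1 - e_ xi) * theta_quot xi = Theta xi.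
Proof.
have hs := summ_theta_quot xi.
have sp : summ (fun k => s_coef (k - 1) * e_ (k%:~R * xi)).
  apply/(summ_reindex _ (addz_bij 1)); apply: (summ_le (summZ (e_ xi) hs)) => k.
  rewrite le_eqVlt; apply/orP; left; apply/eqP; congr `|_|.
  by rewrite [1 + k]addrC addrK intrD mulrDl mul1r e_D; ring.
rewrite mulrBl mul1r /Theta.
have -> : e_ xi * theta_quot xi = tsum (fun k => s_coef (k - 1) * e_ (k%:~R * xi)).
  rewrite -(tsum_reindex _ (addz_bij 1)) -tsumZ //; congr tsum; apply/funext => k.
  by rewrite [1 + k]addrC addrK intrD mulrDl mul1r e_D; ring.
rewrite -tsumB //; congr tsum; apply/funext => k.
by rewrite -mulrBl s_coef_pred.
Qed.

Lemma ana_at_theta_quot rho : 0 < rho ->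
  ana_at rho theta_quot (fun n => tsum (fun k => s_coef k * cexp_term (twopii R * k%:~R) n)).
Proof.
move=> rho0; have := ana_at_expsum rho0 (summ_S_weight (ltW rho0)).
move=> h x /h[sx <-]; split=> //.
by congr tsum; apply/funext => k; rewrite -e_lin.
Qed.

(** Positive indices are dominated by powers of e(tau - eta), negative ones by powers of e(eta); the
    two bounds on Im eta make both ratios less than 1. *)
Lemma summ_theta_ratio (eta : C) : 0 < complex.Im eta -> complex.Im eta < complex.Im tau ->
  summ (fun k => s_coef k / th_coef k * e_ (- (k%:~R * eta))).
Proof.
move=> eta0 etat.
have w1 : `|e_ eta| < 1 by rewrite norm_e_lt1.
have v1 : `|e_ (tau - eta)| < 1.
  by rewrite norm_e_lt1 raddfB subr_gt0.
have r1 : 0 <= (1 - r)^-1 by rewrite invr_ge0 subr_ge0 ltW.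
have th0 k : 0 < `|th_coef k| by rewrite normr_gt0 th_coef_neq0.
have [] // := @int_sumP R (fun k => s_coef k / th_coef k * e_ (- (k%:~R * eta))).
  apply: (summ_le (summZ (r / (1 - r)) (summ_geometric v1))) => k.
  have -> : e_ (- ((Posz k)%:~R * eta)) = e_ eta ^- k by rewrite e_N e_Mn.
  rewrite [leLHS]normrM normf_div [leRHS]normrM normrX.
  have -> : `|e_ eta ^- k| = `|e_ eta| ^- k by rewrite normfV normrX.
  have -> : `|e_ (tau - eta)| = r / `|e_ eta| by rewrite e_D e_N normf_div.
  have -> : `|r / (1 - r)| = r / (1 - r) by rewrite ger0_norm // mulr_ge0.
  rewrite expr_div_n [leRHS]mulrA ler_wpM2r ?invr_ge0 ?exprn_ge0 //.
  rewrite ler_pdivrMr // [leRHS]mulrC (le_trans (s_coef_Posz_le k)) // ler_wpM2l //.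
  by rewrite exprS mulrAC.
apply: (summ_le (summZ (e_ eta / (1 - r)) (summ_geometric w1))) => k.
have -> : e_ (- ((Negz k)%:~R * eta)) = e_ eta * e_ eta ^+ k.
  by rewrite NegzE mulrNz mulNr opprK e_Mn exprS.
rewrite [leLHS]normrM normf_div.
rewrite [leRHS](_ : _ = `|(1 - r)^-1| * `|e_ eta * e_ eta ^+ k|); last first.
  by rewrite -normrM; congr `|_|; ring.
rewrite ler_wpM2r // ler_pdivrMr // (@ger0_norm _ (1 - r)^-1) // [leRHS]mulrC.
exact: s_coef_Negz_le.
Qed.

End Theta.

Lemma ana_at_ana (R : realType) (rho : Cplx R) f c : 0 < rho -> ana_at rho f c -> ana f c.
Proof. by exists rho. Qed.

(** * The Kronecker series *)

Section KroneckerSeries.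
Variable R : realType.
Local Notation C := (Cplx R).
Variable tau : C.
Hypothesis tau_gt0 : 0 < complex.Im tau.
Let r : C := `|e_ tau|.

Let r_gt0 : 0 < r. Proof. by rewrite normr_gt0 e_neq0. Qed.
Let r_ge0 : 0 <= r. Proof. exact: ltW. Qed.
Let r_lt1 : r < 1. Proof. by rewrite norm_e_lt1. Qed.

(** The coefficient 1 / (1 - e(xi + n tau)) tends to 1 as n grows. Subtracting 1 for n >= 0 removes
    the geometric series 1 / (1 - e(eta)), which carries the pole at eta = 0; the rest decays
    geometrically at both ends and is analytic near 0. *)
Definition gam (xi : C) (n : int) : C := (1 - e_ (xi + n%:~R * tau))^-1 - (0 <= n)%R%:R.

Let small_geo (a : C) : exists N : nat, forall n, (N <= n)%N ->
  `|e_ (a + n%:R * tau)| <= 2^-1.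
Proof.
have a0 : 0 < 2^-1 / `|e_ a| by rewrite divr_gt0 // ?invr_gt0 // normr_gt0 e_neq0.
have [|N hN] := exprn_small (r := r) _ a0; first by rewrite r_ge0 r_lt1.
exists N => n /hN; rewrite e_D e_Mn normrM normrX ltr_pdivlMr ?normr_gt0 ?e_neq0 //.
by rewrite mulrC => /ltW.
Qed.

Let inv1B_le (u : C) : `|u| <= 2^-1 -> [/\ 1 - u != 0 & `|(1 - u)^-1| <= 2].
Proof.
move=> u2; have h : 2^-1 <= `|1 - u|.
  rewrite (le_trans _ (lerB_dist _ _)) // normr1 lerBrDl.
  rewrite -lerBrDr; apply: (le_trans u2).
  by rewrite [X in X - _](splitr 1) mul1r addrK.
have n0 : 0 < `|1 - u| by apply: lt_le_trans h; rewrite invr_gt0.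
split; first by rewrite -normr_gt0.
by rewrite normfV -[leRHS]invrK lef_pV2 // ?posrE // invr_gt0.
Qed.

(** Lattice points are allowed: the estimate concerns large |n| only, and a vanishing denominator
    has inverse 0. The case xi = 0 serves for the Weierstrass function. *)
Lemma gam_bound xi : exists K : C, forall n, `|gam xi n| <= K * r ^+ `|n|%N.
Proof.
have [N1 h1] := small_geo xi; have [N2 h2] := small_geo (- xi + tau).
have rn n : 0 < r ^+ n by rewrite exprn_gt0.
have [|K1 k1] := @eventually_bounded R (fun n => gam xi n / r ^+ n) (2 * `|e_ xi|) N1.
  move=> n /h1 hn; have [u1 u2] := inv1B_le hn.
  rewrite /gam -pmulrn normf_div normrX normr_id ler_pdivrMr //.
  have -> : (1 - e_ (xi + n%:R * tau))^-1 - 1 =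
    (1 - e_ (xi + n%:R * tau))^-1 * e_ (xi + n%:R * tau) by field.
  rewrite normrM -mulrA; apply: ler_pM => //.
  by rewrite e_D e_Mn normrM normrX.
have [|K2 k2] := @eventually_bounded R (fun n => gam xi (Negz n) / r ^+ n.+1) (2 * `|e_ (- xi)|) N2.
  move=> n /h2 hn; have [u1 u2] := inv1B_le hn.
  rewrite /gam subr0 NegzE mulrNz -pmulrn mulNr.
  set v := e_ (- xi + tau + n%:R * tau) in u1 u2 hn.
  have vE : e_ (xi - n.+1%:R * tau) = v^-1.
    by rewrite /v -e_N -natr1; congr e_; ring.
  have v0 : v != 0 by exact: e_neq0.
  rewrite vE normf_div normrX normr_id ler_pdivrMr //.
  have -> : (1 - v^-1)^-1 = - ((1 - v)^-1 * v).
    have -> : 1 - v^-1 = - (1 - v) / v by field.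
    by rewrite invf_div invrN mulrN mulrC.
  rewrite normrN normrM -mulrA; apply: ler_pM => //.
  rewrite /v -addrA e_D normrM ler_wpM2l //.
  have -> : tau + n%:R * tau = n.+1%:R * tau by rewrite -natr1; ring.
  by rewrite e_Mn normrX.
have K10 : 0 <= K1 by exact: le_trans (k1 0%N).
have K20 : 0 <= K2 by exact: le_trans (k2 0%N).
exists (K1 + K2) => -[n|n].
  have := k1 n; rewrite normf_div normrX normr_id ler_pdivrMr // => /le_trans; apply.
  by rewrite ler_wpM2r ?exprn_ge0 // lerDl.
have := k2 n; rewrite normf_div normrX normr_id ler_pdivrMr // => /le_trans; apply.
by rewrite ler_wpM2r ?exprn_ge0 // lerDr.
Qed.

(** At distance Im tau / 2 the factor |e(n eta)| grows at most like exp(pi Im tau |n|), while the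
    coefficients decay like exp(- 2 pi Im tau |n|). *)
Definition conv_radius : C := (complex.Im tau / 2)%:C%C.

Lemma conv_radius_gt0 : 0 < conv_radius.
Proof. by rewrite ltcR divr_gt0. Qed.

Let B : C := cexp (`|twopii R| * conv_radius).

Let rB_lt1 : 0 <= r * B < 1.
Proof.
have nt : `|twopii R| = (2 * pi)%:C%C.
  by rewrite normc_def /= expr0n add0r sqrtr_sqr ger0_norm // mulr_ge0 // pi_ge0.
have BE : B = (expR (pi * complex.Im tau))%:C%C.
  rewrite /B nt /conv_radius -rmorphM /= /cexp /= cos0 sin0 mulr1 mulr0.
  by congr (Complex (expR _) _); field.
rewrite BE /r norm_e -rmorphM /= -expRD.
rewrite ler0c expR_ge0 (_ : (1 : C) = (1 : R)%:C%C) // ltcR expR_lt1 /=.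
have -> : - (2 * pi * complex.Im tau) + pi * complex.Im tau = - (pi * complex.Im tau) by ring.
by rewrite oppr_lt0 mulr_gt0 // pi_gt0.
Qed.

Lemma summ_gam_weight xi j :
  summ (fun n => n%:~R ^+ j * gam xi n * cexp (`|twopii R * n%:~R| * conv_radius)).
Proof.
have [K hK] := gam_bound xi; apply: (@summ_int_geo R _ K (r * B) j) => // n.
have wE : cexp (`|twopii R * n%:~R| * conv_radius) = B ^+ `|n|%N.
  by rewrite normrM norm_int mulrAC mulrC cexpMn.
have B0 : 0 <= B by rewrite cexp_ge0 // mulr_ge0 // ltW // conv_radius_gt0.
rewrite wE [leLHS]normrM [X in X * _]normrM normrX norm_int exprMn.
rewrite (@ger0_norm _ (B ^+ _)) ?exprn_ge0 //.
rewrite [leRHS](_ : _ = (`|n|%N.+1%:R ^+ j * (K * r ^+ `|n|%N)) * B ^+ `|n|%N); last by ring.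
rewrite ler_wpM2r ?exprn_ge0 //; apply: ler_pM; rewrite ?exprn_ge0 //.
by rewrite lerXn2r ?nnegrE // ler_nat.
Qed.

Definition gam_series xi j (eta : C) := tsum (fun n => n%:~R ^+ j * gam xi n * e_ (n%:~R * eta)).

Lemma summ_gam xi j (eta : C) : `|eta| <= conv_radius ->
  summ (fun n => n%:~R ^+ j * gam xi n * e_ (n%:~R * eta)).
Proof.
move=> h; under eq_fun do rewrite e_lin.
exact: summ_expsum conv_radius_gt0 (summ_gam_weight xi j) h.
Qed.

Definition gam_moment xi j := tsum (fun n => n%:~R ^+ j * gam xi n).

Lemma summ_gam_moment xi j : summ (fun n => n%:~R ^+ j * gam xi n).
Proof.
have := @summ_gam xi j 0; rewrite normr0 => /(_ (ltW conv_radius_gt0)).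
by congr summ; apply/funext => n; rewrite mulr0 e_0 mulr1.
Qed.

Lemma ana_gam_series xi j :
  ana (gam_series xi j) (fun k => twopii R ^+ k / k`!%:R * gam_moment xi (j + k)).
Proof.
have h := ana_at_expsum conv_radius_gt0 (summ_gam_weight xi j).
apply: (ana_ext _ _ (ana_at_ana conv_radius_gt0 h)) => [x|k].
  by congr tsum; apply/funext => t; rewrite e_lin.
rewrite /gam_moment -tsumZ; last exact: summ_gam_moment.
by congr tsum; apply/funext => t; rewrite /cexp_term exprMn exprD; ring.
Qed.

(* For such eta near 0 the Kronecker series converges: |q| < |e(eta)| < 1. *)
Definition near_upper (eta : C) := `|eta| < conv_radius /\ 0 < complex.Im eta.

Lemma Im_le_norm (z : C) : (complex.Im z)%:C%C <= `|z|.
Proof.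
rewrite normc_def lecR (le_trans (ler_norm _)) // -sqrtr_sqr.
by rewrite ler_sqrt ?addr_ge0 ?sqr_ge0 // lerDr sqr_ge0.
Qed.

Lemma near_upper_lt eta : near_upper eta -> complex.Im eta < complex.Im tau.
Proof.
move=> [h _]; rewrite -ltcR; apply: (le_lt_trans (Im_le_norm _)); apply: (lt_trans h).
by rewrite ltcR ltr_pdivrMr // mulr_natr mulr2n ltrDl.
Qed.

Definition nonlattice (xi : C) := forall n : int, e_ (xi + n%:~R * tau) != 1.

Lemma has_tsum_geo_int j (eta : C) : 0 < complex.Im eta ->
  summ (fun n : int => n%:~R ^+ j * (0 <= n)%R%:R * e_ (n%:~R * eta)) /\
  tsum (fun n : int => n%:~R ^+ j * (0 <= n)%R%:R * e_ (n%:~R * eta)) =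
  tsum (fun n : nat => n%:R ^+ j * e_ eta ^+ n).
Proof.
move=> eta0; have w1 : `|e_ eta| < 1 by rewrite norm_e_lt1.
set f := (X in summ X).
have fP : (fun n : nat => f (Posz n)) = fun n => n%:R ^+ j * e_ eta ^+ n.
  by apply/funext => n; rewrite /f /= mulr1 -pmulrn e_Mn.
have fN : (fun n : nat => f (Negz n)) = fun n => 0.
  by apply/funext => n; rewrite /f /= mulr0 mul0r.
have sP : summ (fun n : nat => f (Posz n)).
  rewrite fP; apply: (summ_le (summ_natX_expr j w1)) => n.
  by rewrite !normrM ler_wpM2r // !normrX !normr_nat lerXn2r ?nnegrE // ler_nat.
have sN : summ (fun n : nat => f (Negz n)) by rewrite fN; exact: summ0.
have [sf ->] := int_sumP sP sN; split=> //.
by rewrite fP fN tsum0 addr0.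
Qed.

Definition kron xi eta := tsum (fun n : int => e_ (n%:~R * eta) / (1 - e_ (xi + n%:~R * tau))).
(** The derivative of [kron] in eta divided by 2 pi i. For xi = 0 the factor n kills the singular
    term n = 0, and the sum is wp(eta) / (2 pi i)^2 up to an additive constant. *)
Definition dkron xi eta :=
  tsum (fun n : int => n%:~R * (e_ (n%:~R * eta) / (1 - e_ (xi + n%:~R * tau)))).

Let kron_split xi j eta : near_upper eta ->
  summ (fun n : int => n%:~R ^+ j * (e_ (n%:~R * eta) / (1 - e_ (xi + n%:~R * tau)))) /\
  tsum (fun n : int => n%:~R ^+ j * (e_ (n%:~R * eta) / (1 - e_ (xi + n%:~R * tau)))) =
  tsum (fun n : nat => n%:R ^+ j * e_ eta ^+ n) + gam_series xi j eta.
Proof.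
move=> [eta1 eta0]; have [sg <-] := has_tsum_geo_int j eta0.
have -> : (fun n : int => n%:~R ^+ j * (e_ (n%:~R * eta) / (1 - e_ (xi + n%:~R * tau)))) =
    fun n : int => n%:~R ^+ j * (0 <= n)%R%:R * e_ (n%:~R * eta) +
                   n%:~R ^+ j * gam xi n * e_ (n%:~R * eta).
  by apply/funext => n; rewrite /gam; ring.
have sg' := @summ_gam xi j eta (ltW eta1).
by split; [exact: summD|rewrite tsumD].
Qed.

Lemma summ_kron xi eta : near_upper eta ->
  summ (fun n : int => e_ (n%:~R * eta) / (1 - e_ (xi + n%:~R * tau))).
Proof.
move=> h; have [+ _] := kron_split xi 0 h.
by congr summ; apply/funext => n; rewrite mul1r.
Qed.

Lemma summ_dkron xi eta : near_upper eta ->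
  summ (fun n : int => n%:~R * (e_ (n%:~R * eta) / (1 - e_ (xi + n%:~R * tau)))).
Proof. by move=> h; have [+ _] := kron_split xi 1 h. Qed.

Lemma kronE xi eta : near_upper eta -> kron xi eta = (1 - e_ eta)^-1 + gam_series xi 0 eta.
Proof.
move=> h; have [_] := kron_split xi 0 h; rewrite -tsum_geometric ?norm_e_lt1 ?h.2 //.
under eq_fun do rewrite mul1r.
by under [in X in _ = X + _]eq_fun do rewrite mul1r.
Qed.

Lemma tsum_nat_geometric (u : C) : `|u| < 1 ->
  tsum (fun n => n%:R * u ^+ n) = u / (1 - u) ^+ 2.
Proof.
move=> u1; have sg := summ_geometric u1.
have u1n : 1 - u != 0 by rewrite subr_eq0; apply: contraTneq u1 => <-; rewrite normr1 ltxx.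
have sn : summ (fun n => n%:R * u ^+ n).
  apply: (summ_le (summ_natX_expr 1 u1)) => n.
  by rewrite !normrM ler_wpM2r // !normrX !normr_nat ler_nat.
apply: (mulIf u1n); rewrite mulrBr mulr1 [X in _ - X]mulrC -tsumZ //.
rewrite tsum_recl // mul0r add0r -tsumB; last exact: summZ.
  have -> : (fun n => n.+1%:R * u ^+ n.+1 - u * (n%:R * u ^+ n)) = fun n => u * u ^+ n.
    by apply/funext => n; rewrite -natr1 exprS; ring.
  by rewrite tsumZ // tsum_geometric //; field.
exact: summ_comp succn_inj sn.
Qed.

Lemma dkronE xi eta : near_upper eta ->
  dkron xi eta = e_ eta / (1 - e_ eta) ^+ 2 + gam_series xi 1 eta.
Proof.
move=> h; have [_] := kron_split xi 1 h; rewrite -tsum_nat_geometric ?norm_e_lt1 ?h.2 //.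
Qed.

Lemma Theta_shift_quot n xi :
  th_coef tau n * e_ (n%:~R * xi) * ((1 - e_ (xi + n%:~R * tau)) * theta_quot tau (xi + n%:~R * tau)) =
  Theta tau xi.
Proof. by rewrite theta_quotM // -Theta_shift. Qed.

Definition theta_ratio eta := tsum (fun k => s_coef tau k / th_coef tau k * e_ (- (k%:~R * eta))).

(** Expand [theta_quot] in k and use n + k as a new index. By [th_coefD] the summand separates into
    a term of Theta(xi + eta) and a term of [theta_ratio], which does not involve xi. *)
Lemma theta_ratioM xi eta : near_upper eta ->
  summ (fun n : int => e_ (n%:~R * eta) * (th_coef tau n * e_ (n%:~R * xi) *
     theta_quot tau (xi + n%:~R * tau))) /\
  tsum (fun n : int => e_ (n%:~R * eta) * (th_coef tau n * e_ (n%:~R * xi) *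
     theta_quot tau (xi + n%:~R * tau))) = Theta tau (xi + eta) * theta_ratio eta.
Proof.
move=> h; have sT := summ_Theta tau_gt0 (xi + eta).
have sR := summ_theta_ratio tau_gt0 h.2 (near_upper_lt h).
pose G (p : int * int) := th_coef tau p.1 * e_ (p.1%:~R * (xi + eta)) *
  (s_coef tau p.2 / th_coef tau p.2 * e_ (- (p.2%:~R * eta))).
have sG : summ G := summ_prod sT sR.
pose sh (p : int * int) := (p.1 + p.2, p.2).
have bsh : bijective sh.
  by exists (fun p => (p.1 - p.2, p.2)) => -[a b]; rewrite /sh /= ?addrK ?subrK.
have sF : summ (fun p => G (sh p)) by apply/(summ_reindex _ bsh).
have rowE n : tsum (fun k => G (sh (n, k))) =
    e_ (n%:~R * eta) * (th_coef tau n * e_ (n%:~R * xi) * theta_quot tau (xi + n%:~R * tau)).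
  rewrite mulrA -tsumZ; last exact: summ_theta_quot.
  congr tsum; apply/funext => k; rewrite /G /sh /= th_coefD intrD.
  have -> : (n%:~R + k%:~R) * (xi + eta) =
    n%:~R * eta + n%:~R * xi + (k%:~R * xi + k%:~R * eta) by ring.
  have -> : k%:~R * (xi + n%:~R * tau) = k%:~R * xi + n%:~R * k%:~R * tau by ring.
  rewrite !e_D e_N; field.
  by rewrite e_neq0 th_coef_neq0.
under eq_fun do rewrite -rowE.
split; first exact: summ_fubini sF.
rewrite (tsum_fubini sF) (tsum_reindex _ bsh).
exact: (tsum_prod sT sR).
Qed.

(** By quasi-periodicity Theta(xi) kron(xi, eta) is the sum of [theta_ratioM], hence Theta(xi + eta)
    times a factor depending on eta alone. That factor is found at xi = 0, where only the term n = 0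
    survives. *)
Lemma Theta_kron xi eta : nonlattice xi -> near_upper eta ->
  Theta tau xi * Theta tau eta * kron xi eta = theta_quot tau 0 * Theta tau (xi + eta).
Proof.
move=> hxi h; have [_ e1] := theta_ratioM xi h; have [_ e2] := theta_ratioM 0 h.
have e3 : Theta tau xi * kron xi eta = Theta tau (xi + eta) * theta_ratio eta.
  rewrite -e1 /kron -tsumZ; last exact: summ_kron.
  congr tsum; apply/funext => n; rewrite -(Theta_shift_quot n xi).
  by field; rewrite subr_eq0 eq_sym hxi.
have e4 : theta_quot tau 0 = Theta tau eta * theta_ratio eta.
  rewrite -[eta in Theta tau eta]add0r -e2; apply/esym/tsumE.
  have T0 : Theta tau 0 = 0 by rewrite -theta_quotM // e_0 subrr mul0r.
  have z0 : e_ (0%:~R * eta) * (th_coef tau 0 * e_ (0%:~R * 0) *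
      theta_quot tau (0 + 0%:~R * tau)) = theta_quot tau 0.
    by rewrite (th_coef_Posz tau 0) expr0 !(mul0r, mulr0, add0r) e_0 !(mul1r, mulr1).
  rewrite -[X in has_tsum _ X]z0.
  (* For n other than 0, Theta(0) = 0 and the shift formula give (1 - e(n tau)) theta_quot(n tau) =
     0, and e(n tau) = 1 is excluded by its imaginary part. *)
  apply: (@has_tsum_point R _ (0 : int) (fun n : int => e_ (n%:~R * eta) *
    (th_coef tau n * e_ (n%:~R * 0) * theta_quot tau (0 + n%:~R * tau)))) => n n0.
  have := Theta_shift_quot n 0; rewrite T0 add0r mulr0 e_0 mulr1 => /eqP.
  rewrite mulf_eq0 (negPf (th_coef_neq0 _ _)) mulf_eq0 subr_eq0 eq_sym /=.
  case/orP => [/eqP/e_eq1[m /(congr1 (@complex.Im R))]|/eqP -> ]; last by rewrite !mulr0.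
  have -> : complex.Im (n%:~R * tau) = n%:~R * complex.Im tau.
    rewrite -(rmorph_int (real_complex R)); case: tau => a b /=.
    by rewrite mul0r addr0.
  rewrite -(rmorph_int (real_complex R)) /= => /eqP.
  by rewrite mulf_eq0 intr_eq0 (negPf n0) (gt_eqF tau_gt0).
by rewrite mulrAC e3 e4; ring.
Qed.

End KroneckerSeries.

(** * Theta does not vanish identically *)

Section ThetaNonvanishing.
Variable R : realType.
Local Notation C := (Cplx R).

Lemma tsum_sum (T : choiceType) n (F : nat -> T -> C) : (forall i, summ (F i)) ->
  summ (fun t => \sum_(i < n) F i t) /\
  tsum (fun t => \sum_(i < n) F i t) = \sum_(i < n) tsum (F i).
Proof.
move=> sF; elim: n => [|n [s1 s2]].
  rewrite big_ord0; under eq_fun do rewrite big_ord0.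
  by rewrite tsum0; split=> //; exact: summ0.
under eq_fun do rewrite big_ord_recr /=.
by rewrite big_ord_recr /= tsumD // s2; split=> //; exact: summD.
Qed.

Lemma summ_tail (T : choiceType) (f : T -> C) (e : C) : summ f -> 0 < e ->
  exists A : {fset T}, forall B : {fset T},
    (forall x, x \in B -> x \notin A) -> \sum_(i <- B) `|f i| < e.
Proof.
move=> /summ_norm/summ_has_tsum hf e0; have e2 : 0 < e / 2 by rewrite divr_gt0.
have [A hA] := hf _ e2; exists A => B AB.
have h1 := hA A (fsubset_refl A); have h2 := hA (A `|` B)%fset (fsubsetUl A B).
have BE : \sum_(i <- (A `|` B)%fset) `|f i| = \sum_(i <- A) `|f i| + \sum_(i <- B) `|f i|.
  rewrite (fsum_sub _ (fsubsetUl A B)); congr (_ + _).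
  congr (\sum_(i <- _) _); congr enum_fset; apply/fsetP => x; rewrite !inE.
  by case xB : (x \in B); [rewrite (AB x xB) orbT|rewrite orbF andNb].
rewrite BE in h2; rewrite distrC in h1.
have b0 : 0 <= \sum_(i <- B) `|f i| by exact: sumr_ge0.
move: h1 h2 b0; set t := tsum _; set a := \sum_(i <- A) _; set b := \sum_(i <- B) _.
move=> h1 h2 b0; rewrite -(ger0_norm b0) [ltRHS]splitr.
have -> : b = (t - a) + (a + b - t) by ring.
by rewrite (le_lt_trans (ler_normD _ _)) // ltrD.
Qed.

Lemma sum_e_multiples (k : int) (N : nat) : (0 < N)%N ->
  \sum_(j < N) e_ (k%:~R * (j%:R / N%:R) : C) = if (N %| `|k|)%N then N%:R else 0.
Proof.
move=> N0; have Nn0 : N%:R != 0 :> C by rewrite pnatr_eq0 -lt0n.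
have termE j : e_ (k%:~R * (j%:R / N%:R) : C) = e_ (k%:~R / N%:R) ^+ j.
  by rewrite -e_Mn; congr e_; ring.
under eq_bigr do rewrite termE.
case: ifP => [Nk|/negP Nk].
  have -> : e_ (k%:~R / N%:R : C) = 1.
    have : (N%:Z %| k)%Z by rewrite dvdzE absz_nat.
    by case/dvdzP => m ->; rewrite intrM -pmulrn mulfK // e_int.
  by under eq_bigr do rewrite expr1n; rewrite sumr_const card_ord.
have x1 : 1 - e_ (k%:~R / N%:R : C) != 0.
  rewrite subr_eq0 eq_sym; apply/eqP => /e_eq1[m /(canRL (divfK Nn0))].
  rewrite [N%:R]pmulrn -intrM => /intr_inj km; apply: Nk.
  have : (N%:Z %| k)%Z by apply/dvdzP; exists m.
  by rewrite dvdzE absz_nat.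
apply: (mulfI x1); rewrite mulr0 geometric_sum -termE divff // mulr1 e_int.
exact: subrr.
Qed.

Variable tau : C.
Hypothesis tau_gt0 : 0 < complex.Im tau.

(** Otherwise Theta is identically 0, and summing over the translates by j / N leaves N times the
    Fourier terms with index divisible by N. For N larger than all indices in a finite set outside
    which the coefficients sum to less than 1/4, the constant term N would be at most N / 4 + N /
    4. *)
Lemma Theta_not_freq_zero xi : ~ freq_zero (fun eta => Theta tau (xi + eta)).
Proof.
move=> fz; pose b (k : int) := th_coef tau k * e_ (k%:~R * xi).
have sb : summ b by exact: summ_Theta.
have T0 eta : Theta tau (xi + eta) = 0.
  have rho0 : 0 < `|eta| + 1 by rewrite ltr_wpDl.
  have hA := ana_at_Theta tau_gt0 xi rho0.
  have c0 := ana_eq0 (ana_at_ana rho0 hA) fz.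
  have [|_ ->] := hA eta; first by rewrite ltrDl.
  rewrite -[RHS](tsum0 R nat); congr tsum; apply/funext => n.
  by rewrite c0 mul0r.
have q0 : 0 < (4^-1 : C) by rewrite invr_gt0.
have [A hA] := summ_tail sb q0.
pose N := (\max_(k <- A) `|k|%N).+1; have N0 : (0 < N)%N by [].
pose b' (k : int) := b k * (if (N %| `|k|)%N then N%:R else 0).
have hb' : has_tsum b' 0.
  have sj (j : nat) : summ (fun k => b k * e_ (k%:~R * (j%:R / N%:R) : C)).
    have := summ_Theta tau_gt0 (xi + j%:R / N%:R); congr summ; apply/funext => k.
    by rewrite mulrDr e_D mulrA.
  have [sF sE] := tsum_sum N sj.
  have bE : b' = fun k => \sum_(j < N) b k * e_ (k%:~R * (j%:R / N%:R) : C).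
    by apply/funext => k; rewrite -mulr_sumr sum_e_multiples.
  have <- : tsum b' = 0.
    rewrite bE sE big1 // => j _; rewrite -[RHS](T0 (j%:R / N%:R)).
    by congr tsum; apply/funext => k; rewrite mulrDr e_D mulrA.
  by rewrite bE; exact: summ_has_tsum sF.
have NR0 : 0 < N%:R :> C by rewrite ltr0n.
have q1 : 0 < N%:R / 4 :> C by rewrite divr_gt0.
have [A2 hA2] := hb' _ q1.
pose B := ([fset (0 : int)] `|` (A `|` A2))%fset.
have /hA2 : (A2 `<=` B)%fset by rewrite /B fsetUA; exact: fsubsetUr.
have B0 : ([fset (0 : int)] `<=` B)%fset by exact: fsubsetUl.
rewrite (fsum_sub _ B0) big_seq_fset1 subr0.
have -> : b' 0 = N%:R.
  rewrite /b' dvdn0 /b (th_coef_Posz tau 0) expr0 mulr0z mul0r e_0 !mulr1.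
  by rewrite mul1r.
set s := \sum_(i <- _) _ => hs.
have hs2 : `|s| <= N%:R * 4^-1.
  rewrite /s; have D : ((B `\` [fset (0 : int)]) `\` A `<=` B `\` [fset (0 : int)])%fset.
    exact: fsubsetDl.
  apply: (@le_trans _ _ (\sum_(i <- ((B `\` [fset (0 : int)]) `\` A)%fset) N%:R * `|b i|)).
    rewrite (fsum_sub _ D) [X in _ + X]big_seq [X in _ + X]big1 ?addr0.
      rewrite (le_trans (ler_norm_sum _ _ _)) //; apply: ler_sum => k _.
      rewrite /b' normrM mulrC ler_wpM2r //.
      by case: ifP => _; rewrite ?normr_nat // normr0 ler0n.
    move=> k; rewrite !inE => /andP[+ /andP[k0 kB]]; rewrite k0 /= kB andbT negbK => kin.
    rewrite /b' ifF ?mulr0 //; apply/negP => /dvdn_leq; rewrite absz_gt0 k0 => /(_ isT).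
    rewrite leqNgt ltnS; move/negP; apply.
    exact: (@leq_bigmax_seq _ _ xpredT (fun k : int => `|k|%N)).
  rewrite -mulr_sumr ler_wpM2l // ltW // hA // => k; rewrite in_fsetD.
  by case/andP.
have : N%:R <= `|N%:R + s| + `|s| :> C.
  rewrite -[leLHS]normr_nat -[X in `|X| <= _](addrK s).
  exact: ler_normB.
move=> /le_lt_trans/(_ (ltr_leD hs hs2)).
have -> : N%:R / 4 + N%:R * 4^-1 = N%:R / 2 :> C by field.
rewrite ltr_pdivlMr // mulr_natr mulr2n gtrDl => /(lt_trans NR0).
by rewrite ltxx.
Qed.

End ThetaNonvanishing.

(** * The Kronecker function and the coefficients of [omega] *)

Section KroneckerFunction.
Variable R : realType.
Local Notation C := (Cplx R).

Lemma ana_at0 (f : C -> C) c : ana f c -> f 0 = c 0%N.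
Proof.
move=> /ana_shift[g _ [r r0 h]]; rewrite h ?normr0 //.
by rewrite mul0r addr0.
Qed.

Lemma not_freq_zeroP (f : C -> C) : ~ freq_zero f ->
  exists2 d : C, 0 < d & forall x, x != 0 -> `|x| < d -> f x != 0.
Proof.
move=> nf; apply: contrapT => h; apply: nf => d d0.
apply: contrapT => h'; apply: h; exists d => // x x0 xd; apply/eqP => fx.
by apply: h'; exists x.
Qed.

Lemma ana_neq0 (f : C -> C) c : ana f c -> c 0%N != 0 ->
  exists2 d : C, 0 < d & forall x, `|x| < d -> f x != 0.
Proof.
move=> hf c0; have [|d d0 hd] := @not_freq_zeroP f.
  by move=> fz; move: c0; rewrite (ana_eq0 hf fz) eqxx.
exists d => // x xd; have [->|x0] := eqVneq x 0; last exact: hd.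
by rewrite (ana_at0 hf).
Qed.

Variable tau : C.
Hypothesis tau_gt0 : 0 < complex.Im tau.

Definition imag (s : R) : C := Complex 0 s.

Lemma norm_imag (s : R) : 0 <= s -> `|imag s| = s%:C%C.
Proof. by move=> s0; rewrite normc_def /= expr0n add0r sqrtr_sqr ger0_norm. Qed.

Lemma near_upper_ex (d : C) : 0 < d -> exists eta,
  [/\ near_upper tau eta, eta != 0 & `|eta| < d].
Proof.
move=> d0; have [t [t0 td tr]] := minC_ex d0 (conv_radius_gt0 tau_gt0).
have tE : t = (complex.Re t)%:C%C by rewrite RRe_real // gtr0_real.
have rt : 0 < complex.Re t by rewrite -ltcR -tE.
have h0 : 0 < complex.Re t / 2 by rewrite divr_gt0.
have ht : `|imag (complex.Re t / 2)| < t.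
  by rewrite norm_imag ?ltW // [ltRHS]tE ltcR ltr_pdivrMr // mulr_natr mulr2n ltrDl.
exists (imag (complex.Re t / 2)); split; last exact: lt_le_trans td.
  by split=> //; exact: lt_le_trans tr.
by rewrite eq_complex /= negb_and (gt_eqF h0) orbT.
Qed.

Lemma near_upper_freq_zero (d : C) (f : C -> C) : 0 < d ->
  (forall eta, near_upper tau eta -> `|eta| < d -> f eta = 0) -> freq_zero f.
Proof.
move=> d0 hf e e0; have [t [t0 td te]] := minC_ex d0 e0.
have [eta [h1 h2 h3]] := near_upper_ex t0; exists eta; split=> //.
  exact: lt_le_trans te.
by apply: hf => //; exact: lt_le_trans td.
Qed.

Lemma near_upper_nonlattice eta : near_upper tau eta -> nonlattice tau eta.
Proof.
move=> h; have [_ h0] := h; have h1 := near_upper_lt tau_gt0 h.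
move=> n; apply/eqP => /e_eq1[m /(congr1 (@complex.Im R))].
rewrite -!(rmorph_int (real_complex R)) raddfD /=.
have -> : complex.Im ((n%:~R : R)%:C%C * tau) = n%:~R * complex.Im tau.
  by case: tau => a b /=; rewrite mul0r addr0.
case: n => n.
  have : 0 <= n%:R * complex.Im tau by rewrite mulr_ge0 // ltW.
  by rewrite -pmulrn; lra.
have : 0 <= n%:R * complex.Im tau by rewrite mulr_ge0 // ltW.
by rewrite NegzE mulrNz -pmulrn -natr1; lra.
Qed.

(** eta F(xi, eta) with the singularity at 0 removed, that is, - 2 pi i eta kron(xi, eta): the
    Bernoulli part is the contribution of 1 / (1 - e(eta)). *)
Definition kron_gf xi (eta : C) :=
  bern_gf (twopii R * eta) - twopii R * (eta * gam_series tau xi 0 eta).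

Definition kron_coef xi n : C := bern R n * twopii R ^+ n -
  twopii R * (if n is m.+1 then twopii R ^+ m / m`!%:R * gam_moment tau xi m else 0).

Lemma ana_kron_gf xi : ana (kron_gf xi) (kron_coef xi).
Proof.
apply: anaB; first exact: ana_scale (ana_bern R).
exact/anaZ/ana_mulX/(ana_gam_series tau_gt0).
Qed.

Lemma twopii_neq0 : twopii R != 0.
Proof. by rewrite eq_complex /= negb_and orbC mulf_neq0 // gt_eqF // pi_gt0. Qed.

Definition gf_radius : C := 1 / `|twopii R|.

Lemma gf_radius_gt0 : 0 < gf_radius.
Proof. by rewrite divr_gt0 // normr_gt0 twopii_neq0. Qed.

Lemma gf_radius_lt (eta : C) : `|eta| < gf_radius -> `|twopii R * eta| < 1.
Proof. by rewrite ltr_pdivlMr ?normr_gt0 ?twopii_neq0 // normrM mulrC. Qed.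

Lemma e_neq1 eta : `|eta| < gf_radius -> eta != 0 -> 1 - e_ eta != 0.
Proof.
move=> h e0; rewrite -opprB oppr_eq0; apply: cexp_sub1_neq0; first exact: gf_radius_lt.
by rewrite mulf_neq0 // twopii_neq0.
Qed.

Lemma near_upper_neq0 eta : near_upper tau eta -> eta != 0.
Proof. by case=> _; apply: contraTneq => ->; rewrite ltxx. Qed.

Lemma kron_gfE xi eta : near_upper tau eta -> `|eta| < gf_radius ->
  kron_gf xi eta = - (twopii R * eta) * kron tau xi eta.
Proof.
move=> h1 h2; have e0 := near_upper_neq0 h1; have e1 := e_neq1 h2 e0.
rewrite kronE // /kron_gf bern_gfE; last 2 first.
- exact: gf_radius_lt.
- by rewrite mulf_neq0 // twopii_neq0.
rewrite -/(e_ eta); have -> : e_ eta - 1 = - (1 - e_ eta) by rewrite opprB.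
by field.
Qed.

(** Kept free of divisions by Theta, because the nonvanishing of Theta is deduced from it. Both
    sides are germs that agree on the half disc, hence in all coefficients. *)
Lemma Theta_kron_gf xi : nonlattice tau xi -> exists2 d : C, 0 < d & forall eta, `|eta| < d ->
  Theta tau xi * (Theta tau (0 + eta) * kron_gf xi eta) =
  - twopii R * theta_quot tau 0 * (eta * Theta tau (xi + eta)).
Proof.
move=> hxi.
have aT x := ana_at_ana (@ltr01 C) (ana_at_Theta tau_gt0 x (@ltr01 C)).
have a1 := anaZ (Theta tau xi) (anaM (aT 0) (ana_kron_gf xi)).
have a2 := anaZ (- twopii R * theta_quot tau 0) (ana_mulX (aT xi)).
have [r [r0 h1 h2]] := ana2_at a1 a2; exists r => // eta er.
have [_ ->] := h1 eta er; have [_ ->] := h2 eta er.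
congr tsum; apply/funext => n; congr (_ * _); apply: (ana_unique a1 a2).
apply: (near_upper_freq_zero gf_radius_gt0) => x hx xr.
apply/eqP; rewrite subr_eq0; apply/eqP; rewrite kron_gfE // add0r.
have := Theta_kron tau_gt0 hxi hx => e.
transitivity (- (twopii R * x) * (Theta tau xi * Theta tau x * kron tau xi x)); first by ring.
by rewrite e; ring.
Qed.

(** Otherwise the right side of [Theta_kron_gf] is 0. For a xi with Theta(xi) nonzero, and [kron_gf]
    being 1 at 0, this forces Theta to vanish near 0. *)
Lemma theta_quot0_neq0 : theta_quot tau 0 != 0.
Proof.
apply/eqP => S0.
have [d d0 hd] := not_freq_zeroP (@Theta_not_freq_zero R tau tau_gt0 0).
have [xi [x1 x0 xd]] := near_upper_ex d0.
have := hd _ x0 xd; rewrite add0r => Txi.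
have [d1 d10 hd1] := Theta_kron_gf (near_upper_nonlattice x1).
have [|d2 d20 hd2] := ana_neq0 (ana_kron_gf xi).
  by rewrite /kron_coef mulr0 subr0 bernE big_ord0 subr0 mulr1 oner_eq0.
have [d3 [d30 d31 d32]] := minC_ex d10 d20.
apply: (@Theta_not_freq_zero R tau tau_gt0 0); apply: (freq_zero_near d30) => x xn xd3.
have := hd1 x (lt_le_trans xd3 d31); rewrite S0 mulr0 mul0r => /eqP.
rewrite mulf_eq0 (negPf Txi) mulf_eq0 (negPf (hd2 x (lt_le_trans xd3 d32))) orbF.
by move=> /eqP.
Qed.

(** A zero at xi kills the left side of [Theta_kron_gf], and then Theta(xi + eta) = 0 for all small
    nonzero eta. *)
Lemma Theta_neq0 xi : nonlattice tau xi -> Theta tau xi != 0.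
Proof.
move=> hxi; apply/eqP => T0; have [d d0 hd] := Theta_kron_gf hxi.
apply: (@Theta_not_freq_zero R tau tau_gt0 xi); apply: (freq_zero_near d0) => x xn xd.
have := hd x xd; rewrite T0 mul0r => /esym/eqP.
by rewrite mulNr mulNr oppr_eq0 !mulf_eq0 (negPf twopii_neq0) (negPf theta_quot0_neq0)
   (negPf xn) => /eqP.
Qed.

Lemma derive_theta0 : derive1 (@theta R ^~ tau) (0 : C) = - e_ (tau / 8) * theta_quot tau 0.
Proof.
pose k := (twopii R)^-1.
(* The factor 1 - e^u exhibits the zero at 0, so that the linear coefficient of the product only
   involves the constant terms of the other factors. *)
have fE u : theta u tau = e_ (tau / 8) * (cexp (2^-1 * u) * ((1 - cexp (1 * u)) * theta_quot tau (k * u))).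
  have -> : u = twopii R * (k * u) by rewrite mulrA mulfV ?twopii_neq0 // mul1r.
  rewrite thetaE // -theta_quotM // -!mulrA; congr (_ * (_ * (_ * _))).
  - by rewrite /e_; congr cexp; rewrite /k; field; exact: twopii_neq0.
  - by rewrite /e_; congr (1 - cexp _); rewrite /k; field; exact: twopii_neq0.
  - by rewrite /k; congr theta_quot; field; exact: twopii_neq0.
have aS := ana_scale k (ana_at_ana (@ltr01 C) (ana_at_theta_quot tau_gt0 (@ltr01 C))).
have aE := anaB (ana_cst (1 : C)) (ana_cexp (1 : C)).
have a := anaZ (e_ (tau / 8)) (anaM (ana_cexp (2^-1 : C)) (anaM aE aS)).
have {}a := ana_ext (fun u => esym (fE u)) (fun=> erefl) a.
have [r r0 [g ag dg]] := ana_is_derive a.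
rewrite (is_derive1E (dg 0 _)) ?normr0 // (ana_at0 ag).
have S0 := ana_at0 aS; rewrite mulr0 in S0.
rewrite mul1r /conv !big_ord_recl !big_ord0 /= !subn0 /cexp_term !expr0 -S0.
have -> : bump 0 0 = 1%N by [].
have -> : 0`! = 1%N by [].
have -> : 1`! = 1%N by [].
by set X := tsum _; field.
Qed.

Lemma kroneckerFE xi : nonlattice tau xi -> exists2 d : C, 0 < d & forall eta,
  eta != 0 -> `|eta| < d -> eta * kroneckerF xi eta tau = kron_gf xi eta.
Proof.
move=> hxi; have [d1 d10 h1] := Theta_kron_gf hxi.
have [d2 d20 h2] := not_freq_zeroP (@Theta_not_freq_zero R tau tau_gt0 0).
have [d [d0 d1d d2d]] := minC_ex d10 d20; exists d => // eta e0 ed.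
have Tx := Theta_neq0 hxi; have Te := h2 eta e0 (lt_le_trans ed d2d).
have {}h1 := h1 eta (lt_le_trans ed d1d).
have e12 : e_ ((xi + eta) / 2) = e_ (xi / 2) * e_ (eta / 2).
  by rewrite mulrDl e_D.
rewrite /kroneckerF derive_theta0 !thetaE // e12.
rewrite add0r in h1 Te.
apply: (mulfI (mulf_neq0 Tx Te)); rewrite -[RHS]mulrA h1.
by field; rewrite !e_neq0 Tx Te.
Qed.

Lemma tFE xi : nonlattice tau xi -> tF xi tau = kron_coef xi.
Proof.
move=> hxi; have [d d0 hd] := kroneckerFE hxi.
exact: taylor0E d0 hd (ana_kron_gf xi).
Qed.

Lemma kron_coef0 xi : kron_coef xi 0 = 1.
Proof. by rewrite /kron_coef mulr0 subr0 bernE big_ord0 subr0 mulr1. Qed.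

Lemma is_derive_inv (x : C) : x != 0 ->
  is_derive x (1 : C) (fun y : C => y^-1) (- x ^- 2).
Proof.
move=> x0; have nx : 0 < `|x| by rewrite normr_gt0.
apply: (@is_derive_quad R _ _ _ (`|x| / 2) (2 * `|x| ^- 3)); first by rewrite divr_gt0.
move=> h hh.
have xh : `|x| / 2 <= `|x + h|.
  rewrite -[X in `|x + X|]opprK; apply: le_trans (lerB_dist _ _); rewrite normrN.
  by rewrite lerBrDr [leRHS]splitr lerD2l ltW.
have xh0 : 0 < `|x + h| by apply: lt_le_trans xh; rewrite divr_gt0.
have xhn : x + h != 0 by rewrite -normr_gt0.
have -> : (x + h)^-1 - x^-1 - h * (- x ^- 2) = h ^+ 2 * (x ^- 2 * (x + h)^-1).
  by field; rewrite xhn x0.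
rewrite normrM normrX mulrC ler_wpM2r ?exprn_ge0 // normrM !normfV normrX.
have -> : 2 * `|x| ^- 3 = `|x| ^- 2 * (`|x| / 2)^-1 by field; rewrite gt_eqF.
by rewrite ler_wpM2l ?invr_ge0 ?exprn_ge0 // lef_pV2 ?posrE // divr_gt0.
Qed.

(** F = 1/t + g(t) with g(t) the sum of h_(n+1) t^n, so the poles cancel in 1/t + t dF/dt = t
    g'(t). *)
Lemma tdFE xi : nonlattice tau xi -> tdF xi tau = fun n => n%:R * kron_coef xi n.+1.
Proof.
move=> hxi; have [d d0 hd] := kroneckerFE hxi.
have [g ag [r r0 hg]] := ana_shift (ana_kron_gf xi).
have [s s0 [g' ag' hg']] := ana_is_derive ag.
have a : ana (fun t => t * g' t) (fun n => n%:R * kron_coef xi n.+1).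
  by apply: ana_ext (ana_mulX ag') => // -[|n]; rewrite ?mul0r.
have [u [u0 ud ur]] := minC_ex d0 r0; have [v [v0 vu vs]] := minC_ex u0 s0.
apply: (taylor0E v0 _ a) => x x0 xv.
have FE y : y != 0 -> `|y| < u -> kroneckerF xi y tau = y^-1 + g y.
  move=> y0 yu; apply: (mulfI y0); rewrite hd ?hg ?kron_coef0 //.
  - by rewrite mulrDr divff.
  - exact: lt_le_trans ur.
  - exact: lt_le_trans ud.
have dF : is_derive x (1 : C) (fun y => y^-1 + g y) (- x ^- 2 + g' x).
  have h1 := is_derive_inv x0; have h2 := hg' x (lt_le_trans xv vs).
  exact: is_deriveD.
have dK : is_derive x (1 : C) (fun y => kroneckerF xi y tau) (- x ^- 2 + g' x).
  (* The first bound keeps x + h away from the pole at 0, the second keeps it in the disc where [FE]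
     applies. *)
  have [w [w0 wx wv]] : exists w : C, [/\ 0 < w, w <= `|x| & w <= u - `|x|].
    apply: minC_ex; rewrite ?normr_gt0 // subr_gt0; exact: lt_le_trans vu.
  apply: (is_derive_near w0 _ dF) => h hw; rewrite FE //.
    rewrite addrC addr_eq0; apply: contraTneq hw => ->; rewrite normrN.
    by rewrite -real_leNgt ?gtr0_real // normr_gt0.
  by rewrite (le_lt_trans (ler_normD _ _)) // -ltrBrDl (lt_le_trans hw).
by rewrite (is_derive1E dK); field.
Qed.

End KroneckerFunction.

(** * The Fay identity *)

Section FayIdentity.
Variable R : realType.
Local Notation C := (Cplx R).
Variable tau : C.
Hypothesis tau_gt0 : 0 < complex.Im tau.

Lemma kron_fay xi x y : nonlattice tau xi ->
  near_upper tau x -> near_upper tau y -> near_upper tau (x + y) ->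
  kron tau xi x * dkron tau xi y - dkron tau xi x * kron tau xi y =
  kron tau xi (x + y) * (dkron tau 0 y - dkron tau 0 x).
Proof.
move=> hxi hx hy hxy.
pose g (n : int) := (1 - e_ (xi + n%:~R * tau))^-1.
pose k z (n : int) := e_ (n%:~R * z) / (1 - e_ (xi + n%:~R * tau)).
pose d z (n : int) := n%:~R * k z n.
pose p z (n : int) := n%:~R * (e_ (n%:~R * z) / (1 - e_ (0 + n%:~R * tau))).
have sk z : near_upper tau z -> summ (k z) by exact: summ_kron.
have sd z : near_upper tau z -> summ (d z) by exact: summ_dkron.
have sp z : near_upper tau z -> summ (p z) by exact: summ_dkron.
(* Off the diagonal this is the partial fraction identity u / ((1 - zu)(u - v)) - v / ((1 - zv)(u -
   v)) = 1 / ((1 - zu)(1 - zv)), multiplied by (m - n) e(n x + m y). On the diagonal both sides are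
   0. *)
have pw n m : k x n * d y m - d x n * k y m =
    k (x + y) n * p y (m - n) - k (x + y) m * p x (n - m).
  have [->|nm] := eqVneq n m.
    by rewrite /d /p subrr mulr0z !mul0r !mulr0; ring.
  have q1 l : l != 0 -> 1 - e_ (l%:~R * tau) != 0.
    move=> l0; rewrite subr_eq0 eq_sym; apply/eqP => /e_eq1[j /(congr1 (@complex.Im R))].
    rewrite -!(rmorph_int (real_complex R)) /=.
    have -> : complex.Im ((l%:~R : R)%:C%C * tau) = l%:~R * complex.Im tau.
      by case: tau => a b /=; rewrite mul0r addr0.
    by move=> /eqP; rewrite mulf_eq0 intr_eq0 (negPf l0) (gt_eqF tau_gt0).
  have h1 : 1 - e_ ((m - n)%:~R * tau) != 0 by apply: q1; rewrite subr_eq0 eq_sym.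
  have h2 : 1 - e_ ((n - m)%:~R * tau) != 0 by apply: q1; rewrite subr_eq0.
  have gn : 1 - e_ (xi + n%:~R * tau) != 0 by rewrite subr_eq0 eq_sym hxi.
  have gm : 1 - e_ (xi + m%:~R * tau) != 0 by rewrite subr_eq0 eq_sym hxi.
  pose u := e_ (n%:~R * tau); pose v := e_ (m%:~R * tau); pose z := e_ xi.
  have u0 : u != 0 by exact: e_neq0.
  have v0 : v != 0 by exact: e_neq0.
  have un : e_ (xi + n%:~R * tau) = z * u by rewrite e_D.
  have vm : e_ (xi + m%:~R * tau) = z * v by rewrite e_D.
  have uv : e_ ((m - n)%:~R * tau) = v / u by rewrite intrB mulrBl e_D e_N.
  have vu : e_ ((n - m)%:~R * tau) = u / v by rewrite intrB mulrBl e_D e_N.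
  rewrite /d /p /k !add0r un vm uv vu.
  rewrite un in gn; rewrite vm in gm; rewrite uv in h1; rewrite vu in h2.
  have uvn : u - v != 0.
    by apply: contraNneq h1 => /eqP; rewrite subr_eq0 => /eqP ->; rewrite divff // subrr.
  have -> : e_ (n%:~R * (x + y)) = e_ (n%:~R * x) * e_ (n%:~R * y) by rewrite mulrDr e_D.
  have -> : e_ (m%:~R * (x + y)) = e_ (m%:~R * x) * e_ (m%:~R * y) by rewrite mulrDr e_D.
  have -> : e_ ((m - n)%:~R * y) = e_ (m%:~R * y) / e_ (n%:~R * y).
    by rewrite intrB mulrBl e_D e_N.
  have -> : e_ ((n - m)%:~R * x) = e_ (n%:~R * x) / e_ (m%:~R * x).
    by rewrite intrB mulrBl e_D e_N.
  have -> : 1 - v / u = (u - v) / u by field.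
  have -> : 1 - u / v = - (u - v) / v by field.
  rewrite !intrB; field.
  by rewrite u0 v0 uvn gn gm !e_neq0.
pose L (q : int * int) := k x q.1 * d y q.2 - d x q.1 * k y q.2.
pose R1 (q : int * int) := k (x + y) q.1 * p y (q.2 - q.1).
pose R2 (q : int * int) := k (x + y) q.2 * p x (q.1 - q.2).
have LE : L = fun q => R1 q - R2 q by apply/funext => q; exact: pw.
(* Taking the difference of the two indices as a new variable turns both double sums into products
   of single sums. *)
pose f1 (q : int * int) := (q.1, q.1 + q.2).
pose f2 (q : int * int) := (q.1 + q.2, q.1).
have b1 : bijective f1.
  exists (fun q => (q.1, q.2 - q.1)) => -[a b]; rewrite /f1 /=.
    by rewrite [a + b]addrC addrK.
  by rewrite addrC subrK.
have b2 : bijective f2.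
  exists (fun q => (q.2, q.1 - q.2)) => -[a b]; rewrite /f2 /=.
    by rewrite [a + b]addrC addrK.
  by rewrite addrC subrK.
have e1 : (fun q => R1 (f1 q)) = fun q => k (x + y) q.1 * p y q.2.
  by apply/funext => -[a b]; rewrite /R1 /f1 /= [a + b]addrC addrK.
have e2 : (fun q => R2 (f2 q)) = fun q => k (x + y) q.1 * p x q.2.
  by apply/funext => -[a b]; rewrite /R2 /f2 /= [a + b]addrC addrK.
have s1 : summ R1.
  by apply/(summ_reindex _ b1); rewrite e1; apply: summ_prod; [exact: sk|exact: sp].
have s2 : summ R2.
  by apply/(summ_reindex _ b2); rewrite e2; apply: summ_prod; [exact: sk|exact: sp].
have t1 : tsum R1 = kron tau xi (x + y) * dkron tau 0 y.
  by rewrite -(tsum_reindex _ b1) e1; apply: (tsum_prod (sk _ hxy) (sp _ hy)).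
have t2 : tsum R2 = kron tau xi (x + y) * dkron tau 0 x.
  by rewrite -(tsum_reindex _ b2) e2; apply: (tsum_prod (sk _ hxy) (sp _ hx)).
rewrite mulrBr -t1 -t2 -tsumB // -LE /L tsumB; last 2 first.
- exact: (summ_prod (sk _ hx) (sd _ hy)).
- exact: (summ_prod (sd _ hx) (sk _ hy)).
rewrite (tsum_prod (sk _ hx) (sd _ hy)) (tsum_prod (sd _ hx) (sk _ hy)).
by [].
Qed.

(** eta^2 times the derivative of F in eta, with the singularity removed; hence the coefficients (n
    - 1) h_n in [ana_dkron_gf]. *)
Definition dkron_gf xi (eta : C) :=
  - (bern_gf (twopii R * eta) ^+ 2 * cexp (twopii R * eta)) -
  twopii R ^+ 2 * (eta * (eta * gam_series tau xi 1 eta)).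

Lemma ana_dkron_gf xi : ana (dkron_gf xi) (fun n => (n%:R - 1) * kron_coef tau xi n).
Proof.
have a1 := anaZ (-1) (ana_scale (twopii R) (ana_bern_sqr R)).
have a2 := anaZ (twopii R ^+ 2) (ana_mulX (ana_mulX (ana_gam_series tau_gt0 xi 1))).
apply: ana_ext (anaB a1 a2) => [x|[|[|n]]] /=.
- by rewrite /dkron_gf mulN1r.
- by rewrite /kron_coef; ring.
- by rewrite /kron_coef; ring.
rewrite /kron_coef add1n factS natrM !exprS -!natr1.
have n1 : n%:R + 1 != 0 :> C by rewrite natr1 pnatr_eq0.
have nf : n`!%:R != 0 :> C by rewrite pnatr_eq0 -lt0n fact_gt0.
by field; rewrite n1 nf.
Qed.

Lemma dkron_gfE xi eta : near_upper tau eta -> `|eta| < gf_radius R ->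
  dkron_gf xi eta = - (twopii R * eta) ^+ 2 * dkron tau xi eta.
Proof.
move=> h1 h2; have e0 := near_upper_neq0 h1; have e1 := e_neq1 h2 e0.
rewrite dkronE // /dkron_gf bern_gfE; last 2 first.
- exact: gf_radius_lt.
- by rewrite mulf_neq0 // twopii_neq0.
rewrite -/(e_ eta); have -> : e_ eta - 1 = - (1 - e_ eta) by rewrite opprB.
by field.
Qed.

Lemma gf_fay xi x y : nonlattice tau xi ->
  near_upper tau x -> near_upper tau y -> near_upper tau (x + y) ->
  `|x| < gf_radius R -> `|y| < gf_radius R -> `|x + y| < gf_radius R ->
  (x + y) * (x * (kron_gf tau xi x * dkron_gf xi y) - y * (dkron_gf xi x * kron_gf tau xi y)) =
  kron_gf tau xi (x + y) * (x ^+ 2 * dkron_gf 0 y - y ^+ 2 * dkron_gf 0 x).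
Proof.
move=> hxi hx hy hxy rx ry rxy; have := kron_fay hxi hx hy hxy => e.
rewrite !kron_gfE // !dkron_gfE //.
transitivity (- twopii R ^+ 3 * x ^+ 2 * y ^+ 2 * (x + y) * 
  - (kron tau xi x * dkron tau xi y - dkron tau xi x * kron tau xi y)); first by ring.
by rewrite e; ring.
Qed.

End FayIdentity.

(** * Eisenstein series as coefficients of the Weierstrass function *)

Section EisensteinCoefficients.
Variable R : realType.
Local Notation C := (Cplx R).
Variable tau : C.
Hypothesis tau_gt0 : 0 < complex.Im tau.
Let q : C := e_ tau.

Let q_lt1 : `|q| < 1. Proof. by rewrite norm_e_lt1. Qed.

Let qX_neq1 d : 1 - q ^+ d.+1 != 0.
Proof.
rewrite subr_eq0; apply/eqP => e; have : `|q| ^+ d.+1 < 1 by rewrite exprn_ilt1.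
by rewrite -normrX -e normr1 ltxx.
Qed.

Lemma lambert_summ K : summ (fun p : nat * nat => p.1.+1%:R ^+ K * q ^+ (p.1.+1 * p.2.+1)).
Proof.
have r0 := normr_ge0 q.
apply: (summ_le (summ_prod (summ_natX_expr K q_lt1) (summ_geometric q_lt1))) => -[d m] /=.
rewrite -mulrA -exprD !normrM ler_wpM2l // !normrX ler_wiXn2l // 1?ltW //.
by rewrite mulSn mulnS; lia.
Qed.

Lemma lambert_row K d : tsum (fun m => d.+1%:R ^+ K * q ^+ (d.+1 * m.+1)) =
  d.+1%:R ^+ K * (q ^+ d.+1 / (1 - q ^+ d.+1)).
Proof.
have qd : `|q ^+ d.+1| < 1 by rewrite normrX exprn_ilt1.
rewrite -tsum_geometric // -tsumZ; last exact: summ_geometric.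
rewrite -tsumZ; last exact/summZ/summ_geometric.
by congr tsum; apply/funext => m; rewrite -exprM -exprD -mulnS.
Qed.

Lemma sum_sigma K n (x : C) :
  \sum_(d < n.+1) (if (d.+1 %| n.+1)%N then d.+1%:R ^+ K * x else 0) = (sigma K n.+1)%:R * x.
Proof.
rewrite -big_mkcond /= -mulr_suml; congr (_ * _); rewrite /sigma.
have -> : (\sum_(d <- divisors n.+1) d ^ K = \sum_(d < n.+2 | d %| n.+1) d ^ K)%N.
  rewrite -(big_mkord (fun d => d %| n.+1)%N (fun d => d ^ K)%N) -[RHS]big_filter.
  apply: perm_big; apply: uniq_perm; rewrite ?divisors_uniq ?filter_uniq ?iota_uniq //.
  move=> d; rewrite mem_filter mem_index_iota -dvdn_divisors // /= ltnS.
  by case dn : (d %| n.+1)%N => //=; rewrite dvdn_leq.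
rewrite [in RHS]big_mkcond [in RHS]big_ord_recl dvd0n /= add0n -[in RHS]big_mkcond natr_sum.
by apply: eq_bigr => d _; rewrite natrX.
Qed.

Lemma lambertE K :
  summ (fun n => (sigma K n.+1)%:R * q ^+ n.+1) /\
  tsum (fun n => (sigma K n.+1)%:R * q ^+ n.+1) =
  tsum (fun d => d.+1%:R ^+ K * (q ^+ d.+1 / (1 - q ^+ d.+1))).
Proof.
pose F (p : nat * nat) : C := if (p.2.+1 %| p.1.+1)%N then p.2.+1%:R ^+ K * q ^+ p.1.+1 else 0.
(* Indices are shifted by one: (d, m) stands for the factorisation (d + 1)(m + 1) = n + 1, and [g]
   recovers it from n and the divisor d + 1. *)
pose h (p : nat * nat) := (p.1.+1 * p.2.+1 - 1, p.1)%N.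
pose g (p : nat * nat) :=
  if (p.2.+1 %| p.1.+1)%N then Some (p.2, (p.1.+1 %/ p.2.+1).-1) else None.
have gK : ocancel g h.
  case=> n d; rewrite /g /h /=; case: ifP => //= dn.
  have dv : (0 < n.+1 %/ d.+1)%N by rewrite divn_gt0 // dvdn_leq.
  by rewrite prednK // mulnC divnK // subn1.
have hK : pcancel h g.
  case=> d m; rewrite /g /h /= subn1 prednK ?muln_gt0 // dvdn_mulr //.
  by rewrite mulKn.
have F0 p : g p = None -> F p = 0 by rewrite /g /F; case: ifP.
have Fh : (fun p => F (h p)) = fun p => p.1.+1%:R ^+ K * q ^+ (p.1.+1 * p.2.+1).
  by apply/funext => -[d m]; rewrite /F /h /= subn1 prednK ?muln_gt0 // dvdn_mulr.
have sF : summ F by apply: (summ_ext gK F0); rewrite Fh; exact: lambert_summ.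
have rowE : (fun n => (sigma K n.+1)%:R * q ^+ n.+1) = fun n => tsum (fun d => F (n, d)).
  apply/funext => n; rewrite (@tsum_ord _ _ n.+1) => [|d nd]; first by rewrite -sum_sigma.
  by rewrite /F /= ifF //; apply/negP => /(dvdn_leq (ltn0Sn n)); rewrite ltnS leqNgt nd.
rewrite rowE; split; first exact: summ_fubini.
rewrite tsum_fubini // (tsum_ext gK hK F0) Fh; last exact: lambert_summ.
rewrite -(tsum_fubini (lambert_summ K)); congr tsum; apply/funext => d.
exact: lambert_row.
Qed.

Lemma gam0_Posz d : gam tau 0 d.+1 = q ^+ d.+1 / (1 - q ^+ d.+1).
Proof. by rewrite /gam add0r -pmulrn e_Mn -/q /=; field; exact: qX_neq1. Qed.

Lemma gam0_Negz d : gam tau 0 (Negz d) = - (q ^+ d.+1 / (1 - q ^+ d.+1)).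
Proof.
rewrite /gam add0r NegzE mulrNz mulNr e_N -pmulrn e_Mn -/q /= subr0.
have q0 : q ^+ d.+1 != 0 by rewrite expf_neq0 // e_neq0.
have h := qX_neq1 d.
have h' : q ^+ d.+1 - 1 != 0 by rewrite -opprB oppr_eq0.
by field; rewrite q0 h h'.
Qed.

(** At xi = 0 [gam] is odd in n apart from n = 0, and that term is killed by the positive power of
    n. *)
Lemma gam_moment0 j : gam_moment tau 0 j.+1 =
  (1 - (-1) ^+ j.+1) * tsum (fun d => d.+1%:R ^+ j.+1 * (q ^+ d.+1 / (1 - q ^+ d.+1))).
Proof.
have s := summ_gam_moment tau_gt0 0 j.+1.
have [sP sN] := summ_int_halves s.
rewrite /gam_moment; set f := (X in tsum X) in s *.
have [_ ->] := @int_sumP R f sP sN.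
pose L (d : nat) := d.+1%:R ^+ j.+1 * (q ^+ d.+1 / (1 - q ^+ d.+1)).
have fS d : f (Posz d.+1) = L d by rewrite /f gam0_Posz -pmulrn.
have fN d : f (Negz d) = - (-1) ^+ j.+1 * L d.
  have nE : (Negz d)%:~R ^+ j.+1 = (-1) ^+ j.+1 * d.+1%:R ^+ j.+1 :> C.
    by rewrite NegzE mulrNz -pmulrn [LHS]exprNn.
  by rewrite /f gam0_Negz nE /L; ring.
have sL : summ L by have := summ_comp succn_inj sP; congr summ; apply/funext => d; exact: fS.
rewrite tsum_recl // {1}/f expr0n !mul0r add0r.
have -> : tsum (fun n => f (Posz n.+1)) = tsum L by congr tsum; apply/funext => d; exact: fS.
have -> : tsum (fun n => f (Negz n)) = - (-1) ^+ j.+1 * tsum L.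
  by rewrite -tsumZ //; congr tsum; apply/funext => d; exact: fN.
by rewrite /L; ring.
Qed.

Lemma eisenstein2E m : eisenstein2 m.+1 tau =
  - (bern R m.+1.*2 * m.+1.*2`!%:R / (4 * m.+1)%:R) +
  tsum (fun d => d.+1%:R ^+ m.*2.+1 * (q ^+ d.+1 / (1 - q ^+ d.+1))).
Proof.
rewrite /eisenstein2 bernoulliE mulrC [X in _ + limn X](_ : _ =
  series (fun n => (sigma m.*2.+1 n.+1)%:R * q ^+ n.+1)) //.
have [s <-] := lambertE m.*2.+1.
by rewrite lim_series // mulrC [_ * bern R _]mulrC.
Qed.

(** The numbers (1 - n) h_n at xi = 0 are the coefficients of [- dkron_gf tau 0], that is, of eta^2
    wp(eta) up to the constant term of wp. The normalisation (2 pi i)^(2m+1) / (2m)! of the terms of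
    psi is read off here. *)
Lemma weierstrass_coef_even m :
  (1 - m.*2.+2%:R) * kron_coef tau 0 m.*2.+2 =
  2 * (twopii R * (twopii R ^+ m.*2.+1 / m.*2`!%:R * eisenstein2 m.+1 tau)).
Proof.
rewrite eisenstein2E /kron_coef gam_moment0 -signr_odd /= odd_double /=.
set T := tsum _; rewrite doubleS !factS !natrM -!natr1 -muln2 natrM.
have n1 : m%:R * 2 + 1 != 0 :> C by rewrite -natrM natr1 pnatr_eq0.
have n2 : m%:R + 1 != 0 :> C by rewrite natr1 pnatr_eq0.
have nf : (m * 2)`!%:R != 0 :> C by rewrite pnatr_eq0 -lt0n fact_gt0.
by rewrite !exprS; field; rewrite n1 n2 nf.
Qed.

Lemma weierstrass_coef_odd m : (1 - m.*2.+1%:R) * kron_coef tau 0 m.*2.+1 = 0.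
Proof.
case: m => [|m]; first by rewrite subrr mul0r.
rewrite /kron_coef bern_odd doubleS gam_moment0 -signr_odd /= odd_double /=.
by ring.
Qed.

End EisensteinCoefficients.

(** * The Fay identity as a symmetry of polynomials *)

Lemma sum_even (V : nmodType) (t : nat -> V) M L : (M <= L)%N ->
  (forall k, t k.*2.+1 = 0) ->
  \sum_(m < M) t m = \sum_(k < L) (if (k.*2 < M)%N then t k.*2 else 0).
Proof.
move=> ML t0; elim: M ML => [|M IHM] ML.
  by rewrite big_ord0 big1.
rewrite big_ord_recr IHM /=; last exact: ltnW.
have -> : t M = \sum_(k < L) (if k.*2 == M then t M else 0).
  have [[k kM]|[k kM]] : (exists k, M = k.*2) \/ (exists k, M = k.*2.+1).
  - have := odd_double_half M; case: odd => e; [right|left]; exists M./2; lia.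
  - have kL : (k < L)%N by lia.
    rewrite (bigD1 (Ordinal kL)) //= -kM eqxx big1 ?addr0 // => i ik.
    rewrite ifF //; apply/negP => /eqP iM; case/eqP: ik; apply: val_inj => /=; lia.
  - transitivity (0 : V); first by rewrite kM t0.
    by rewrite big1 // => i _; rewrite ifF //; apply/negP => /eqP; lia.
rewrite -big_split; apply: eq_bigr => k _ /=.
by rewrite ltnS; case: (ltngtP k.*2 M) => [_|_|->]; rewrite ?addr0 ?add0r.
Qed.

Section KzbSymbol.
Variable K : fieldType.
Implicit Types (x y : K) (h w k : nat -> K).

(** The polynomial ((x + y)^n - y^n) / x, given by the same recursion as the action of a d/dt on
    a_n. *)
Fixpoint shift_quot n x y : K :=
  if n is m.+1 then y ^+ m + (x + y) * shift_quot m x y else 0.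

Lemma shift_quotE n x y : x * shift_quot n x y = (x + y) ^+ n - y ^+ n.
Proof.
elim: n => [|n IHn] /=; first by rewrite mulr0 subrr.
by rewrite mulrDr mulrCA IHn !exprS; ring.
Qed.

Definition alt_sum m x y : K :=
  \sum_(1 <= j < m.*2.+1) (-1) ^+ j * (x ^+ j * y ^+ (m.*2.+1 - j)).

Lemma alt_sumE m x y : (x + y) * alt_sum m x y = x * y * (x ^+ m.*2 - y ^+ m.*2).
Proof.
rewrite /alt_sum big_add1 /= big_mkord.
have -> : \sum_(i < m.*2) (-1) ^+ i.+1 * (x ^+ i.+1 * y ^+ (m.*2.+1 - i.+1)) =
    - (x * y) * \sum_(i < m.*2) y ^+ (m.*2.-1 - i) * (- x) ^+ i.
  rewrite mulr_sumr; apply: eq_bigr => i _.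
  have -> : (m.*2.+1 - i.+1 = (m.*2.-1 - i).+1)%N by have := ltn_ord i; lia.
  by rewrite [(- x) ^+ i]exprNn !exprS; ring.
have := subrXX y (- x) m.*2; rewrite opprK => e.
have xe : (- x) ^+ m.*2 = x ^+ m.*2 by rewrite exprNn -signr_odd odd_double expr0 mul1r.
rewrite xe in e; transitivity (- (x * y) * ((y + x) * \sum_(i < m.*2) y ^+ (m.*2.-1 - i) * (- x) ^+ i)).
  by ring.
by rewrite -e; ring.
Qed.

Lemma alt_sum_anti m x y : x + y != 0 -> alt_sum m y x = - alt_sum m x y.
Proof.
move=> xy0; apply: (mulfI xy0); rewrite mulrN alt_sumE [x + y]addrC alt_sumE.
by ring.
Qed.

(** The index m stands for the term m + 1 of psi, whose bracket has degree 2m + 3; the remaining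
    degree comes from ad_t, with symbol x + y. *)
Definition symbol_psi h k N x y : K :=
  \sum_(m < N) (if (m.*2.+3 <= N)%N then
    h (N - m.*2.+3)%N * k m * ((x + y) ^+ (N - m.*2.+3) * alt_sum m.+1 x y) else 0).

Definition symbol_br h N x y : K :=
  \sum_(i < N.+1) i%:R * h i.+1 * h (N - i)%N * (x ^+ i * y ^+ (N - i)).

Definition kzb_symbol h k N x y : K :=
  h N.+1 * shift_quot N.+1 x y + symbol_psi h k N x y + symbol_br h N x y.

Lemma symbol_psi_anti h k N x y : x + y != 0 ->
  symbol_psi h k N y x = - symbol_psi h k N x y.
Proof.
move=> xy0; rewrite /symbol_psi -sumrN; apply: eq_bigr => m _.
case: ifP => _; last by rewrite oppr0.
by rewrite alt_sum_anti // [y + x]addrC !mulrN.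
Qed.

Definition nconv (f g : nat -> K) n := \sum_(i < n.+1) f i * g (n - i)%N.

(** The coefficient i h_(i+1) of the bracket symbol is (n - 1) h_n at n = i + 1. The missing index n
    = 0 has value -1 and accounts for the isolated term. *)
Lemma conv_br_r h N x y : h 0%N = 1 ->
  nconv (fun i => h i * x ^+ i) (fun j => (j%:R - 1) * h j * y ^+ j) N.+1 =
  - h N.+1 * x ^+ N.+1 + y * symbol_br h N y x.
Proof.
move=> h0; rewrite /nconv big_ord_recr /= subnn h0 addrC; congr (_ + _); first by ring.
rewrite /symbol_br mulr_sumr [RHS](reindex_inj rev_ord_inj) /=; apply: eq_bigr => i _.
have iN : (i <= N)%N by rewrite -ltnS.
by rewrite subSS subSn // subKn // -natr1 !exprS; ring.
Qed.

Lemma conv_br_l h N x y : h 0%N = 1 ->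
  nconv (fun i => (i%:R - 1) * h i * x ^+ i) (fun j => h j * y ^+ j) N.+1 =
  - h N.+1 * y ^+ N.+1 + x * symbol_br h N x y.
Proof.
move=> h0; rewrite /nconv big_ord_recl /= subn0 h0; congr (_ + _); first by ring.
rewrite /symbol_br mulr_sumr; apply: eq_bigr => i _.
by rewrite /bump leq0n add1n subSS -natr1 !exprS; ring.
Qed.

Lemma conv_psi h w k N x y : w 0%N = 1 -> (forall m, w m.*2.+1 = 0) ->
  (forall m, w m.*2.+4 = 2 * k m) ->
  nconv (fun i => h i * (x + y) ^+ i) (fun m => w m * (y ^+ 2 * x ^+ m - x ^+ 2 * y ^+ m)) N.+1 =
  h N.+1 * (x + y) ^+ N.+1 * (y ^+ 2 - x ^+ 2) + 2 * (x * y * (x + y) * symbol_psi h k N x y).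
Proof.
move=> w0 wo we.
pose t m := if (m <= N.+1)%N then h (N.+1 - m)%N * (x + y) ^+ (N.+1 - m) *
  (w m * (y ^+ 2 * x ^+ m - x ^+ 2 * y ^+ m)) else 0.
have -> : nconv (fun i => h i * (x + y) ^+ i)
    (fun m => w m * (y ^+ 2 * x ^+ m - x ^+ 2 * y ^+ m)) N.+1 = \sum_(m < N.+2) t m.
  rewrite /nconv (reindex_inj rev_ord_inj) /=; apply: eq_bigr => i _.
  have iN : (i <= N.+1)%N by rewrite -ltnS.
  by rewrite /t iN subSS subKn.
rewrite (sum_even (leqnn _)); last first.
  by move=> m; rewrite /t; case: ifP => // _; rewrite wo mul0r mulr0.
rewrite big_ord_recl big_ord_recl /= addrA; congr (_ + _).
  have -> : t 0%N = h N.+1 * (x + y) ^+ N.+1 * (y ^+ 2 - x ^+ 2).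
    by rewrite /t leq0n w0 subn0; ring.
  (* The term of [w 2], where G_2 would enter, cancels between x and y; accordingly psi starts with
     G_4. *)
  have -> : t 2%N = 0 by rewrite /t; case: ifP => // _; ring.
  by rewrite if_same addr0.
rewrite /symbol_psi !mulr_sumr; apply: eq_bigr => m _.
rewrite /bump !leq0n !add1n !doubleS !ltnS; case: ifP => mN; last by rewrite !mulr0.
rewrite /t !ltnS mN !subSS we.
have e := alt_sumE m.+1 x y.
transitivity (2 * (h (N - m.*2.+3)%N * k m * (x + y) ^+ (N - m.*2.+3) * (x * y) *
   (x * y * (x ^+ m.+1.*2 - y ^+ m.+1.*2)))).
  by rewrite doubleS !exprS; ring.
by rewrite -e; ring.
Qed.

(* The last hypothesis is the Fay identity in degree N + 3; it amounts to
   x y (x + y) (f(x, y) - f(y, x)) = 0 for the symbol f. *)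
Lemma kzb_symbol_sym h w k N x y : h 0%N = 1 -> w 0%N = 1 ->
  (forall m, w m.*2.+1 = 0) -> (forall m, w m.*2.+4 = 2 * k m) ->
  x != 0 -> y != 0 -> x + y != 0 ->
  (x + y) * (x * nconv (fun i => h i * x ^+ i) (fun j => (j%:R - 1) * h j * y ^+ j) N.+1 -
             y * nconv (fun i => (i%:R - 1) * h i * x ^+ i) (fun j => h j * y ^+ j) N.+1) =
  nconv (fun i => h i * (x + y) ^+ i) (fun m => w m * (y ^+ 2 * x ^+ m - x ^+ 2 * y ^+ m)) N.+1 ->
  kzb_symbol h k N x y = kzb_symbol h k N y x.
Proof.
move=> h0 w0 wo we x0 y0 xy0; rewrite conv_br_r // conv_br_l // (conv_psi _ _ _ _ w0 wo we) => E.
have d1 := shift_quotE N.+1 x y; have d2 := shift_quotE N.+1 y x.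
apply/eqP; rewrite -subr_eq0; apply/eqP.
apply: (mulfI (mulf_neq0 (mulf_neq0 x0 y0) xy0)); rewrite mulr0.
rewrite /kzb_symbol (symbol_psi_anti h k N xy0).
move: (symbol_psi h k N x y) (symbol_br h N x y) (symbol_br h N y x) E => f2 f3 f3' E.
move: (shift_quot N.+1 x y) (shift_quot N.+1 y x) d1 d2 => s1 s2 d1 d2.
transitivity ((x + y) * h N.+1 * (y * (x * s1) - x * (y * s2))
  + 2 * (x * y * (x + y) * f2) + x * y * (x + y) * (f3 - f3')); first by ring.
rewrite d1 d2 [y + x]addrC.
transitivity (h N.+1 * (x + y) ^+ N.+1 * (y ^+ 2 - x ^+ 2) + 2 * (x * y * (x + y) * f2) -
  (x + y) * (x * (- h N.+1 * x ^+ N.+1 + y * f3') - y * (- h N.+1 * y ^+ N.+1 + x * f3))).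
  by rewrite !exprS; ring.
by rewrite E subrr.
Qed.

End KzbSymbol.

(** * Taylor coefficients of the Fay identity along rays *)

Section FayCoefficients.
Variable R : realType.
Local Notation C := (Cplx R).
Variable tau : C.
Hypothesis tau_gt0 : 0 < complex.Im tau.
Variable xi : C.
Hypothesis xi_nl : nonlattice tau xi.

Let h := kron_coef tau xi.
Let w m := (1 - m%:R) * kron_coef tau 0 m.

Lemma ana_near_eq (f g : C -> C) c d : ana f c -> ana g d ->
  (forall e : C, 0 < e -> exists x, [/\ x != 0, `|x| < e & f x = g x]) -> c =1 d.
Proof.
move=> hf hg fg; apply: (ana_unique hf hg) => e /fg[x [x0 xe fgx]].
by exists x; rewrite fgx subrr.
Qed.

(** Both sides are coefficients of germs in one variable s, obtained from [gf_fay] at (s x, s y).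
    For small real s > 0 the points s x, s y and s (x + y) lie on the positive imaginary axis, where
    [gf_fay] applies. *)
Lemma fay_coef (a b : R) n : 0 < a -> 0 < b -> let x := imag a in let y := imag b in
  (x + y) * (x * conv (fun i => h i * x ^+ i) (fun j => (j%:R - 1) * h j * y ^+ j) n -
             y * conv (fun i => (i%:R - 1) * h i * x ^+ i) (fun j => h j * y ^+ j) n) =
  conv (fun i => h i * (x + y) ^+ i) (fun m => w m * (y ^+ 2 * x ^+ m - x ^+ 2 * y ^+ m)) n.
Proof.
move=> a0 b0 x y; have ab0 : 0 < a + b by rewrite addr_gt0.
have aH k := ana_scale k (ana_kron_gf tau_gt0 xi).
have aE k := ana_scale k (ana_dkron_gf tau_gt0 xi).
have aW k := ana_scale k (ana_dkron_gf tau_gt0 0).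
have aL := anaZ (x + y) (anaB (anaZ x (anaM (aH x) (aE y))) (anaZ y (anaM (aE x) (aH y)))).
have aR := anaM (aH (x + y)) (anaB (anaZ (x ^+ 2) (aW y)) (anaZ (y ^+ 2) (aW x))).
rewrite (ana_near_eq aL aR).
  by congr conv; apply/funext => m; rewrite /w; ring.
move=> e e0; have [t1 [t10 t1e t1c]] := minC_ex e0 (conv_radius_gt0 tau_gt0).
have [t [t0 tt1 tg]] := minC_ex t10 (gf_radius_gt0 R).
have abC0 : 0 < (1 + (a + b))%:C%C :> C by rewrite ltcR addr_gt0.
(* This s has (1 + a + b) s < t, so s itself and the moduli of all three points are below t. *)
pose s := complex.Re (t / (1 + (a + b))%:C%C) / 2.
have sE : t / (1 + (a + b))%:C%C = (complex.Re (t / (1 + (a + b))%:C%C))%:C%C.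
  by rewrite RRe_real // gtr0_real // divr_gt0.
have s0 : 0 < s by rewrite divr_gt0 // -ltcR -sE divr_gt0.
have st : ((1 + (a + b)) * s)%:C%C < t.
  rewrite mulrC rmorphM /= -ltr_pdivlMr // sE ltcR /s.
  by rewrite ltr_pdivrMr // mulr_natr mulr2n ltrDl -ltcR -sE divr_gt0.
have sC0 : (s%:C%C : C) != 0 by rewrite eq_complex /= negb_and (gt_eqF s0).
have nearc (c : R) : 0 < c -> c <= a + b ->
    near_upper tau (imag c * s%:C%C) /\ `|imag c * s%:C%C| < gf_radius R.
  move=> c0 cab; have -> : imag c * s%:C%C = imag (c * s).
    by apply/eqP; rewrite eq_complex /=; apply/andP; split; apply/eqP; ring.
  have ct : `|imag (c * s)| < t.
    rewrite norm_imag; last by rewrite mulr_ge0 // ltW.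
    apply: le_lt_trans st; rewrite lecR ler_wpM2r ?(ltW s0) //.
    by rewrite (le_trans cab) // lerDr.
  split; last exact: lt_le_trans tg.
  by split; [apply: lt_le_trans ct (le_trans tt1 t1c)|rewrite /= mulr_gt0].
have [nx gx] : near_upper tau (x * s%:C%C) /\ `|x * s%:C%C| < gf_radius R.
  by apply: nearc => //; rewrite lerDl ltW.
have [ny gy] : near_upper tau (y * s%:C%C) /\ `|y * s%:C%C| < gf_radius R.
  by apply: nearc => //; rewrite lerDr ltW.
have xyE : x + y = imag (a + b).
  by apply/eqP; rewrite eq_complex /= addr0 !eqxx.
have [nxy gxy] : near_upper tau ((x + y) * s%:C%C) /\ `|(x + y) * s%:C%C| < gf_radius R.
  by rewrite xyE; apply: nearc.
exists s%:C%C; split=> //.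
  rewrite -[s%:C%C]mul1r -[1](rmorph1 (real_complex R)) -rmorphM.
  rewrite (@ger0_norm _ (1 * s)%:C%C); last by rewrite ler0c mul1r ltW.
  apply: lt_le_trans (le_trans tt1 t1e); apply: le_lt_trans st.
  by rewrite lecR ler_wpM2r ?(ltW s0) // lerDl ltW.
rewrite mulrDl in nxy gxy.
have := gf_fay tau_gt0 xi_nl nx ny nxy gx gy gxy => E.
(* The prefactors of [gf_fay] at the scaled points exceed those of the goal by s^2. *)
apply: (mulfI (expf_neq0 2 sC0)); rewrite (mulrDl x y s%:C%C).
set H12 := kron_gf tau xi (x * s%:C%C + y * s%:C%C) in E *.
set H1 := kron_gf tau xi (x * s%:C%C) in E *; set H2 := kron_gf tau xi (y * s%:C%C) in E *.
set E1 := dkron_gf tau xi (x * s%:C%C) in E *; set E2 := dkron_gf tau xi (y * s%:C%C) in E *.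
set W1 := dkron_gf tau 0 (x * s%:C%C) in E *; set W2 := dkron_gf tau 0 (y * s%:C%C) in E *.
transitivity ((x * s%:C%C + y * s%:C%C) * (x * s%:C%C * (H1 * E2) - y * s%:C%C * (E1 * H2))).
  by ring.
by rewrite E; ring.
Qed.

Definition psi_coef m : C :=
  twopii R ^+ m.*2.+1 / m.*2`!%:R * eisenstein2 m.+1 tau.

Lemma kron_symbol_sym N (a b : R) : 0 < a -> 0 < b ->
  kzb_symbol h (fun m => twopii R * psi_coef m.+1) N (imag a) (imag b) =
  kzb_symbol h (fun m => twopii R * psi_coef m.+1) N (imag b) (imag a).
Proof.
move=> a0 b0; apply: (@kzb_symbol_sym C h w).
- exact: kron_coef0.
- by rewrite /w kron_coef0 subr0 mulr1.
- by move=> m; exact: weierstrass_coef_odd.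
- by move=> m; exact: (weierstrass_coef_even tau_gt0 m.+1).
- by rewrite eq_complex /= negb_and (gt_eqF a0) orbT.
- by rewrite eq_complex /= negb_and (gt_eqF b0) orbT.
- by rewrite eq_complex /= negb_and (gt_eqF (addr_gt0 a0 b0)) orbT.
exact: fay_coef.
Qed.

End FayCoefficients.

(** * Brackets and their symbols *)

Section LieSymbols.
Variable K : numFieldType.
Local Notation a_ n := (iter n (lie_br gen_t) (gen_a : liealg K)).
Implicit Types (z : liealg K) (f g : K -> K -> K).

Lemma lie_br_anti (x y : liealg K) : lie_br x y = - lie_br y x.
Proof.
apply/liealg_inj; rewrite -[- lie_br y x]addr0 -scaleN1r lie_valZD scaleN1r.
by rewrite !lie_val_br /nc_comm addr0 opprB.
Qed.

Lemma lie_brZr (c : K) (x y : liealg K) : lie_br x (c *: y) = c *: lie_br x y.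
Proof. by have := lie_br_linr c y 0 x; rewrite lie_br0r !addr0. Qed.

Lemma lie_brZl (c : K) (x y : liealg K) : lie_br (c *: x) y = c *: lie_br x y.
Proof. by have := lie_br_linl c x 0 y; rewrite lie_br0l !addr0. Qed.

Lemma lie_br_sumr (I : Type) (r : seq I) (P : pred I) (F : I -> liealg K) x :
  lie_br x (\sum_(i <- r | P i) F i) = \sum_(i <- r | P i) lie_br x (F i).
Proof.
by apply: (big_morph _ _ (lie_br0r x)) => y y'; exact: lie_brDr.
Qed.

Lemma lie_br_suml (I : Type) (r : seq I) (P : pred I) (F : I -> liealg K) x :
  lie_br (\sum_(i <- r | P i) F i) x = \sum_(i <- r | P i) lie_br (F i) x.
Proof.
elim/big_rec2: _ => [|i y y' _ <-]; [exact: lie_br0l|exact: lie_brDl].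
Qed.

(* Because of [a_i, a_j] = - [a_j, a_i], z does not determine f. *)
Definition has_symbol N z f := exists c : nat -> K,
  z = \sum_(j < N.+1) c j *: lie_br (a_ j) (a_ (N - j)%N) /\
  forall x y, f x y = \sum_(j < N.+1) c j * (x ^+ j * y ^+ (N - j)).

Lemma has_symbol_ext N z f g : f =2 g -> has_symbol N z f -> has_symbol N z g.
Proof. by move=> fg [c [zc fc]]; exists c; split=> // x y; rewrite -fg. Qed.

Lemma has_symbol0 N : has_symbol N 0 (fun _ _ => 0).
Proof.
exists (fun=> 0); split=> [|x y]; first by rewrite big1 // => i _; rewrite scale0r.
by rewrite big1 // => i _; rewrite mul0r.
Qed.

Lemma has_symbol_lin N k z z' f g : has_symbol N z f -> has_symbol N z' g ->
  has_symbol N (k *: z + z') (fun x y => k * f x y + g x y).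
Proof.
move=> [c [-> fc]] [d [-> gd]]; exists (fun j => k * c j + d j); split=> [|x y].
  rewrite scaler_sumr -big_split; apply: eq_bigr => i _ /=.
  by rewrite scalerDl scalerA.
rewrite fc gd mulr_sumr -big_split; apply: eq_bigr => i _ /=.
by rewrite mulrDl -mulrA.
Qed.

Lemma has_symbolD N z z' f g : has_symbol N z f -> has_symbol N z' g ->
  has_symbol N (z + z') (fun x y => f x y + g x y).
Proof.
move=> hz hz'; rewrite -[z]scale1r; apply: has_symbol_ext (has_symbol_lin 1 hz hz').
by move=> x y /=; rewrite mul1r.
Qed.

Lemma has_symbolZ N k z f : has_symbol N z f ->
  has_symbol N (k *: z) (fun x y => k * f x y).
Proof.
move=> hz; rewrite -[_ *: z]addr0.
apply: has_symbol_ext (has_symbol_lin k hz (has_symbol0 N)).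
by move=> x y /=; rewrite addr0.
Qed.

Lemma has_symbol_sum (I : Type) (r : seq I) (P : pred I) N (Z : I -> liealg K) F :
  (forall i, P i -> has_symbol N (Z i) (F i)) ->
  has_symbol N (\sum_(i <- r | P i) Z i) (fun x y => \sum_(i <- r | P i) F i x y).
Proof.
move=> h; elim: r => [|i r IHr].
  rewrite big_nil; apply: has_symbol_ext (has_symbol0 N) => x y.
  by rewrite big_nil.
rewrite big_cons; case: ifP => [Pi|nPi].
  apply: has_symbol_ext (has_symbolD (h i Pi) IHr) => x y.
  by rewrite big_cons Pi.
by apply: has_symbol_ext IHr => x y; rewrite big_cons nPi.
Qed.

Lemma has_symbol_br N i j : (i + j)%N = N ->
  has_symbol N (lie_br (a_ i) (a_ j)) (fun x y => x ^+ i * y ^+ j).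
Proof.
move=> <-.
have iN : (i < (i + j).+1)%N by rewrite ltnS leq_addr.
exists (fun k => (k == i)%:R); split=> [|x y]; rewrite (bigD1 (Ordinal iN)) //=.
  rewrite eqxx scale1r addKn big1 ?addr0 // => k ki.
  by rewrite (_ : (_ == i) = false) ?scale0r //; exact: negbTE ki.
rewrite eqxx mul1r addKn big1 ?addr0 // => k ki.
by rewrite (_ : (_ == i) = false) ?mul0r //; exact: negbTE ki.
Qed.

(** By the Jacobi identity ad_t raises the index of either entry of [a_i, a_j] in turn. *)
Lemma has_symbol_ad_t N z f : has_symbol N z f ->
  has_symbol N.+1 (lie_br gen_t z) (fun x y => (x + y) * f x y).
Proof.
move=> [c [-> fc]]; rewrite lie_br_sumr.
apply: (@has_symbol_ext _ _ (fun x y => \sum_(j < N.+1)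
    c j * (x ^+ j.+1 * y ^+ (N - j) + x ^+ j * y ^+ (N - j).+1))).
  move=> x y; rewrite fc mulr_sumr; apply: eq_bigr => j _.
  by rewrite !exprS; ring.
apply: has_symbol_sum => j _; rewrite lie_brZr; apply: has_symbolZ.
rewrite lie_br_jacobi; apply: has_symbolD.
  by apply: (@has_symbol_br _ j.+1); rewrite addSn subnKC // -ltnS.
by apply: (@has_symbol_br _ j (N - j).+1); rewrite addnS subnKC // -ltnS.
Qed.

Lemma has_symbol_iter_ad_t N n z f : has_symbol N z f ->
  has_symbol (n + N) (iter n (lie_br gen_t) z) (fun x y => (x + y) ^+ n * f x y).
Proof.
move=> hz; elim: n => [|n IHn].
  by apply: has_symbol_ext hz => x y; rewrite mul1r.
by apply: has_symbol_ext (has_symbol_ad_t IHn) => x y /=; rewrite exprS mulrA.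
Qed.

(** D a_(k+1) = [a, a_k] + [t, D a_k] for D = a d/dt, which on symbols is the recursion of
    [shift_quot]. *)
Lemma has_symbol_der_t n :
  has_symbol n (der_t gen_a (a_ n.+1)) (fun x y => shift_quot n.+1 x y).
Proof.
have step k : der_t gen_a (a_ k.+1) = lie_br (a_ 0) (a_ k) + lie_br gen_t (der_t gen_a (a_ k)).
  by rewrite iterS der_leibniz der_t_t.
elim: n => [|n IHn].
  rewrite step -[iter 0 _ gen_a]/gen_a der_t_a lie_br0r addr0.
  apply: has_symbol_ext (@has_symbol_br 0 0 0 erefl) => x y.
  by rewrite /= mulr0 addr0 mulr1.
rewrite step; apply: has_symbol_ext (has_symbolD (@has_symbol_br n.+1 0 n.+1 erefl) (has_symbol_ad_t IHn)).
by move=> x y; rewrite expr0 mul1r.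
Qed.

Definition alt_br m : liealg K :=
  \sum_(1 <= j < m.*2.+1) (-1) ^+ j *: lie_br (a_ j) (a_ (m.*2.+1 - j)).

Lemma has_symbol_alt_br m : has_symbol m.*2.+1 (alt_br m) (alt_sum m).
Proof.
rewrite /alt_br big_nat_cond; apply: has_symbol_ext (has_symbol_sum _ _).
  by move=> x y; rewrite /alt_sum [RHS]big_nat_cond.
move=> j /andP[/andP[_ jm] _]; apply: has_symbolZ.
by apply: has_symbol_br; rewrite subnKC // ltnW.
Qed.

Lemma der_a_iter (u : liealg K) n : der_a u (a_ n) = iter n (lie_br gen_t) u.
Proof.
elim: n => [|n IHn]; first exact: der_a_a.
by rewrite iterS der_leibniz der_a_t lie_br0l add0r IHn.
Qed.

(** By homogeneity a single nonzero y suffices: infinitely many x force c_j = c_(N-j). Antisymmetry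
    of the bracket then gives z = - z, and the characteristic is 0. *)
Lemma has_symbol_sym0 N z f (r : nat -> K) (y : K) : has_symbol N z f ->
  injective r -> y != 0 -> (forall k, f (r k) y = f y (r k)) -> z = 0.
Proof.
move=> [c [zc fc]] rI y0 fr.
pose p := \poly_(j < N.+1) ((c j - c (N - j)%N) * y ^+ (N - j)).
have p0 : p = 0.
  apply/eqP; rewrite -size_poly_eq0; apply/eqP.
  have [//|s0] := eqVneq (size p) 0%N; exfalso.
  have pn0 : p != 0 by rewrite -size_poly_eq0.
  have := @max_poly_roots _ p [seq r k | k <- iota 0 N.+1] pn0.
  rewrite size_map size_iota ltnNge size_poly => /(_ _ _)/negP; case.
  - apply/allP => _ /mapP[k _ ->]; apply/rootP; rewrite horner_poly.
    have := fr k; rewrite !fc => /eqP; rewrite -subr_eq0.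
    rewrite [X in _ - X](reindex_inj rev_ord_inj) /= -sumrB => /eqP e.
    rewrite -[RHS]e; apply: eq_bigr => j _.
    by rewrite !subSS subKn -1?ltnS //; ring.
  - by rewrite map_inj_uniq // iota_uniq.
  - by [].
have cs j : (j <= N)%N -> c j = c (N - j)%N.
  move=> jN; have := congr1 (fun p : {poly K} => p`_j) p0.
  rewrite coef_poly ltnS jN coef0 => /eqP.
  by rewrite mulf_eq0 expf_eq0 (negPf y0) andbF orbF subr_eq0 => /eqP.
have zN : z = - z.
  rewrite {1}zc zc -sumrN (reindex_inj rev_ord_inj) /=; apply: eq_bigr => j _.
  have jN : (j <= N)%N by rewrite -ltnS.
  by rewrite subSS subKn // -cs // lie_br_anti scalerN.
have : 2%:R *: z = 0 by rewrite scaler_nat mulr2n {1}zN addNr.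
by move=> /eqP; rewrite scaler_eq0 pnatr_eq0 /= => /eqP.
Qed.

(** With h_n the coefficients of t F and k_m those of psi times 2 pi i, this is the part of 2 pi i B
    phi made of brackets [a_i, a_j] with i + j = N. The three summands come from a d/dt, psi and
    nu. *)
Definition kzb_br (h k : nat -> K) N : liealg K :=
  h N.+1 *: der_t gen_a (a_ N.+1) +
  \sum_(m < N) (if (m.*2.+3 <= N)%N then
     (h (N - m.*2.+3)%N * k m) *: der_a (alt_br m.+1) (a_ (N - m.*2.+3)) else 0) +
  \sum_(i < N.+1) (i%:R * h i.+1 * h (N - i)%N) *: lie_br (a_ i) (a_ (N - i)).

Lemma has_symbol_kzb h k N : has_symbol N (kzb_br h k N) (kzb_symbol h k N).
Proof.
apply: has_symbolD; [apply: has_symbolD|].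
- exact/has_symbolZ/has_symbol_der_t.
- apply: has_symbol_sum => m _; case: ifP => mN; last exact: has_symbol0.
  apply: has_symbolZ; rewrite der_a_iter.
  have := has_symbol_iter_ad_t (N - m.*2.+3) (has_symbol_alt_br m.+1).
  by rewrite doubleS subnK.
- apply: has_symbol_sum => i _; apply: has_symbolZ.
  by apply: has_symbol_br; rewrite subnKC // -ltnS.
Qed.

End LieSymbols.

(** * From homogeneous components to the whole series *)

Lemma sum_shift_trunc (V : nmodType) (G : nat -> V) M (c : nat) :
  (forall n, (M <= c + n)%N -> G n = 0) ->
  \sum_(n < M) G n = \sum_(N < M) (if (c <= N)%N then G (N - c)%N else 0).
Proof.
move=> G0; rewrite -[RHS](big_mkord xpredT (fun N => if (c <= N)%N then G (N - c)%N else 0)).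
have [cM|Mc] := leqP c M; last first.
  rewrite [RHS]big_nat_cond [RHS]big1 => [|N /andP[/andP[_ NM] _]].
    by rewrite big1 // => n _; apply: G0; lia.
  by rewrite ifF //; apply/negP; lia.
rewrite (big_cat_nat (n := c)) //= [X in X + _]big_nat_cond [X in X + _]big1 ?add0r; last first.
  by move=> N /andP[/andP[_ Nc] _]; rewrite ifF //; apply/negP; lia.
rewrite -[X in \sum_(X <= _ < _) _]add0n big_addn big_mkord.
transitivity (\sum_(n < M - c) G n); last first.
  by apply: eq_bigr => n _; rewrite leq_addl addnK.
rewrite (big_ord_widen M G (leq_subr c M)) [RHS]big_mkcond; apply: eq_bigr => n _ /=.
by case: ifP => // nM; apply: G0; lia.
Qed.

Section Flatness.
Variable K : numFieldType.
Local Notation a_ n := (iter n (lie_br gen_t) (gen_a : liealg K)).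
Implicit Types (x y z : liealg K) (D E : der K) (w : seq bool) (c : nat -> K).

Lemma lie_valD x y w : lie_val (x + y) w = lie_val x w + lie_val y w.
Proof. by rewrite -[x]scale1r lie_valZD !scale1r. Qed.

Lemma lie_valZ (k : K) x w : lie_val (k *: x) w = k * lie_val x w.
Proof. by rewrite -[_ *: x]addr0 lie_valZD addr0. Qed.

Lemma lie_val_sum (I : Type) (r : seq I) (P : pred I) (F : I -> liealg K) w :
  lie_val (\sum_(i <- r | P i) F i) w = \sum_(i <- r | P i) lie_val (F i) w.
Proof. by elim/big_rec2: _ => // i y z _ <-; rewrite lie_valD. Qed.

Definition agree n x y := forall w, (size w <= n)%N -> lie_val x w = lie_val y w.

(** Continuity in the form that is used: degrees up to n of the value depend only on degrees up to n
    of the argument. It allows a derivation to be applied termwise to the infinite series phi. *)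
Definition der_local D := forall n x y, agree n x y -> agree n (D x) (D y).

Lemma agree_br n x x' y y' : agree n x x' -> agree n y y' ->
  agree n (lie_br x y) (lie_br x' y').
Proof.
move=> hx hy w wn; rewrite !lie_val_br /nc_comm !fctE.
congr (_ - _); apply: eq_bigr => i _; congr (_ * _); (apply: hx || apply: hy);
  rewrite ?size_drop ?size_take; try (case: ifP => iw); lia.
Qed.

Lemma der_local_ad x : der_local (ad x).
Proof. by move=> n y y' h; apply: agree_br. Qed.

Lemma der_local_der_t (u : liealg K) : der_local (der_t u).
Proof.
move=> n x y h w wn; apply: nc_der_trunc; first exact: lie_series_nil (valP u).
by move=> p pw; apply: h; exact: leq_trans wn.
Qed.

Lemma der_local_der_a (u : liealg K) : der_local (der_a u).
Proof.
move=> n x y h w wn; apply: nc_der_trunc; first exact: lie_series_nil (valP u).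
by move=> p pw; apply: h; exact: leq_trans wn.
Qed.

Lemma der_localD D E : der_local D -> der_local E -> der_local (D + E).
Proof.
move=> hD hE n x y h w wn.
by rewrite [LHS]lie_valD [RHS]lie_valD (hD _ _ _ h) ?(hE _ _ _ h).
Qed.

Lemma der_localZ k D : der_local D -> der_local (k *: D).
Proof. by move=> hD n x y h w wn; rewrite [LHS]lie_valZ [RHS]lie_valZ (hD _ _ _ h). Qed.

Lemma der_local_sum (F : nat -> der K) (FS : der_summable F) :
  (forall m, der_local (F m)) -> der_local (der_sum FS).
Proof. by move=> hF n x y h w wn; apply: eq_bigr => m _; exact: (hF m n). Qed.

Lemma der0 D : D 0 = 0.
Proof. by have := der_lin D (-1) 0 0; rewrite scaler0 addr0 scaleN1r addNr. Qed.

Lemma derZ D (k : K) x : D (k *: x) = k *: D x.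
Proof. by have := der_lin D k x 0; rewrite der0 !addr0. Qed.

Lemma der_sumE D (I : Type) (r : seq I) (P : pred I) (F : I -> liealg K) :
  D (\sum_(i <- r | P i) F i) = \sum_(i <- r | P i) D (F i).
Proof. by elim/big_rec2: _ => [|i y z _ <-]; [exact: der0|exact: derD]. Qed.

Definition ps_trunc M c : liealg K := \sum_(n < M) c n *: a_ n.

Lemma ps_act_trunc c n : agree n (ps_act c gen_a) (ps_trunc n.+1 c).
Proof.
move=> w wn; rewrite /ps_trunc lie_val_sum.
apply: (@nc_sum_widen _ (fun m => c m *: a_ m)) => // m.
by apply/order_geZ/(@order_geW _ m m.+1) => //; exact: order_ge_iter_ad.
Qed.

Lemma der_ps_act D c w : der_local D ->
  lie_val (D (ps_act c gen_a)) w =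
  \sum_(n < (size w).+1) c n * lie_val (D (a_ n)) w.
Proof.
move=> hD; rewrite (hD _ _ _ (ps_act_trunc c (n := size w))) //.
rewrite /ps_trunc der_sumE lie_val_sum; apply: eq_bigr => n _.
by rewrite derZ lie_valZ.
Qed.

Lemma ps_act_br c x w :
  lie_val (lie_br (ps_act c gen_a) x) w =
  \sum_(n < (size w).+1) c n * lie_val (lie_br (a_ n) x) w.
Proof.
rewrite (agree_br (ps_act_trunc c (n := size w)) (y' := x)) //.
rewrite /ps_trunc lie_br_suml lie_val_sum; apply: eq_bigr => n _.
by rewrite lie_brZl lie_valZ.
Qed.

Lemma ad_t_br_order i j w : (size w <= i + j)%N -> lie_val (lie_br (a_ i) (a_ j)) w = 0.
Proof.
move=> h; apply: (@order_ge_br K i.+1 j.+1); try exact: order_ge_iter_ad.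
by rewrite addSn addnS; lia.
Qed.

Lemma der_t_order n w : (size w <= n)%N -> lie_val (der_t gen_a (a_ n.+1)) w = 0.
Proof.
have [c [-> _]] := has_symbol_der_t K n; move=> wn; rewrite lie_val_sum big1 // => i _.
by rewrite lie_valZ ad_t_br_order ?mulr0 // subnKC // -ltnS.
Qed.

Lemma alt_br_order m n w : (size w <= m.*2.+1 + n)%N ->
  lie_val (der_a (alt_br K m) (a_ n)) w = 0.
Proof.
rewrite der_a_iter; have [c [-> _]] := has_symbol_iter_ad_t n (has_symbol_alt_br K m).
move=> wn; rewrite lie_val_sum big1 // => i _; have := ltn_ord i => iN.
by rewrite lie_valZ ad_t_br_order ?mulr0 // subnKC -1?ltnS // addnC.
Qed.

(** The left side is the coefficient of w in 2 pi i B phi. Brackets of large degree vanish at w, so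
    every sum may be cut at size w + 1, and regrouping by total degree N gives the coefficients of
    [kzb_br]. *)
Lemma kzb_flat h k w : (forall N, kzb_br h k N = 0) ->
  \sum_(n < (size w).+1) h n *
    (lie_val (der_t gen_a (a_ n)) w
     + \sum_(m < (size w).+1) k m * lie_val (der_a (alt_br K m.+1) (a_ n)) w
     + \sum_(i < (size w).+1) (i%:R * h i.+1) * lie_val (lie_br (a_ i) (a_ n)) w) = 0.
Proof.
move=> Z0; set M := (size w).+1.
pose dt n : K := lie_val (der_t gen_a (a_ n)) w.
pose da m n : K := lie_val (der_a (alt_br K m.+1) (a_ n)) w.
pose br i n : K := lie_val (lie_br (a_ i) (a_ n)) w.
have dt0 : dt 0%N = 0 by rewrite /dt der_t_a.
have dtM : dt M = 0 by exact: der_t_order.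
have da0 m n : (M <= m.*2.+3 + n)%N -> da m n = 0.
  by move=> Mn; apply: alt_br_order; rewrite doubleS; lia.
have br0 i n : (M <= i + n)%N -> br i n = 0 by move=> Mn; apply: ad_t_br_order; lia.
have Z N : h N.+1 * dt N.+1 +
    \sum_(m < N) (if (m.*2.+3 <= N)%N then h (N - m.*2.+3)%N * k m * da m (N - m.*2.+3)%N else 0) +
    \sum_(i < N.+1) i%:R * h i.+1 * h (N - i)%N * br i (N - i)%N = 0.
  have := congr1 (fun x : liealg K => lie_val x w) (Z0 N).
  rewrite /kzb_br !lie_valD !lie_val_sum lie_valZ => e; rewrite -[RHS]e.
  congr (_ + _ + _); apply: eq_bigr => i _.
  by case: ifP => // _; exact/esym/lie_valZ.
transitivity (\sum_(n < M) h n * (dt n + \sum_(m < M) k m * da m n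
  + \sum_(i < M) i%:R * h i.+1 * br i n)); first by [].
move: dt da br dt0 dtM da0 br0 Z => dt da br dt0 dtM da0 br0 Z.
clearbody M.
under eq_bigr => n _ do rewrite !mulrDr.
rewrite !big_split /=.
transitivity (\sum_(N < M) (h N.+1 * dt N.+1 +
    \sum_(m < N) (if (m.*2.+3 <= N)%N then h (N - m.*2.+3)%N * k m * da m (N - m.*2.+3)%N else 0) +
    \sum_(i < N.+1) i%:R * h i.+1 * h (N - i)%N * br i (N - i)%N)); last first.
  by rewrite big1 // => N _; rewrite Z.
rewrite !big_split /=; congr (_ + _ + _).
(* The shift n = N + 1 loses nothing: a d/dt kills a_0, and its value on a_M has order greater than
   the length of w. *)
- transitivity (\sum_(n < M.+1) h n * dt n); first by rewrite big_ord_recr /= dtM mulr0 addr0.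
  by rewrite big_ord_recl /= dt0 mulr0 add0r.
- under eq_bigr => n _ do rewrite mulr_sumr.
  rewrite exchange_big /=.
  transitivity (\sum_(m < M) \sum_(N < M) (if (m.*2.+3 <= N)%N then
      h (N - m.*2.+3)%N * (k m * da m (N - m.*2.+3)%N) else 0)).
    apply: eq_bigr => m _.
    apply: (@sum_shift_trunc _ (fun n => h n * (k m * da m n))).
    by move=> n Mn; rewrite da0 ?mulr0.
  rewrite exchange_big; apply: eq_bigr => N _.
  have NM : (N <= M)%N by rewrite ltnW.
  rewrite (big_ord_widen _ (fun m => if (m.*2.+3 <= N)%N
     then h (N - m.*2.+3)%N * k m * da m (N - m.*2.+3)%N else 0) NM).
  rewrite [RHS]big_mkcond; apply: eq_bigr => m _ /=.
  case: ifP => mN; last by rewrite if_same.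
  by rewrite ifT ?mulrA //; lia.
- under eq_bigr => n _ do rewrite mulr_sumr.
  rewrite exchange_big /=.
  transitivity (\sum_(i < M) \sum_(N < M) (if (i <= N)%N then
      h (N - i)%N * (i%:R * h i.+1 * br i (N - i)%N) else 0)).
    apply: eq_bigr => i _.
    apply: (@sum_shift_trunc _ (fun n => h n * (i%:R * h i.+1 * br i n))).
    by move=> n Mn; rewrite br0 ?mulr0.
  rewrite exchange_big; apply: eq_bigr => N _.
  have NM : (N < M)%N by [].
  rewrite (big_ord_widen _ (fun i => i%:R * h i.+1 * h (N - i)%N * br i (N - i)%N) NM).
  rewrite [RHS]big_mkcond; apply: eq_bigr => i _ /=.
  by rewrite ltnS; case: ifP => // iN; ring.
Qed.

End Flatness.

(** * Vanishing of the bracket of [omega] with itself *)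

Section KzbBracket.
Variable R : realType.
Local Notation C := (Cplx R).
Variables (tau xi : C).
Hypothesis tau_gt0 : 0 < complex.Im tau.
Hypothesis xi_nl : nonlattice tau xi.

Lemma kzb_br0 N :
  kzb_br (kron_coef tau xi) (fun m => twopii R * psi_coef tau m.+1) N = 0.
Proof.
(* Points on the positive imaginary axis, where [kron_symbol_sym] gives the symmetry. *)
apply: (has_symbol_sym0 (has_symbol_kzb _ _ N) (r := fun k => imag k.+1%:R) (y := imag 1)).
- by move=> i j /eqP; rewrite eq_complex /= eqxx eqr_nat => /eqP[].
- by rewrite eq_complex /= negb_and oner_neq0 orbT.
- by move=> k; apply: kron_symbol_sym.
Qed.

Lemma psi_local (t : C) : der_local (psi t).
Proof. by apply: der_local_sum => m; apply/der_localZ/der_local_der_a. Qed.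

Lemma omega_tau_ps0 :
  dtau_part (omega R) xi tau (ps_act (tF xi tau) gen_a) = 0.
Proof.
have tp0 : twopii R != 0 by rewrite eq_complex /= negb_and mulf_neq0 ?orbT // gt_eqF // pi_gt0.
apply/liealg_inj/funext => w; apply: (mulfI tp0); rewrite [RHS]mulr0.
rewrite der_ps_act; last first.
  by apply: der_localD; [apply: der_localD; [exact/der_localZ/der_local_der_t|exact: psi_local]|
    exact: der_local_ad].
rewrite mulr_sumr -[RHS](kzb_flat w kzb_br0); apply: eq_bigr => n _.
rewrite tFE // mulrCA; congr (_ * _).
rewrite [lie_val (dtau_part _ _ _ _) w]lie_valD [lie_val ((_ + _ : der C) _) w]lie_valD.
rewrite mulrDr [X in X + _]mulrDr; congr (_ + _ + _).
- by rewrite [lie_val ((_ *: _ : der C) _) w]lie_valZ mulrA divff // mul1r.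
- rewrite mulr_sumr; apply: eq_bigr => m _.
  by rewrite -mulrA; congr (_ * _); rewrite [LHS]lie_valZ.
- rewrite [lie_val (\val _ _) w](congr1 (fun x => lie_val x w) (lie_brZl _ _ _)).
  rewrite lie_valZ mulrA divff // mul1r ps_act_br; apply: eq_bigr => i _.
  by rewrite tdFE.
Qed.

Lemma omega_br0 : form_br (omega R) (omega R) xi tau = 0.
Proof.
have d0 x : lie_br (ps_act (tF xi tau) gen_a) (dtau_part (omega R) xi tau x) =
    dtau_part (omega R) xi tau (lie_br (ps_act (tF xi tau) gen_a) x).
  by rewrite der_leibniz omega_tau_ps0 lie_br0l add0r.
apply/val_inj/funext => x.
rewrite -[LHS]/((lie_br (ps_act (tF xi tau) gen_a) (dtau_part (omega R) xi tau x) -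
    dtau_part (omega R) xi tau (lie_br (ps_act (tF xi tau) gen_a) x)) -
   (dtau_part (omega R) xi tau (lie_br (ps_act (tF xi tau) gen_a) x) -
    lie_br (ps_act (tF xi tau) gen_a) (dtau_part (omega R) xi tau x))).
by rewrite d0 !subrr.
Qed.

End KzbBracket.

(** * Holomorphy and the heat equation *)

Section LambertDerivative.
Variable R : realType.
Local Notation C := (Cplx R).
Implicit Types (z w h a b t u : C) (p : nat -> C).

Definition lam u : C := u / (1 - u).
(** u d/du of [lam], i.e. its derivative in the logarithm of u, since the arguments vary as u
    e^w. *)
Definition dlam u : C := u / (1 - u) ^+ 2.

Lemma lam_taylor u w (m : C) : 0 < m -> m <= `|1 - u| -> m <= `|1 - u * cexp w| ->
  `|lam (u * cexp w) - lam u - w * dlam u| <=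
  `|u| * (`|1 - u| + `|u|) / m ^+ 3 * (`|w| ^+ 2 * cexp `|w|).
Proof.
move=> m0 mu mE; have nu : 0 < `|1 - u| by exact: lt_le_trans mu.
have nE : 0 < `|1 - u * cexp w| by exact: lt_le_trans mE.
have c0 : 0 <= cexp `|w| by exact: cexp_ge0.
have e1 := cexp_sub1B_le w; have e2 := cexp_sub1_le w.
set E := cexp w in mE nE e1 e2 *.
have u1 : 1 - u != 0 by rewrite -normr_gt0.
have uE : 1 - u * E != 0 by rewrite -normr_gt0.
have -> : lam (u * E) - lam u - w * dlam u =
   u * ((E - 1 - w) * (1 - u) + w * (u * (E - 1))) / ((1 - u * E) * (1 - u) ^+ 2).
  by rewrite /lam /dlam; field; rewrite u1 uE.
rewrite normrM (normrM u) normfV.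
have hN : `|(E - 1 - w) * (1 - u) + w * (u * (E - 1))| <=
    (`|1 - u| + `|u|) * (`|w| ^+ 2 * cexp `|w|).
  apply: (le_trans (ler_normD _ _)); rewrite [leRHS]mulrDl; apply: lerD.
    by rewrite normrM mulrC ler_wpM2l.
  rewrite !normrM mulrCA ler_wpM2l // expr2 -mulrA ler_wpM2l //.
have hD : m ^+ 3 <= `|(1 - u * E) * (1 - u) ^+ 2|.
  by rewrite normrM normrX exprS ler_pM ?exprn_ge0 ?(ltW m0) // lerXn2r ?nnegrE // ltW.
have hI : `|(1 - u * E) * (1 - u) ^+ 2|^-1 <= (m ^+ 3)^-1.
  by rewrite lef_pV2 // posrE ?exprn_gt0 // (lt_le_trans _ hD) ?exprn_gt0.
have -> : `|u| * (`|1 - u| + `|u|) / m ^+ 3 * (`|w| ^+ 2 * cexp `|w|) =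
    `|u| * ((`|1 - u| + `|u|) * (`|w| ^+ 2 * cexp `|w|)) / m ^+ 3 by ring.
by apply: ler_pM; rewrite ?mulr_ge0 ?invr_ge0 // ler_wpM2l.
Qed.

(** A displacement of size d changes the n-th term by a factor of order exp(T d)^(n+1). Bringing
    exp(T d) close to 1 keeps this growth below the decay |e(t)|^n. *)
Lemma cexp_near1 (T e : C) : 0 <= T -> 0 < e ->
  exists2 d : C, 0 < d & d <= 1 /\ cexp (T * d) <= 1 + e.
Proof.
move=> T0 e0; have T1 : 0 < T + 1 by rewrite ltr_wpDl.
have c1 : 0 < cexp (1 : C) by apply: lt_le_trans (cexp_ge1 (@ler01 C)).
have [d1 [d10 dT de]] := minC_ex (divr_gt0 (@ltr01 C) T1) (divr_gt0 e0 (mulr_gt0 T1 c1)).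
have [d [d0 dd1 d_1]] := minC_ex d10 (@ltr01 C); exists d => //; split=> //.
have Td0 : 0 <= T * d by rewrite mulr_ge0 // ltW.
have T_le : T <= T + 1 by rewrite lerDl.
have Td1 : T * d <= 1.
  apply: (@le_trans _ _ ((T + 1) * d)); first by rewrite ler_wpM2r // ltW.
  by rewrite mulrC -ler_pdivlMr //; exact: le_trans dT.
rewrite -lerBlDl.
have := cexp_sub1_le (T * d); rewrite (ger0_norm Td0) => h.
rewrite -[leLHS]ger0_norm; last by rewrite subr_ge0 cexp_ge1.
apply: (le_trans h); apply: (@le_trans _ _ ((T + 1) * d * cexp 1)).
  apply: ler_pM => //; first exact: cexp_ge0.
    by rewrite ler_wpM2r // ltW.
  exact: cexp_le.
by rewrite mulrAC mulrC -ler_pdivlMr ?mulr_gt0 //; exact: le_trans de.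
Qed.

(* The sum of the p_n lam(e(z + n t)) is differentiated in the direction (a, b)
   of the (z, t)-space. *)
Definition lambert_pt z a t b h n : C := z + h * a + n%:R * (t + h * b).

Definition lambert_diff p z a t b := exists2 d : C, 0 < d &
  [/\ forall h n, `|h| < d -> e_ (lambert_pt z a t b h n) != 1,
      forall h, `|h| < d -> summ (fun n => p n * lam (e_ (lambert_pt z a t b h n))),
      summ (fun n => p n * (twopii R * (a + n%:R * b) * dlam (e_ (z + n%:R * t)))) &
      is_derive (0 : C) (1 : C)
        (fun h => tsum (fun n => p n * lam (e_ (lambert_pt z a t b h n))))
        (tsum (fun n => p n * (twopii R * (a + n%:R * b) * dlam (e_ (z + n%:R * t)))))].

Lemma e_lambert_pt z a t b h n : e_ (lambert_pt z a t b h n) =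
  e_ (z + n%:R * t) * cexp (twopii R * h * (a + n%:R * b)).
Proof. by rewrite /e_ -cexpD; congr cexp; rewrite /lambert_pt; ring. Qed.

Lemma norm1B_ge u (m : C) : `|u| <= m -> 1 - m <= `|1 - u|.
Proof.
move=> um; rewrite (le_trans _ (lerB_dist _ _)) // normr1.
by rewrite lerB.
Qed.

(** With r = |e(t)|, the n-th point is at most r^n / 4, and a displacement multiplies it by at most
    E^(n+1), where E <= 2 and E r < 1. So it stays below (E r)^n / 2: denominators are at least 1/2
    and the terms still decay geometrically. *)
Lemma lambert_diff_tail p z a t b (K : C) j : 0 < complex.Im t ->
  (forall n, `|p n| <= K * n.+1%:R ^+ j) -> `|e_ z| <= 4^-1 -> lambert_diff p z a t b.
Proof.
move=> t0 pK z4; pose r : C := `|e_ t|.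
have r0 : 0 < r by rewrite normr_gt0 e_neq0.
have r1 : r < 1 by rewrite norm_e_lt1.
have rE : r = `|e_ t| by [].
clearbody r.
have K0 : 0 <= K by have := le_trans (normr_ge0 _) (pK 0%N); rewrite expr1n mulr1.
pose T : C := `|twopii R| * (`|a| + `|b|).
have T0 : 0 <= T by rewrite mulr_ge0 // addr_ge0.
have [e [e0 e1 er]] : exists e : C, [/\ 0 < e, e <= 1 & (1 + e) * r < 1].
  have r1' : 0 < (1 - r) / 2 by rewrite divr_gt0 // subr_gt0.
  have [e [e0 e1 eh]] := minC_ex (@ltr01 C) r1'.
  exists e; split=> //; rewrite mulrDl mul1r -ltrBrDl.
  apply: (@le_lt_trans _ _ e); first by rewrite ler_piMr // ltW.
  by apply: (le_lt_trans eh); rewrite ltr_pdivrMr // mulr_natr mulr2n ltrDl subr_gt0.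
have [d d0 [d1 Ed]] := cexp_near1 T0 e0.
pose E := cexp (T * d).
have E0 : 1 <= E by rewrite cexp_ge1 // mulr_ge0 // ltW.
have E_ge0 : 0 <= E by exact: le_trans E0.
have E2 : E <= 2 by rewrite (le_trans Ed) // -[2]/(1 + 1) lerD2l.
have Er : E * r < 1 by apply: le_lt_trans er; rewrite ler_wpM2r // ltW.
have EE : cexp (T * d) = E by [].
clearbody E.
have wb h n : `|twopii R * h * (a + n%:R * b)| <= T * n.+1%:R * `|h|.
  rewrite !normrM [leRHS]mulrAC /T -!mulrA ler_wpM2l // mulrCA ler_wpM2l //.
  apply: (le_trans (ler_normD _ _)); rewrite normrM normr_nat mulrDl; apply: lerD.
    by rewrite ler_peMr // ler1n.
  by rewrite mulrC ler_wpM2l // ler_nat.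
have cb h n : `|h| < d -> cexp `|twopii R * h * (a + n%:R * b)| <= E ^+ n.+1.
  move=> hd; rewrite -EE -cexpMn; apply: cexp_le => //.
  apply: (le_trans (wb h n)); rewrite [leRHS](_ : _ = T * n.+1%:R * d); last by ring.
  by rewrite ler_wpM2l ?mulr_ge0 // ltW.
have ub n : `|e_ (z + n%:R * t)| <= 4^-1 * r ^+ n.
  by rewrite e_D e_Mn normrM normrX -rE ler_wpM2r // exprn_ge0 // ltW.
have rn1 n : r ^+ n <= 1 by rewrite exprn_ile1 // ltW.
have u4 n : `|e_ (z + n%:R * t)| <= 4^-1.
  by apply: (le_trans (ub n)); rewrite ler_piMr // invr_ge0.
have uEb h n : `|h| < d -> `|e_ (lambert_pt z a t b h n)| <= 2^-1 * (E * r) ^+ n.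
  move=> hd; rewrite e_lambert_pt normrM.
  apply: (@le_trans _ _ (4^-1 * r ^+ n * E ^+ n.+1)).
    by apply: ler_pM => //; exact: le_trans (norm_cexp_le _) (cb h n hd).
  have -> : 4^-1 * r ^+ n * E ^+ n.+1 = E * 4^-1 * (E * r) ^+ n.
    by rewrite exprMn exprS; ring.
  rewrite ler_wpM2r ?exprn_ge0 ?mulr_ge0 // ?(ltW r0) //.
  rewrite ler_pdivrMr // (le_trans E2) //.
  by rewrite (_ : 2^-1 * 4 = 2) //; field.
have uE2 h n : `|h| < d -> `|e_ (lambert_pt z a t b h n)| <= 2^-1.
  move=> hd; apply: (le_trans (uEb h n hd)); rewrite ler_piMr ?invr_ge0 //.
  by rewrite exprn_ile1 ?mulr_ge0 // ltW.
have half : 1 - 2^-1 = 2^-1 :> C by rewrite [X in X - _](splitr 1) mul1r addrK.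
have h2 : 0 < 2^-1 :> C by rewrite invr_gt0.
have uE1 h n : `|h| < d -> 2^-1 <= `|1 - e_ (lambert_pt z a t b h n)|.
  by move=> hd; rewrite -[leLHS]half; exact/norm1B_ge/uE2.
have u1 n : 2^-1 <= `|1 - e_ (z + n%:R * t)|.
  rewrite -[leLHS]half; apply/norm1B_ge/(le_trans (u4 n)).
  by rewrite lef_pV2 ?posrE // ler_nat.
have u32 n : `|1 - e_ (z + n%:R * t)| + `|e_ (z + n%:R * t)| <= 2.
  apply: (@le_trans _ _ (1 + 4^-1 + 4^-1)).
    by rewrite lerD // (le_trans (ler_normB _ _)) // normr1 lerD2l.
  rewrite -addrA -[leRHS]/(1 + 1) lerD2l -mulr2n -[leLHS]mulr_natr mulrC ler_pdivrMr //.
  by rewrite mul1r ler_nat.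
have Er0 : 0 <= E * r by rewrite mulr_ge0 // ltW.
have Ern : `|E * r| < 1 by rewrite ger0_norm.
have sG k := summ_natX_expr k Ern.
have n0 k n : 0 <= n.+1%:R ^+ k * (E * r) ^+ n by rewrite mulr_ge0 ?exprn_ge0.
have sS h : `|h| < d -> summ (fun n => p n * lam (e_ (lambert_pt z a t b h n))).
  move=> hd; apply: (summ_le (summZ K (sG j))) => n.
  rewrite [leRHS]ger0_norm; last exact: mulr_ge0 K0 (n0 j n).
  rewrite /lam normrM [leRHS]mulrA.
  apply: ler_pM => //; rewrite normf_div ler_pdivrMr ?(lt_le_trans h2) ?uE1 //.
  apply: (le_trans (uEb h n hd)); rewrite mulrC ler_wpM2l ?exprn_ge0 //.
  exact: uE1.
have sD : summ (fun n => p n * (twopii R * (a + n%:R * b) * dlam (e_ (z + n%:R * t)))).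
  apply: (summ_le (summZ (K * (T * 4)) (sG j.+1))) => n.
  rewrite [leRHS]ger0_norm; last exact: mulr_ge0 (mulr_ge0 K0 (mulr_ge0 T0 (ler0n _ _))) (n0 j.+1 n).
  rewrite normrM normrM.
  have -> : K * (T * 4) * (n.+1%:R ^+ j.+1 * (E * r) ^+ n) =
     (K * n.+1%:R ^+ j) * ((T * n.+1%:R) * (4 * (E * r) ^+ n)).
    by rewrite exprS; ring.
  apply: ler_pM => //; apply: ler_pM => //.
    by have := wb 1 n; rewrite normr1 !mulr1.
  rewrite /dlam normf_div normrX ler_pdivrMr; last first.
    by rewrite exprn_gt0 // (lt_le_trans h2).
  apply: (le_trans (ub n)); apply: (@le_trans _ _ ((E * r) ^+ n)).
    apply: (@le_trans _ _ (r ^+ n)).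
      by rewrite ler_piMl ?exprn_ge0 ?(ltW r0) // invf_le1 // ler1n.
    by rewrite lerXn2r ?nnegrE ?(ltW r0) // ler_peMl // ltW.
  rewrite [leRHS]mulrAC ler_peMl ?exprn_ge0 //.
  rewrite [leLHS](_ : 1 = 4 * (2^-1) ^+ 2 :> C); last by field.
  by rewrite ler_wpM2l // lerXn2r ?nnegrE // ltW.
exists d => //; split=> //.
  move=> h n hd; apply: contraTneq (uE1 h n hd) => ->.
  by rewrite subrr normr0 (lt_geF h2).
apply: (@is_derive_tsum _ _ (fun n h => p n * lam (e_ (lambert_pt z a t b h n))) _
  (fun n => K * (4 * (T ^+ 2 * E)) * (n.+1%:R ^+ (j + 2) * (E * r) ^+ n)) _ d) => //.
- exact: summZ (sG _).
- by move=> h hd; rewrite add0r; exact: sS.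
move=> n h hd; rewrite add0r.
have l0 : e_ (lambert_pt z a t b 0 n) = e_ (z + n%:R * t).
  by rewrite e_lambert_pt mulr0 mul0r cexp0 mulr1.
rewrite l0; set u := e_ (z + n%:R * t); set w := twopii R * h * (a + n%:R * b).
have lE : e_ (lambert_pt z a t b h n) = u * cexp w by rewrite e_lambert_pt.
have lt := @lam_taylor u w (2^-1) h2 (u1 n) _.
rewrite -lE in lt; have {}lt := lt (uE1 h n hd); rewrite lE in lt.
rewrite lE.
have -> : p n * lam (u * cexp w) - p n * lam u - h * (p n * (twopii R * (a + n%:R * b) * dlam u)) =
   p n * (lam (u * cexp w) - lam u - w * dlam u) by rewrite /w; ring.
rewrite normrM [X in _ <= X * _]ger0_norm; last first.
  by rewrite mulr_ge0 // mulr_ge0 // mulr_ge0 // mulr_ge0 // exprn_ge0.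
have -> : K * (4 * (T ^+ 2 * E)) * (n.+1%:R ^+ (j + 2) * (E * r) ^+ n) * `|h| ^+ 2 =
   (K * n.+1%:R ^+ j) * ((4^-1 * r ^+ n) * 2 / (2^-1) ^+ 3 * ((T * n.+1%:R * `|h|) ^+ 2 * E ^+ n.+1)).
  by rewrite exprD !exprMn [E ^+ n.+1]exprS; field.
apply: ler_pM => //; apply: (le_trans lt).
apply: ler_pM.
- by rewrite divr_ge0 ?exprn_ge0 ?(ltW h2) // mulr_ge0 // addr_ge0.
- by rewrite mulr_ge0 ?exprn_ge0 // cexp_ge0.
- rewrite ler_wpM2r ?invr_ge0 ?exprn_ge0 ?(ltW h2) //; apply: ler_pM => //.
    exact: ub.
  exact: u32.
apply: ler_pM; rewrite ?exprn_ge0 ?cexp_ge0 //; last exact: cb.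
by rewrite lerXn2r ?nnegrE ?mulr_ge0 //; exact: wb.
Qed.

Lemma lam_cexp_diff u (k : C) : u != 1 -> exists2 d : C, 0 < d &
  (forall h, `|h| < d -> u * cexp (k * h) != 1) /\
  is_derive (0 : C) (1 : C) (fun h => lam (u * cexp (k * h))) (k * dlam u).
Proof.
move=> u1; have m0 : 0 < `|1 - u| / 2 by rewrite divr_gt0 // normr_gt0 subr_eq0 eq_sym.
set m := `|1 - u| / 2 in m0; have mE : m + m = `|1 - u| by rewrite /m -splitr.
have mu : m <= `|1 - u| by rewrite -mE lerDl ltW.
have c0 : 0 <= cexp `|k| by exact: cexp_ge0.
have B0 : 0 < `|u| * (`|k| * cexp `|k|) + 1 by rewrite ltr_wpDl // !mulr_ge0.
(* Chosen so that |u (e^(kh) - 1)| <= m, half of |1 - u|; the denominator then stays at least m. *)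
have [d [d0 d1 dm]] := minC_ex (@ltr01 C) (divr_gt0 m0 B0).
clearbody m.
have ck h : `|h| < d -> cexp `|k * h| <= cexp `|k|.
  move=> hd; apply: cexp_le => //; rewrite normrM ler_piMr //.
  by rewrite (le_trans (ltW hd)).
have mh h : `|h| < d -> m <= `|1 - u * cexp (k * h)|.
  move=> hd; have -> : 1 - u * cexp (k * h) = (1 - u) - u * (cexp (k * h) - 1) by ring.
  apply: le_trans (lerB_dist _ _); rewrite lerBrDr -mE lerD2l normrM.
  apply: (@le_trans _ _ (`|u| * (`|k * h| * cexp `|k|))).
    rewrite ler_wpM2l // (le_trans (cexp_sub1_le _)) // ler_wpM2l //; exact: ck.
  have -> : `|u| * (`|k * h| * cexp `|k|) = `|u| * (`|k| * cexp `|k|) * `|h|.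
    by rewrite normrM; ring.
  apply: (@le_trans _ _ ((`|u| * (`|k| * cexp `|k|) + 1) * d)).
    by apply: ler_pM; rewrite ?mulr_ge0 // ?lerDl // ltW.
  by rewrite mulrC -ler_pdivlMr.
exists d => //; split.
  move=> h hd; apply: contraTneq (mh h hd) => ->.
  by rewrite subrr normr0 (lt_geF m0).
apply: (@is_derive_quad R _ _ _ d
  (`|u| * (`|1 - u| + `|u|) / m ^+ 3 * (`|k| ^+ 2 * cexp `|k|))) => // h hd.
rewrite add0r mulr0 cexp0 mulr1 mulrCA mulrA.
apply: (le_trans (lam_taylor m0 mu (mh h hd))).
rewrite -[leRHS]mulrA ler_wpM2l //.
  by rewrite divr_ge0 ?exprn_ge0 ?(ltW m0) // mulr_ge0 // addr_ge0.
rewrite normrM exprMn -mulrA [leRHS]mulrAC -mulrA ler_wpM2l ?exprn_ge0 //.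
rewrite ler_wpM2l ?exprn_ge0 // -normrM; exact: ck.
Qed.

(** Peels off the term n = 0, which may be close to a pole; the rest is a sum of the same kind based
    at z + t, moving in the direction a + b. *)
Lemma lambert_diffS p z a t b : e_ z != 1 ->
  lambert_diff (fun n => p n.+1) (z + t) (a + b) t b -> lambert_diff p z a t b.
Proof.
move=> z1 [d1 d10 [n1 s1 sd1 D1]].
have [d2 d20 [n2 D2]] := lam_cexp_diff (twopii R * a) z1.
have [d [d0 dd1 dd2]] := minC_ex d10 d20.
have ptS h n : lambert_pt (z + t) (a + b) t b h n = lambert_pt z a t b h n.+1.
  by rewrite /lambert_pt -natr1; ring.
have ztS n : z + t + n%:R * t = z + n.+1%:R * t by rewrite -natr1; ring.
have abS n : a + b + n%:R * b = a + n.+1%:R * b by rewrite -natr1; ring.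
have pt0 h : e_ (lambert_pt z a t b h 0) = e_ z * cexp (twopii R * a * h).
  by rewrite e_lambert_pt !mul0r !addr0 mulrAC.
have {}s1 h : `|h| < d1 -> summ (fun n => p n.+1 * lam (e_ (lambert_pt z a t b h n.+1))).
  by move=> /s1; under eq_fun do rewrite ptS.
have {}sd1 : summ (fun n => p n.+1 * (twopii R * (a + n.+1%:R * b) * dlam (e_ (z + n.+1%:R * t)))).
  by move: sd1; under eq_fun do rewrite ztS abS.
have sh h : `|h| < d -> summ (fun n => p n * lam (e_ (lambert_pt z a t b h n))).
  by move=> hd; apply: summ_recl; apply: s1; exact: lt_le_trans dd1.
have sd : summ (fun n => p n * (twopii R * (a + n%:R * b) * dlam (e_ (z + n%:R * t)))).
  exact: summ_recl.
exists d => //; split=> //.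
  move=> h [|n] hd; last by rewrite -ptS; apply: n1; exact: lt_le_trans dd1.
  by rewrite pt0; apply: n2; exact: lt_le_trans dd2.
rewrite (tsum_recl sd) !mul0r !addr0.
have D0 : is_derive (0 : C) (1 : C) (fun h => p 0%N * lam (e_ z * cexp (twopii R * a * h)))
    (p 0%N * (twopii R * a * dlam (e_ z))) by exact: is_deriveZ.
move: D1; under eq_fun do (under eq_fun do rewrite ptS).
under [X in is_derive _ _ _ (tsum X)]eq_fun do rewrite ztS abS.
move=> D1; apply: (is_derive_near d0 _ (is_deriveD D0 D1)) => h hd.
by rewrite add0r fctE -pt0 [RHS](tsum_recl (sh h hd)).
Qed.

(** Finitely many terms are peeled off until the base point satisfies |e(z + N t)| <= 1/4. *)
Lemma lambert_diffP p z a t b (K : C) j : 0 < complex.Im t ->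
  (forall n, `|p n| <= K * n.+1%:R ^+ j) -> (forall n : nat, e_ (z + n%:R * t) != 1) ->
  lambert_diff p z a t b.
Proof.
move=> t0 pK z1.
have [N hN] : exists N : nat, `|e_ (z + N%:R * t)| <= 4^-1.
  have a0 : 0 < 4^-1 / `|e_ z| by rewrite divr_gt0 // ?invr_gt0 // normr_gt0 e_neq0.
  have [|N hN] := exprn_small (r := `|e_ t|) _ a0; first by rewrite normr_ge0 norm_e_lt1.
  exists N; have := hN N (leqnn N); rewrite e_D e_Mn normrM normrX.
  by rewrite ltr_pdivlMr ?normr_gt0 ?e_neq0 // mulrC => /ltW.
elim: N z a p K pK z1 hN => [|N IHN] z a p K pK z1 hN.
  by apply: lambert_diff_tail t0 pK _; rewrite mul0r addr0 in hN.
have ztS n : z + t + n%:R * t = z + n.+1%:R * t by rewrite -natr1; ring.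
apply: lambert_diffS; first by have := z1 0%N; rewrite mul0r addr0.
(* As n + 2 <= 2 (n + 1), shifting the weights by one index costs a factor 2^j. *)
apply: (IHN _ _ _ (K * 2 ^+ j)) => [n|n|]; rewrite ?ztS //.
have K0 : 0 <= K by have := le_trans (normr_ge0 _) (pK 0%N); rewrite expr1n mulr1.
apply: (le_trans (pK _)); rewrite -mulrA ler_wpM2l // -exprMn lerXn2r ?nnegrE ?mulr_ge0 //.
by rewrite -natrM ler_nat; lia.
Qed.

End LambertDerivative.

(** * Derivatives of the moments and of the coefficients h_n *)

Section KroneckerDerivative.
Variable R : realType.
Local Notation C := (Cplx R).
Implicit Types (xi tau h a b : C).

Lemma is_derive_shift (f : C -> C) (x l : C) :
  is_derive (0 : C) (1 : C) (fun h => f (x + h)) l -> is_derive x (1 : C) f l.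
Proof.
move=> [df dl].
have e : (fun h : C => h^-1 *: ((fun k => f (x + k)) (h *: 1 + 0) - (fun k => f (x + k)) 0)) =
    (fun h : C => h^-1 *: (f (h *: 1 + x) - f x)).
  by apply/funext => h /=; rewrite !addr0 [x + _]addrC.
by apply: DeriveDef; rewrite /derivable /derive -e.
Qed.

Lemma Im_near tau : 0 < complex.Im tau ->
  exists2 d : C, 0 < d & forall h, `|h| < d -> 0 < complex.Im (tau + h).
Proof.
move=> t0; exists (complex.Im tau)%:C%C; first by rewrite ltcR.
move=> h; have := Im_le_norm (- h); rewrite normrN => hI /(le_lt_trans hI).
by rewrite ltcR raddfN raddfD /= ltrNl -subr_gt0 opprK addrC.
Qed.

Lemma nonlatticeP tau xi : nonlattice tau xi <->
  (forall n : nat, e_ (xi + n%:R * tau) != 1) /\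
  (forall n : nat, e_ (- xi + tau + n%:R * tau) != 1).
Proof.
have nE n : e_ (- xi + tau + n%:R * tau) = (e_ (xi + (Negz n)%:~R * tau))^-1.
  by rewrite -e_N NegzE mulrNz -pmulrn -natr1; congr e_; ring.
split=> [h|[hP hN] [n|n]].
- by split=> n; [have := h n; rewrite -pmulrn|rewrite nE invr_eq1; exact: h].
- by rewrite -pmulrn; exact: hP.
- by have := hN n; rewrite nE invr_eq1.
Qed.

(** For the index - (n + 1) put v = e(- xi + (n + 1) tau); then 1 / (1 - v^-1) = - v / (1 - v), so
    both halves become sums of [lam] with arguments tending to 0. The sign joins the (-1)^j of the
    weight. *)
Lemma gam_momentE tau xi j : 0 < complex.Im tau -> nonlattice tau xi ->
  gam_moment tau xi j =
  tsum (fun n => n%:R ^+ j * lam (e_ (xi + n%:R * tau))) +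
  tsum (fun n => ((-1) ^+ j.+1 * n.+1%:R ^+ j) * lam (e_ (- xi + tau + n%:R * tau))).
Proof.
move=> t0 /nonlatticeP[hP hN].
have [sP sN] := summ_int_halves (summ_gam_moment t0 xi j).
rewrite /gam_moment; have [_ ->] := @int_sumP R (fun n => n%:~R ^+ j * gam tau xi n) sP sN; congr (_ + _); congr tsum.
  apply/funext => n; rewrite -pmulrn; congr (_ * _); rewrite /gam -pmulrn /lam.
  have := hP n; rewrite eq_sym -subr_eq0 => h /=; by field.
apply/funext => n; rewrite /gam NegzE mulrNz -pmulrn subr0.
have -> : e_ (xi + - n.+1%:R * tau) = (e_ (- xi + tau + n%:R * tau))^-1.
  by rewrite -e_N -natr1; congr e_; ring.
have v0 := e_neq0 (- xi + tau + n%:R * tau); have := hN n.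
set v := e_ _ in v0 *; rewrite eq_sym -subr_eq0 => v1.
have -> : 1 - v^-1 = - (1 - v) / v by field.
rewrite /lam invf_div invrN mulrN -mulNr.
rewrite [X in X * _](_ : _ = (-1) ^+ j * n.+1%:R ^+ j); last exact: exprNn.
by rewrite exprS; ring.
Qed.

(** The derivative of the j-th moment when (xi, tau) moves in the direction (a, b); the base point -
    xi + tau of the second series then moves in the direction - a + b. *)
Definition gam_deriv tau xi j a b :=
  tsum (fun n => n%:R ^+ j * (twopii R * (a + n%:R * b) * dlam (e_ (xi + n%:R * tau)))) +
  tsum (fun n => ((-1) ^+ j.+1 * n.+1%:R ^+ j) *
    (twopii R * (- a + b + n%:R * b) * dlam (e_ (- xi + tau + n%:R * tau)))).

(* The heat equation 2 pi i dF/dtau = d^2 F/dxi deta, read on moments. *)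
Lemma gam_deriv_heat tau xi j : gam_deriv tau xi j 0 1 = gam_deriv tau xi j.+1 1 0.
Proof.
rewrite /gam_deriv; congr (_ + _); congr tsum; apply/funext => n.
  by rewrite exprS; ring.
by rewrite !exprS -natr1; ring.
Qed.

(** Both series of [gam_momentE] are covered by [lambert_diffP]. The first conclusion, openness of
    the domain along the line, comes with it and is reused for holomorphy. *)
Lemma is_derive_gam tau xi j a b : 0 < complex.Im tau -> nonlattice tau xi ->
  (exists2 d : C, 0 < d & forall h, `|h| < d ->
     0 < complex.Im (tau + h * b) /\ nonlattice (tau + h * b) (xi + h * a)) /\
  is_derive (0 : C) (1 : C) (fun h => gam_moment (tau + h * b) (xi + h * a) j)
    (gam_deriv tau xi j a b).
Proof.
move=> t0 hxi; have /nonlatticeP[hP hN] := hxi.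
have pP n : `|n%:R ^+ j : C| <= 1 * n.+1%:R ^+ j.
  by rewrite normrX normr_nat mul1r lerXn2r ?nnegrE // ler_nat.
have pN n : `|(-1) ^+ j.+1 * n.+1%:R ^+ j : C| <= 1 * n.+1%:R ^+ j.
  by rewrite normrM !normrX normrN normr1 expr1n normr_nat.
have [d1 d10 [n1 s1 sd1 D1]] := lambert_diffP a b t0 pP hP.
have [d2 d20 [n2 s2 sd2 D2]] := lambert_diffP (- a + b) b t0 pN hN.
have [d3 d30 h3] := Im_near t0.
have b1 : 0 < `|b| + 1 by rewrite ltr_wpDl.
have [d' [d'0 d'1 d'2]] := minC_ex d10 d20.
have [d [d0 dd' dd3]] := minC_ex d'0 (divr_gt0 d30 b1).
have near h : `|h| < d -> 0 < complex.Im (tau + h * b) /\ nonlattice (tau + h * b) (xi + h * a).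
  move=> hd; split.
    apply: h3; apply: (@le_lt_trans _ _ (`|h| * (`|b| + 1))).
      by rewrite normrM ler_wpM2l // lerDl.
    by rewrite -ltr_pdivlMr //; exact: lt_le_trans dd3.
  apply/nonlatticeP; split=> n.
    apply: (n1 h n); apply: lt_le_trans hd _; exact: le_trans dd' d'1.
  have := n2 h n (lt_le_trans hd (le_trans dd' d'2)); congr (e_ _ != 1).
  by rewrite /lambert_pt; ring.
split; first by exists d.
apply: (is_derive_near d0 _ (is_deriveD D1 D2)) => h /near[h0 hl].
rewrite add0r fctE gam_momentE //; congr (_ + _); congr tsum; apply/funext => n.
by congr (_ * lam (e_ _)); rewrite /lambert_pt; ring.
Qed.

Definition kron_deriv tau xi n a b : C :=
  if n is m.+1 then - (twopii R * (twopii R ^+ m / m`!%:R * gam_deriv tau xi m a b)) else 0.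

Lemma is_derive_kron tau xi n a b : 0 < complex.Im tau -> nonlattice tau xi ->
  is_derive (0 : C) (1 : C) (fun h => kron_coef (tau + h * b) (xi + h * a) n)
    (kron_deriv tau xi n a b).
Proof.
move=> t0 hxi; case: n => [|m] /=.
  by under eq_fun do rewrite kron_coef0; exact: is_derive_cst.
have [_ D] := is_derive_gam m a b t0 hxi.
have D' := is_deriveB (is_derive_cst (bern R m.+1 * twopii R ^+ m.+1 : C) (0 : C) (1 : C))
  (is_deriveZ (twopii R) (is_deriveZ (twopii R ^+ m / m`!%:R) D)).
by apply: is_derive_eq; rewrite sub0r.
Qed.

Lemma is_derive_kron_xi tau xi n : 0 < complex.Im tau -> nonlattice tau xi ->
  is_derive xi (1 : C) (fun s => kron_coef tau s n) (kron_deriv tau xi n 1 0).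
Proof.
move=> t0 hxi; apply: is_derive_shift; have := is_derive_kron n 1 0 t0 hxi.
by under eq_fun do rewrite mulr0 addr0 mulr1.
Qed.

Lemma is_derive_kron_tau tau xi n : 0 < complex.Im tau -> nonlattice tau xi ->
  is_derive tau (1 : C) (fun s => kron_coef s xi n) (kron_deriv tau xi n 0 1).
Proof.
move=> t0 hxi; apply: is_derive_shift; have := is_derive_kron n 0 1 t0 hxi.
by under eq_fun do rewrite mulr0 addr0 mulr1.
Qed.

(** The coefficients of the dtau and dxi parts of nu are n h_(n+1) / (2 pi i) and h_n, so this is
    closedness of nu in each degree. The Bernoulli parts of the coefficients are constants and drop
    out. *)
Lemma kron_deriv_heat tau xi n :
  (twopii R)^-1 * (n%:R * kron_deriv tau xi n.+1 1 0) = kron_deriv tau xi n 0 1.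
Proof.
have t0 := twopii_neq0 R.
case: n => [|m] /=; first by rewrite mul0r mulr0.
rewrite gam_deriv_heat exprS factS natrM; field; rewrite t0 !pnatr_eq0 /=.
by rewrite -lt0n fact_gt0 addrC natr1 pnatr_eq0.
Qed.

Lemma nonlattice_near_xi tau xi : 0 < complex.Im tau -> nonlattice tau xi ->
  exists2 d : C, 0 < d & forall h, `|h| < d -> nonlattice tau (xi + h).
Proof.
move=> t0 hxi; have [[d d0 hd] _] := is_derive_gam 0 1 0 t0 hxi; exists d => // h /hd[_].
by rewrite mulr0 addr0 mulr1.
Qed.

Lemma nonlattice_near_tau tau xi : 0 < complex.Im tau -> nonlattice tau xi ->
  exists2 d : C, 0 < d & forall h, `|h| < d ->
    0 < complex.Im (tau + h) /\ nonlattice (tau + h) xi.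
Proof.
move=> t0 hxi; have [[d d0 hd] _] := is_derive_gam 0 0 1 t0 hxi; exists d => // h /hd[].
by rewrite mulr0 addr0 mulr1.
Qed.

(** The Lambert form of the Eisenstein series is a sum over [lam] at e((n + 1) tau): base point and
    step are both tau and move together. *)
Lemma derivable_psi_coef tau m : 0 < complex.Im tau ->
  derivable (fun s : C => psi_coef s m) tau 1.
Proof.
move=> t0; pose p n : C := n.+1%:R ^+ m.*2.+1.
have pP n : `|p n| <= 1 * n.+1%:R ^+ m.*2.+1 by rewrite normrX normr_nat mul1r.
have q1 n : e_ (tau + n%:R * tau) != 1.
  apply: contraTneq (_ : `|e_ (tau + n%:R * tau)| < 1) => [->|].
    by rewrite normr1 ltxx.
  have -> : tau + n%:R * tau = n.+1%:R * tau by rewrite -natr1; ring.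
  by rewrite e_Mn normrX exprn_ilt1 // norm_e_lt1.
have [d1 d10 [_ _ _ D]] := lambert_diffP 1 1 t0 pP q1.
have [d2 d20 h2] := Im_near t0; have [d [d0 dd1 dd2]] := minC_ex d10 d20.
have D' := is_deriveZ (twopii R ^+ m.*2.+1 / m.*2`!%:R : C) (is_deriveD
  (is_derive_cst (- (bern R m.+1.*2 * m.+1.*2`!%:R / (4 * m.+1)%:R) : C) (0 : C) (1 : C)) D).
suff [l Dl] : exists l, is_derive (0 : C) (1 : C) (fun h : C => psi_coef (tau + h) m) l.
  by have [] := @is_derive_shift (fun s => psi_coef s m) tau l Dl.
eexists; apply: (is_derive_near d0 _ D') => h hd.
rewrite add0r /psi_coef eisenstein2E; last by apply: h2; exact: lt_le_trans dd2.
rewrite !fctE; congr (_ * (_ + _)); congr tsum; apply/funext => n.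
have -> : lambert_pt tau 1 tau 1 h n = n.+1%:R * (tau + h).
  by rewrite /lambert_pt -natr1; ring.
by rewrite e_Mn.
Qed.

End KroneckerDerivative.

(** * Coefficients of [omega] as finite sums, and their derivatives *)

Section KzbIntegrability.
Variable R : realType.
Local Notation C := (Cplx R).
Implicit Types (xi tau : C) (x : liealg C) (w : seq bool).

Lemma is_derive_sumZ (f : nat -> C -> C) (k l : nat -> C) M (s : C) :
  (forall n, is_derive s (1 : C) (f n) (l n)) ->
  is_derive s (1 : C) (fun t => \sum_(n < M) k n * f n t) (\sum_(n < M) k n * l n).
Proof.
move=> D; have := @is_derive_sum _ _ _ M (fun n => k n \*: f n) s (1 : C) (fun n => k n *: l n).
move=> /(_ (fun n => is_deriveZ _ (D n))); congr is_derive.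
by apply/funext => t; rewrite fct_sumE.
Qed.

Let kap x w n : C := lie_val (lie_br (iter n (lie_br gen_t) gen_a) x) w.

Lemma coef_dxi xi tau x w : 0 < complex.Im tau -> nonlattice tau xi ->
  coef (dxi_part (omega R) xi tau) x w =
  \sum_(n < (size w).+1) kap x w n * kron_coef tau xi n.
Proof.
move=> t0 hxi; rewrite /coef [LHS]ps_act_br tFE //.
by apply: eq_bigr => n _; rewrite mulrC.
Qed.

Lemma coef_dtau xi tau x w : 0 < complex.Im tau -> nonlattice tau xi ->
  coef (dtau_part (omega R) xi tau) x w =
  (twopii R)^-1 * lie_val (der_t gen_a x) w +
  \sum_(m < (size w).+1) lie_val (der_a (alt_br C m.+1) x) w * psi_coef tau m.+1 +
  \sum_(n < (size w).+1) (twopii R)^-1 * (n%:R * kap x w n) * kron_coef tau xi n.+1.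
Proof.
move=> t0 hxi; rewrite /coef.
rewrite [lie_val (dtau_part _ _ _ _) w]lie_valD [lie_val ((_ + _ : der C) _) w]lie_valD.
congr (_ + _ + _).
- by apply: eq_bigr => m _; rewrite mulrC; exact: lie_valZ.
rewrite [lie_val (\val _ _) w](congr1 (fun x => lie_val x w) (lie_brZl _ _ _)).
rewrite lie_valZ ps_act_br mulr_sumr; apply: eq_bigr => n _.
by rewrite tdFE // /kap; ring.
Qed.

Lemma omega_derivatives xi tau x w : 0 < complex.Im tau -> nonlattice tau xi ->
  [/\ derivable (fun s : C => coef (dxi_part (omega R) s tau) x w) xi 1,
      is_derive tau (1 : C) (fun s : C => coef (dxi_part (omega R) xi s) x w)
        (\sum_(n < (size w).+1) kap x w n * kron_deriv tau xi n 0 1),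
      is_derive xi (1 : C) (fun s : C => coef (dtau_part (omega R) s tau) x w)
        (\sum_(n < (size w).+1) (twopii R)^-1 * (n%:R * kap x w n) * kron_deriv tau xi n.+1 1 0) &
      derivable (fun s : C => coef (dtau_part (omega R) xi s) x w) tau 1].
Proof.
move=> t0 hxi; have [d1 d10 h1] := nonlattice_near_xi t0 hxi.
have [d2 d20 h2] := nonlattice_near_tau t0 hxi; split.
- have D := is_derive_sumZ (kap x w) (size w).+1 (fun n => is_derive_kron_xi n t0 hxi).
  suff [] : is_derive xi (1 : C) (fun s : C => coef (dxi_part (omega R) s tau) x w)
     (\sum_(n < (size w).+1) kap x w n * kron_deriv tau xi n 1 0) by [].
  by apply: (is_derive_near d10 _ D) => h /h1 hl; rewrite coef_dxi.
- have D := is_derive_sumZ (kap x w) (size w).+1 (fun n => is_derive_kron_tau n t0 hxi).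
  by apply: (is_derive_near d20 _ D) => h /h2[h0 hl]; rewrite coef_dxi.
- have D := is_derive_sumZ (fun n => (twopii R)^-1 * (n%:R * kap x w n)) (size w).+1
    (fun n => is_derive_kron_xi n.+1 t0 hxi).
  (* Of the dtau part only nu depends on xi; the contributions of a d/dt and psi are constants
     here. *)
  have D' := is_deriveD (is_derive_cst ((twopii R)^-1 * lie_val (der_t gen_a x) w +
    \sum_(m < (size w).+1) lie_val (der_a (alt_br C m.+1) x) w * psi_coef tau m.+1 : C) xi (1 : C)) D.
  rewrite add0r in D'.
  by apply: (is_derive_near d10 _ D') => h /h1 hl; rewrite coef_dtau.
- have D1 := is_derive_sumZ (fun n => (twopii R)^-1 * (n%:R * kap x w n)) (size w).+1
    (fun n => is_derive_kron_tau n.+1 t0 hxi).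
  have D2 := is_derive_sumZ (fun m => lie_val (der_a (alt_br C m.+1) x) w) (size w).+1
    (fun m => derivableP (@derivable_psi_coef R tau m.+1 t0)).
  have D := is_deriveD (is_deriveD
    (is_derive_cst ((twopii R)^-1 * lie_val (der_t gen_a x) w : C) tau (1 : C)) D2) D1.
  suff [l Dl] : exists l, is_derive tau (1 : C) (fun s : C => coef (dtau_part (omega R) xi s) x w) l.
    by have [] := Dl.
  by eexists; apply: (is_derive_near d20 _ D) => h /h2[h0 hl]; rewrite coef_dtau.
Qed.

End KzbIntegrability.

Theorem lemma9p19 (R : realType) :
  (forall xi tau : Cplx R, kzb_domain R (xi, tau) ->
     form_br (omega R) (omega R) xi tau = 0) /\
  integrable_form (kzb_domain R) (omega R).
Proof.
have br0 (xi tau : Cplx R) : kzb_domain R (xi, tau) ->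
    form_br (omega R) (omega R) xi tau = 0.
  by move=> /kzb_domainP[t0 hxi]; exact: omega_br0.
split; first exact: br0.
split=> [xi tau /kzb_domainP[t0 hxi] x w|xi tau dom x w].
  have [D1 [D2 _] [D3 _] D4] := omega_derivatives x w t0 hxi.
  by split; [exact: D1|exact: D2|exact: D3|exact: D4].
have /kzb_domainP[t0 hxi] := dom.
rewrite (br0 xi tau dom) [coef 0 x w](_ : _ = 0) // mulr0 addr0.
have [_ D1 D2 _] := omega_derivatives x w t0 hxi.
rewrite /form_d (is_derive1E D1) (is_derive1E D2) -sumrB big1 // => n _.
by rewrite -(kron_deriv_heat tau xi n); ring.
Qed.
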